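(* Let $A$ and $B$ be noetherian rings, and let ${}_BM_A$ and ${}_AN_B$ be bimodules, each finitely generated both as a left and as a right module. Let $\Lambda_{(0,0)}=\left(\begin{smallmatrix}A&N\\ M&B\end{smallmatrix}\right)$ be the Morita context ring with both bimodule homomorphisms zero. The following are equivalent. (1) ${}_AN_B$ and ${}_BM_A$ are weakly compatible bimodules; $({}_AN,0,0,0)$ and $(M_A,0,0,0)$ are semi-weakly compatible left and right $\Lambda_{(0,0)}$-modules, respectively. (2) For every finitely generated left $\Lambda_{(0,0)}$-module $(X,Y,f,g)$: $(X,Y,f,g)$ is Gorenstein-projective if and only if both of the following hold: (a) ${}_B\mathrm{Coker}(f)$ and ${}_A\mathrm{Coker}(g)$ are Gorenstein-projective; (b) there are isomorphisms $\mathrm{Im}(f)\simeq M\otimes_A\mathrm{Coker}(g)$ of left $B$-modules and $\mathrm{Im}(g)\simeq N\otimes_B\mathrm{Coker}(f)$ of left $A$-modules.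
   Context: Rings are unital and associative; noetherian means left and right noetherian; modules are finitely generated. For a ring $R$, $R\text{-proj}$ is the category of finitely generated projective left $R$-modules. $\Lambda_{(0,0)}$ is the set of matrices $\left(\begin{smallmatrix}a&n\\ m&b\end{smallmatrix}\right)$ ($a\in A,n\in N,m\in M,b\in B$) with multiplication $\left(\begin{smallmatrix}a&n\\ m&b\end{smallmatrix}\right)\left(\begin{smallmatrix}a'&n'\\ m'&b'\end{smallmatrix}\right)=\left(\begin{smallmatrix}aa'&an'+nb'\\ ma'+bm'&bb'\end{smallmatrix}\right)$. A left $\Lambda_{(0,0)}$-module is a quadruple $(X,Y,f,g)$ with $X$ a left $A$-module, $Y$ a left $B$-module, $f:M\otimes_AX\to Y$ a $B$-homomorphism and $g:N\otimes_BY\to X$ an $A$-homomorphism such that $g(n\otimes f(m\otimes x))=0$ and $f(m\otimes g(n\otimes y))=0$. A right $\Lambda_{(0,0)}$-module is similarly a quadruple $(C_A,D_B,h,k)$ with $h:C\otimes_AN\to D$ and $k:D\otimes_BM\to C$ homomorphisms of right modules satisfying the analogous vanishing conditions. A complex $P^\bullet$ of left $R$-modules is totally exact if it is exact and $\mathrm{Hom}_R(P^\bullet,R)$ is exact. A left $R$-module $X$ is Gorenstein-projective if $X=\mathrm{Ker}(d_P^0)$ for some totally exact complex $P^\bullet$ of projective left $R$-modules. A left $R$-module $X$ is semi-weakly compatible if $\mathrm{Hom}_R(P^\bullet,X)$ is exact for every totally exact complex $P^\bullet$ with terms in $R\text{-proj}$. A right $R$-module $Y$ is semi-weakly compatible if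 $Y\otimes_RQ^\bullet$ is exact for every totally exact complex $Q^\bullet$ with terms in $R\text{-proj}$. A bimodule ${}_RU_S$ is weakly compatible if ${}_RU$ and $U_S$ are both semi-weakly compatible. *)

(* Defs.v *)
From HB Require Import structures.
From mathcomp Require Import all_boot ssralg ssrint matrix.
From mathcomp Require Import generic_quotient ring_quotient boolp.
From mathcomp.multinomials Require Import freeg.

Set Implicit Arguments.
Unset Strict Implicit.
Unset Printing Implicit Defensive.

Import GRing.Theory.
Local Open Scope ring_scope.
Local Open Scope quotient_scope.

(* Conventions: rings are [pzRingType] (unital, associative, the zero ring
   allowed); a right R-module is an [lmodType] over the converse ring [R^c],
   so that [(r : R^c) *: c] is the product c r. *)

Section FiniteGeneration.
Variables (R : pzRingType) (V : lmodType R).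

Definition finitely_generated : Prop :=
  exists (n : nat) (v : 'I_n -> V),
    forall x : V, exists c : 'I_n -> R, x = \sum_(i < n) c i *: v i.

Definition projective : Prop :=
  forall (U W : lmodType R) (g : {linear U -> W}) (h : {linear V -> W}),
    (forall w, exists u, g u = w) ->
    exists k : {linear V -> U}, forall v, g (k v) = h v.

End FiniteGeneration.

Definition left_ideal (R : pzRingType) (I : R -> Prop) : Prop :=
  [/\ I 0, forall x y, I x -> I y -> I (x + y) & forall r x, I x -> I (r * x)].

Definition left_noetherian (R : pzRingType) : Prop :=
  forall I : nat -> R -> Prop,
    (forall n, left_ideal (I n)) ->
    (forall n x, I n x -> I n.+1 x) ->
    exists n0, forall n, (n0 <= n)%N -> forall x, I n x -> I n0 x.

Definition noetherian (R : pzRingType) : Prop :=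
  left_noetherian R /\ left_noetherian R^c.

Definition lmod_iso (R : pzRingType) (U V : lmodType R) : Prop :=
  exists f : {linear U -> V}, bijective f.

Section KernelImageCokernel.
Variables (R : pzRingType) (U V : lmodType R) (f : {linear U -> V}).

Definition ker_pred : pred U := fun u => f u == 0.

Lemma ker_pred_submod : submod_closed ker_pred.
Proof.
split=> [|a u v]; rewrite !unfold_in /ker_pred ?linear0 //.
by move=> /eqP fu /eqP fv; rewrite linearP fu fv scaler0 addr0.
Qed.

Definition im_pred : pred V := fun v => `[< exists u, f u = v >].

Lemma im_predP v : reflect (exists u, f u = v) (v \in im_pred).
Proof. exact: asboolP. Qed.

Lemma im_pred_submod : submod_closed im_pred.
Proof.
split=> [|a v w]; first by apply/im_predP; exists 0; rewrite linear0.
move=> /im_predP[u <-] /im_predP[u' <-].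
by apply/im_predP; exists (a *: u + u'); rewrite linearP.
Qed.

End KernelImageCokernel.

HB.instance Definition _ (R : pzRingType) (U V : lmodType R)
    (f : {linear U -> V}) :=
  GRing.isSubmodClosed.Build R U (ker_pred f)
    (GRing.submod_closed_semi (ker_pred_submod f)).
HB.instance Definition _ (R : pzRingType) (U V : lmodType R)
    (f : {linear U -> V}) :=
  GRing.isSubmodClosed.Build R V (im_pred f)
    (GRing.submod_closed_semi (im_pred_submod f)).

Definition ker_mod (R : pzRingType) (U V : lmodType R) (f : {linear U -> V}) :=
  {u : U | ker_pred f u}.
HB.instance Definition _ (R : pzRingType) (U V : lmodType R)
    (f : {linear U -> V}) :=
  SubChoice.on (ker_mod f).
HB.instance Definition _ (R : pzRingType) (U V : lmodType R)
    (f : {linear U -> V}) :=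
  GRing.SubChoice_isSubLmodule.Build R U (ker_pred f) (ker_mod f)
    (GRing.submod_closed_semi (ker_pred_submod f)).

Definition im_mod (R : pzRingType) (U V : lmodType R) (f : {linear U -> V}) :=
  {v : V | im_pred f v}.
HB.instance Definition _ (R : pzRingType) (U V : lmodType R)
    (f : {linear U -> V}) :=
  SubChoice.on (im_mod f).
HB.instance Definition _ (R : pzRingType) (U V : lmodType R)
    (f : {linear U -> V}) :=
  GRing.SubChoice_isSubLmodule.Build R V (im_pred f) (im_mod f)
    (GRing.submod_closed_semi (im_pred_submod f)).

Definition coker_mod (R : pzRingType) (U V : lmodType R)
    (f : {linear U -> V}) : Type :=
  Quotient.quot (GRing.ZmodClosed.clone V (im_pred f) _).
HB.instance Definition _ (R : pzRingType) (U V : lmodType R)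
    (f : {linear U -> V}) :=
  GRing.Zmodule.on (coker_mod f).

Section CokernelModule.
Variables (R : pzRingType) (U V : lmodType R) (f : {linear U -> V}).
Implicit Types (a b : R) (x y : coker_mod f).

Definition coker_pi (v : V) : coker_mod f :=
  \pi_(Quotient.quot (GRing.ZmodClosed.clone V (im_pred f) _)) v.

Lemma coker_pi_zmod : zmod_morphism coker_pi.
Proof. by move=> u v; rewrite /coker_pi raddfB. Qed.
HB.instance Definition _ :=
  GRing.isZmodMorphism.Build V (coker_mod f) coker_pi coker_pi_zmod.

Lemma coker_pi_repr x : coker_pi (repr x) = x.
Proof. exact: reprK. Qed.

Lemma coker_piP u v : coker_pi u = coker_pi v <-> exists w, f w = u - v.
Proof.
split=> [/eqP|[w fw]].
  by rewrite /coker_pi -Quotient.idealrBE => /im_predP.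
by apply/eqP; rewrite /coker_pi -Quotient.idealrBE; apply/im_predP; exists w.
Qed.

Definition coker_scale a x : coker_mod f := coker_pi (a *: repr x).

Lemma coker_scale_pi a v : coker_scale a (coker_pi v) = coker_pi (a *: v).
Proof.
apply/coker_piP; have /coker_piP[w fw] := coker_pi_repr (coker_pi v).
by exists (a *: w); rewrite linearZ fw /= -scalerBr.
Qed.

Lemma coker_scaleA a b x :
  coker_scale a (coker_scale b x) = coker_scale (a * b) x.
Proof. by rewrite -[x]coker_pi_repr !coker_scale_pi scalerA. Qed.

Lemma coker_scale1 : left_id 1 coker_scale.
Proof. by move=> x; rewrite -[x]coker_pi_repr coker_scale_pi scale1r. Qed.

Lemma coker_scaleDr : right_distributive coker_scale +%R.
Proof.
move=> a x y; rewrite -[x]coker_pi_repr -[y]coker_pi_repr.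
by rewrite -raddfD !coker_scale_pi scalerDr raddfD.
Qed.

Lemma coker_scaleDl x : {morph coker_scale^~ x : a b / a + b}.
Proof.
by move=> a b; rewrite -[x]coker_pi_repr !coker_scale_pi scalerDl raddfD.
Qed.

HB.instance Definition _ := GRing.Zmodule_isLmodule.Build R (coker_mod f)
  coker_scaleA coker_scale1 coker_scaleDr coker_scaleDl.

Lemma coker_pi_scalable : scalable coker_pi.
Proof. by move=> a v; rewrite -coker_scale_pi. Qed.
HB.instance Definition _ :=
  GRing.isScalable.Build R V (coker_mod f) *:%R coker_pi coker_pi_scalable.

End CokernelModule.

Lemma zmod_morphismD (U V : zmodType) (F : U -> V) :
  zmod_morphism F -> {morph F : x y / x + y}.
Proof.
move=> FB x y; have F0 : F 0 = 0 by rewrite -(subrr 0) FB subrr.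
by rewrite -[y in LHS]opprK FB -(sub0r y) FB F0 sub0r opprK.
Qed.

Section Tensor.
Variables (R : pzRingType) (C : lmodType R^c) (X : lmodType R).

Inductive tensor_rel : {freeg (C * X) / int} -> Prop :=
| tensor_rel0 : tensor_rel 0
| tensor_relB s t : tensor_rel s -> tensor_rel t -> tensor_rel (s - t)
| tensor_relDl c c' x :
    tensor_rel (<< (c + c', x) >> - << (c, x) >> - << (c', x) >>)
| tensor_relDr c x x' :
    tensor_rel (<< (c, x + x') >> - << (c, x) >> - << (c, x') >>)
| tensor_relM (r : R) c x :
    tensor_rel (<< ((r : R^c) *: c, x) >> - << (c, r *: x) >>).

Definition tensor_pred : pred {freeg (C * X) / int} :=
  fun s => `[< tensor_rel s >].

Lemma tensor_predP s : reflect (tensor_rel s) (s \in tensor_pred).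
Proof. exact: asboolP. Qed.

Lemma tensor_pred_zmod : zmod_closed tensor_pred.
Proof.
split=> [|s t /tensor_predP rs /tensor_predP rt]; apply/tensor_predP.
  exact: tensor_rel0.
exact: tensor_relB.
Qed.

HB.instance Definition _ :=
  GRing.isZmodClosed.Build {freeg (C * X) / int} tensor_pred tensor_pred_zmod.

Definition tensor : Type :=
  Quotient.quot (GRing.ZmodClosed.clone {freeg (C * X) / int} tensor_pred _).
HB.instance Definition _ := GRing.Zmodule.on tensor.

Definition tensor_pi (s : {freeg (C * X) / int}) : tensor :=
  \pi_(Quotient.quot
        (GRing.ZmodClosed.clone {freeg (C * X) / int} tensor_pred _)) s.

Lemma tensor_pi_zmod : zmod_morphism tensor_pi.
Proof. by move=> u v; rewrite /tensor_pi raddfB. Qed.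
HB.instance Definition _ :=
  GRing.isZmodMorphism.Build _ tensor tensor_pi tensor_pi_zmod.

Lemma tensor_piP s t : tensor_pi s = tensor_pi t <-> tensor_rel (s - t).
Proof.
split=> [/eqP|st].
  by rewrite /tensor_pi -Quotient.idealrBE => /tensor_predP.
by apply/eqP; rewrite /tensor_pi -Quotient.idealrBE; apply/tensor_predP.
Qed.

Lemma tensor_pi_repr t : tensor_pi (repr t) = t.
Proof. exact: reprK. Qed.

(* The elementary tensor [c (x) x]. *)
Definition tens (c : C) (x : X) : tensor := tensor_pi << (c, x) >>.

Lemma tensDl c c' x : tens (c + c') x = tens c x + tens c' x.
Proof.
rewrite /tens -raddfD; apply/tensor_piP.
by rewrite opprD addrA; apply: tensor_relDl.
Qed.

Lemma tensDr c x x' : tens c (x + x') = tens c x + tens c x'.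
Proof.
rewrite /tens -raddfD; apply/tensor_piP.
by rewrite opprD addrA; apply: tensor_relDr.
Qed.

Lemma tensM (r : R) c x : tens ((r : R^c) *: c) x = tens c (r *: x).
Proof. by apply/tensor_piP; apply: tensor_relM. Qed.

Definition balanced (V : zmodType) (phi : C -> X -> V) : Prop :=
  [/\ forall c c' x, phi (c + c') x = phi c x + phi c' x,
      forall c x x', phi c (x + x') = phi c x + phi c x'
    & forall (r : R) c x, phi ((r : R^c) *: c) x = phi c (r *: x)].

Section Lift.
Variables (V : zmodType) (phi : C -> X -> V).

Definition freeg_lift (s : {freeg (C * X) / int}) : V :=
  @fglift int (zmodule V) (C * X)%type (fun cx => phi cx.1 cx.2) s.

Lemma freeg_lift_zmod : zmod_morphism freeg_lift.
Proof. exact: (@lift_is_additive int (C * X)%type (zmodule V)). Qed.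
HB.instance Definition _ :=
  GRing.isZmodMorphism.Build _ V freeg_lift freeg_lift_zmod.

Lemma freeg_liftU c x : freeg_lift << (c, x) >> = phi c x.
Proof. by rewrite /freeg_lift liftU scale1r. Qed.

(* The additive map induced by [phi]; meaningful when [phi] is balanced. *)
Definition tensor_lift (t : tensor) : V := freeg_lift (repr t).

Hypothesis phi_bal : balanced phi.

Lemma freeg_lift_rel s : tensor_rel s -> freeg_lift s = 0.
Proof.
have [phiDl phiDr phiM] := phi_bal.
elim=> {s} [|s t _ s0 _ t0|c c' x|c x x'|r c x];
  rewrite ?raddf0 ?raddfB /= ?raddfB /= //.
- by rewrite s0 t0 subr0.
- by rewrite !freeg_liftU phiDl addrAC addrK subrr.
- by rewrite !freeg_liftU phiDr addrAC addrK subrr.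
- by rewrite !freeg_liftU phiM subrr.
Qed.

Lemma tensor_lift_pi s : tensor_lift (tensor_pi s) = freeg_lift s.
Proof.
apply/eqP; rewrite -subr_eq0 -raddfB; apply/eqP/freeg_lift_rel.
exact/tensor_piP/tensor_pi_repr.
Qed.

Lemma tensor_lift_tens c x : tensor_lift (tens c x) = phi c x.
Proof. by rewrite tensor_lift_pi freeg_liftU. Qed.

Lemma tensor_lift_zmod : zmod_morphism tensor_lift.
Proof.
move=> s t; rewrite -[s]tensor_pi_repr -[t]tensor_pi_repr -raddfB.
by rewrite !tensor_lift_pi raddfB.
Qed.

End Lift.

Lemma tensor_ind (P : tensor -> Prop) :
  P 0 -> (forall s t, P s -> P t -> P (s - t)) -> (forall c x, P (tens c x)) ->
  forall t, P t.
Proof.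
move=> P0 PB Pt t; rewrite -[t]tensor_pi_repr -[repr t]freeg_sumE.
have PN s : P s -> P (- s) by move=> Ps; rewrite -sub0r; apply: PB.
have PD s s' : P s -> P s' -> P (s + s').
  by move=> Ps Ps'; rewrite -[s']opprK; apply: PB => //; apply: PN.
rewrite raddf_sum; elim/big_ind: _ => // -[c x] _.
have PMn n s : P s -> P (s *+ n).
  by move=> Ps; elim: n => [|n IHn]; rewrite ?mulr0n ?mulrSr //; apply: PD.
have -> k : << k *g (c, x) >> = << (c, x) >> *~ k :> {freeg (C * X) / int}.
  by rewrite freegU_mulz intz.
rewrite raddfMz; case: (coeff _ _) => n; first exact/PMn/Pt.
exact/PN/PMn/Pt.
Qed.

Lemma tensor_eq (V : zmodType) (F G : tensor -> V) :
  zmod_morphism F -> zmod_morphism G ->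
  (forall c x, F (tens c x) = G (tens c x)) -> F =1 G.
Proof.
move=> Fadd Gadd FG; elim/tensor_ind=> [|s t IHs IHt|c x]; last exact: FG.
  by rewrite -(subrr 0) Fadd Gadd !subrr.
by rewrite Fadd Gadd IHs IHt.
Qed.

End Tensor.

(* The map [id_C (x) f]. *)
Definition tensor_map (R : pzRingType) (C : lmodType R^c) (X X' : lmodType R)
    (f : {linear X -> X'}) : tensor C X -> tensor C X' :=
  tensor_lift (fun (c : C) (x : X) => tens c (f x)).

Lemma tensor_map_balanced (R : pzRingType) (C : lmodType R^c)
    (X X' : lmodType R) (f : {linear X -> X'}) :
  balanced (fun (c : C) (x : X) => tens c (f x)).
Proof.
split=> *; first exact: tensDl.
  by rewrite linearD tensDr.
by rewrite linearZ tensM.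
Qed.

Lemma tensor_map_tens (R : pzRingType) (C : lmodType R^c) (X X' : lmodType R)
    (f : {linear X -> X'}) c x :
  tensor_map f (tens c x) = tens c (f x) :> tensor C X'.
Proof. exact/tensor_lift_tens/tensor_map_balanced. Qed.

(* An S-R-bimodule is a left S-module with a commuting right R-action
   [rscale]; the underlying right R-module is [right_of U]. *)
HB.mixin Record Lmodule_isBimodule (S R : pzRingType) U
    of GRing.Lmodule S U := {
  rscale : U -> R -> U;
  rscaleA : forall u r r', rscale (rscale u r) r' = rscale u (r * r');
  rscale1 : forall u, rscale u 1 = u;
  rscaleDl : forall u v r, rscale (u + v) r = rscale u r + rscale v r;
  rscaleDr : forall u r r', rscale u (r + r') = rscale u r + rscale u r';
  scale_rscale : forall s u r, s *: rscale u r = rscale (s *: u) r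
}.

#[short(type="bimodType")]
HB.structure Definition Bimodule (S R : pzRingType) :=
  {U of GRing.Lmodule S U & Lmodule_isBimodule S R U}.

Definition right_of (S R : pzRingType) (U : bimodType S R) : Type := U.

Section RightModuleOfBimodule.
Variables (S R : pzRingType) (U : bimodType S R).

HB.instance Definition _ := GRing.Zmodule.on (right_of U).

Definition right_scale (r : R^c) (u : right_of U) : right_of U :=
  rscale (u : U) (r : R).

Fact right_scaleA (a b : R^c) u :
  right_scale a (right_scale b u) = right_scale (a * b) u.
Proof. exact: rscaleA. Qed.

Fact right_scale1 : left_id 1 right_scale.
Proof. exact: rscale1. Qed.

Fact right_scaleDr : right_distributive right_scale +%R.
Proof. by move=> a u v; apply: rscaleDl. Qed.

Fact right_scaleDl u : {morph right_scale^~ u : a b / a + b}.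
Proof. by move=> a b; apply: rscaleDr. Qed.

HB.instance Definition _ := GRing.Zmodule_isLmodule.Build R^c (right_of U)
  right_scaleA right_scale1 right_scaleDr right_scaleDl.

End RightModuleOfBimodule.

(* For a bimodule U over (S, R) and a left R-module X, [ltensor U X] is
   U (x)_R X as a left S-module. *)
Definition ltensor (S R : pzRingType) (U : bimodType S R) (X : lmodType R) :
  Type := tensor (right_of U) X.

Section LeftTensor.
Variables (S R : pzRingType) (U : bimodType S R) (X : lmodType R).

HB.instance Definition _ := GRing.Zmodule.on (ltensor U X).

Definition ltens (u : U) (x : X) : ltensor U X := tens (u : right_of U) x.

Definition ltensor_scale (s : S) : ltensor U X -> ltensor U X :=
  tensor_lift (fun (u : right_of U) (x : X) => ltens (s *: (u : U)) x).

Lemma ltensor_scale_balanced s :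
  balanced (fun (u : right_of U) (x : X) => ltens (s *: (u : U)) x).
Proof.
split=> [u u' x|u x x'|r u x].
- by rewrite [s *: _]scalerDr; apply: tensDl.
- exact: tensDr.
- rewrite /ltens -tensM; congr (tens _ _); exact: scale_rscale.
Qed.

Lemma ltensor_scale_zmod s : zmod_morphism (ltensor_scale s).
Proof. exact/tensor_lift_zmod/ltensor_scale_balanced. Qed.

Lemma ltensor_scale_tens s u x : ltensor_scale s (ltens u x) = ltens (s *: u) x.
Proof. exact/tensor_lift_tens/ltensor_scale_balanced. Qed.

Fact ltensor_scaleA a b t :
  ltensor_scale a (ltensor_scale b t) = ltensor_scale (a * b) t.
Proof.
move: t; apply: tensor_eq => [s t|s t|c x]; rewrite ?ltensor_scale_zmod //.
by rewrite !ltensor_scale_tens scalerA.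
Qed.

Fact ltensor_scale1 : left_id 1 ltensor_scale.
Proof.
apply: tensor_eq => [s t|s t|c x]; rewrite ?ltensor_scale_zmod //.
by rewrite ltensor_scale_tens scale1r.
Qed.

Fact ltensor_scaleDr : right_distributive ltensor_scale +%R.
Proof.
by move=> a s t; apply/zmod_morphismD/ltensor_scale_zmod.
Qed.

Fact ltensor_scaleDl t : {morph ltensor_scale^~ t : a b / a + b}.
Proof.
move=> a b; move: t; apply: tensor_eq => [s t|s t|c x].
- exact: ltensor_scale_zmod.
- by rewrite !ltensor_scale_zmod opprD addrACA.
- by rewrite !ltensor_scale_tens scalerDl; apply: tensDl.
Qed.

HB.instance Definition _ := GRing.Zmodule_isLmodule.Build S (ltensor U X)
  ltensor_scaleA ltensor_scale1 ltensor_scaleDr ltensor_scaleDl.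

Lemma ltensDl u u' x : ltens (u + u') x = ltens u x + ltens u' x.
Proof. exact: (@tensDl _ (right_of U)). Qed.

Lemma ltensDr u x x' : ltens u (x + x') = ltens u x + ltens u x'.
Proof. exact: tensDr. Qed.

Lemma ltens0l x : ltens 0 x = 0.
Proof. by apply: (addrI (ltens 0 x)); rewrite -ltensDl !addr0. Qed.

Lemma ltensM u r x : ltens (rscale u r) x = ltens u (r *: x).
Proof. exact: (@tensM _ (right_of U)). Qed.

Lemma scale_ltens s u x : s *: ltens u x = ltens (s *: u) x.
Proof. exact: ltensor_scale_tens. Qed.

End LeftTensor.

(* For a right R-module C and a bimodule U over (R, S), [rtensor C U] is
   C (x)_R U as a right S-module. *)
Definition rtensor (R S : pzRingType) (C : lmodType R^c) (U : bimodType R S) :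
  Type := tensor C U.

Section RightTensor.
Variables (R S : pzRingType) (C : lmodType R^c) (U : bimodType R S).

HB.instance Definition _ := GRing.Zmodule.on (rtensor C U).

Definition rtens (c : C) (u : U) : rtensor C U := tens c u.

Definition rtensor_scale (s : S^c) : rtensor C U -> rtensor C U :=
  tensor_lift (fun (c : C) (u : U) => rtens c (rscale u (s : S))).

Lemma rtensor_scale_balanced s :
  balanced (fun (c : C) (u : U) => rtens c (rscale u (s : S))).
Proof.
split=> [c c' u|c u u'|r c u].
- exact: tensDl.
- by rewrite rscaleDl; apply: tensDr.
- by rewrite /rtens tensM scale_rscale.
Qed.

Lemma rtensor_scale_zmod s : zmod_morphism (rtensor_scale s).
Proof. exact/tensor_lift_zmod/rtensor_scale_balanced. Qed.

Lemma rtensor_scale_tens s c u :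
  rtensor_scale s (rtens c u) = rtens c (rscale u (s : S)).
Proof. exact/tensor_lift_tens/rtensor_scale_balanced. Qed.

Fact rtensor_scaleA a b t :
  rtensor_scale a (rtensor_scale b t) = rtensor_scale (a * b) t.
Proof.
move: t; apply: tensor_eq => [s t|s t|c u]; rewrite ?rtensor_scale_zmod //.
by rewrite !rtensor_scale_tens rscaleA.
Qed.

Fact rtensor_scale1 : left_id 1 rtensor_scale.
Proof.
apply: tensor_eq => [s t|s t|c u]; rewrite ?rtensor_scale_zmod //.
by rewrite rtensor_scale_tens rscale1.
Qed.

Fact rtensor_scaleDr : right_distributive rtensor_scale +%R.
Proof. by move=> a s t; apply/zmod_morphismD/rtensor_scale_zmod. Qed.

Fact rtensor_scaleDl t : {morph rtensor_scale^~ t : a b / a + b}.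
Proof.
move=> a b; move: t; apply: tensor_eq => [s t|s t|c u].
- exact: rtensor_scale_zmod.
- by rewrite !rtensor_scale_zmod opprD addrACA.
- by rewrite !rtensor_scale_tens rscaleDr; apply: tensDr.
Qed.

HB.instance Definition _ := GRing.Zmodule_isLmodule.Build S^c (rtensor C U)
  rtensor_scaleA rtensor_scale1 rtensor_scaleDr rtensor_scaleDl.

Lemma rtensDl c c' u : rtens (c + c') u = rtens c u + rtens c' u.
Proof. exact: tensDl. Qed.

Lemma rtensDr c u u' : rtens c (u + u') = rtens c u + rtens c u'.
Proof. exact: tensDr. Qed.

Lemma rtens0r c : rtens c 0 = 0.
Proof. by apply: (addrI (rtens c 0)); rewrite -rtensDr !addr0. Qed.

Lemma rtensM (r : R) c u : rtens ((r : R^c) *: c) u = rtens c (r *: u).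
Proof. exact: tensM. Qed.

Lemma scale_rtens (s : S) c u : (s : S^c) *: rtens c u = rtens c (rscale u s).
Proof. exact: rtensor_scale_tens. Qed.

End RightTensor.

Section BimoduleTheory.
Variables (S R : pzRingType) (U : bimodType S R).
Implicit Types (s : S) (r : R) (u : U).

Lemma rscale0 u : rscale u (0 : R) = 0.
Proof. by apply: (addrI (rscale u 0)); rewrite -rscaleDr !addr0. Qed.

Lemma rscale0l r : rscale (0 : U) r = 0.
Proof. by apply: (addrI (rscale 0 r)); rewrite -rscaleDl !addr0. Qed.

End BimoduleTheory.

(* The Morita context ring Lambda_(0,0); the tuple [(a, n, m, b)] stands for
   the matrix with rows (a n) and (m b). *)
Definition morita00 (A B : pzRingType) (M : bimodType B A) (N : bimodType A B) :
  Type := (A * N * M * B)%type.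

Section MoritaRing.
Variables (A B : pzRingType) (M : bimodType B A) (N : bimodType A B).
Implicit Types x y z : morita00 M N.

HB.instance Definition _ := GRing.Zmodule.on (morita00 M N).

Definition morita_one : morita00 M N := (1, 0, 0, 1).

Definition morita_mul x y : morita00 M N :=
  let: (a, n, m, b) := x in
  let: (a', n', m', b') := y in
  (a * a', a *: n' + rscale n b', rscale m a' + b *: m', b * b').

Fact morita_mulA : associative morita_mul.
Proof.
move=> [[[a n] m] b] [[[a' n'] m'] b'] [[[a2 n2] m2] b2] /=.
rewrite !mulrA !scalerDr !rscaleDl !scalerA !rscaleA !scale_rscale.
by rewrite !addrA.
Qed.

Fact morita_mul1r : left_id morita_one morita_mul.
Proof.
by case=> [[[a n] m] b] /=; rewrite !mul1r !scale1r !rscale0l addr0 add0r.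
Qed.

Fact morita_mulr1 : right_id morita_one morita_mul.
Proof.
by case=> [[[a n] m] b] /=; rewrite !mulr1 !rscale1 !scaler0 addr0 add0r.
Qed.

Fact morita_mulDl : left_distributive morita_mul +%R.
Proof.
move=> [[[a n] m] b] [[[a' n'] m'] b'] [[[a2 n2] m2] b2] /=.
rewrite !mulrDl !scalerDl !rscaleDl.
by congr (_, _, _, _); rewrite addrACA.
Qed.

Fact morita_mulDr : right_distributive morita_mul +%R.
Proof.
move=> [[[a n] m] b] [[[a' n'] m'] b'] [[[a2 n2] m2] b2] /=.
rewrite !mulrDr !scalerDr !rscaleDr.
by congr (_, _, _, _); rewrite addrACA.
Qed.

HB.instance Definition _ := GRing.Zmodule_isPzRing.Build (morita00 M N)
  morita_mulA morita_mul1r morita_mulr1 morita_mulDl morita_mulDr.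

End MoritaRing.

(* Quadruples (X, Y, f, g) describing left Lambda_(0,0)-modules. *)
Record lquad (A B : pzRingType) (M : bimodType B A) (N : bimodType A B) :=
LQuad {
  lqX : lmodType A;
  lqY : lmodType B;
  lqf : {linear ltensor M lqX -> lqY};
  lqg : {linear ltensor N lqY -> lqX};
  lqgf : forall n m x, lqg (ltens n (lqf (ltens m x))) = 0;
  lqfg : forall m n y, lqf (ltens m (lqg (ltens n y))) = 0
}.

(* The Lambda_(0,0)-module of columns (x, y) attached to a quadruple, with
   (a n; m b)(x, y) = (a x + g(n (x) y), f(m (x) x) + b y). *)
Definition lquad_mod (A B : pzRingType) (M : bimodType B A) (N : bimodType A B)
  (Q : lquad M N) : Type := (lqX Q * lqY Q)%type.

Section LeftQuadModule.
Variables (A B : pzRingType) (M : bimodType B A) (N : bimodType A B).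
Variable Q : lquad M N.
Local Notation f := (lqf Q).
Local Notation g := (lqg Q).
Implicit Types (l : morita00 M N) (v : lquad_mod Q).

HB.instance Definition _ := GRing.Zmodule.on (lquad_mod Q).

Definition lquad_scale l v : lquad_mod Q :=
  let: (a, n, m, b) := l in let: (x, y) := v in
  (a *: x + g (ltens n y), f (ltens m x) + b *: y).

Fact lquad_scaleA l l' v :
  lquad_scale l (lquad_scale l' v) = lquad_scale (l * l') v.
Proof.
move: l l' v => [[[a n] m] b] [[[a' n'] m'] b'] [x y] /=.
rewrite !scalerDr !scalerA !ltensDr !ltensDl !ltensM !linearD /= lqgf lqfg.
by rewrite add0r addr0 -!scale_ltens !linearZ /= !addrA.
Qed.

Fact lquad_scale1 : left_id 1 lquad_scale.
Proof.
by case=> x y /=; rewrite !scale1r !ltens0l !linear0 add0r addr0.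
Qed.

Fact lquad_scaleDr : right_distributive lquad_scale +%R.
Proof.
move=> [[[a n] m] b] [x y] [x' y'] /=; congr (_, _).
  by rewrite scalerDr ltensDr linearD addrACA.
by rewrite scalerDr ltensDr linearD addrACA.
Qed.

Fact lquad_scaleDl v : {morph lquad_scale^~ v : l l' / l + l'}.
Proof.
move: v => [x y] [[[a n] m] b] [[[a' n'] m'] b'] /=; congr (_, _).
  by rewrite scalerDl ltensDl linearD addrACA.
by rewrite scalerDl ltensDl linearD addrACA.
Qed.

HB.instance Definition _ := GRing.Zmodule_isLmodule.Build (morita00 M N)
  (lquad_mod Q) lquad_scaleA lquad_scale1 lquad_scaleDr lquad_scaleDl.

End LeftQuadModule.

(* Quadruples (C, D, h, k) describing right Lambda_(0,0)-modules. *)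
Record rquad (A B : pzRingType) (M : bimodType B A) (N : bimodType A B) :=
RQuad {
  rqC : lmodType A^c;
  rqD : lmodType B^c;
  rqh : {linear rtensor rqC N -> rqD};
  rqk : {linear rtensor rqD M -> rqC};
  rqkh : forall c n m, rqk (rtens (rqh (rtens c n)) m) = 0;
  rqhk : forall d m n, rqh (rtens (rqk (rtens d m)) n) = 0
}.

(* The right Lambda_(0,0)-module of rows (c, d) attached to a quadruple, with
   (c, d)(a n; m b) = (c a + k(d (x) m), h(c (x) n) + d b). *)
Definition rquad_mod (A B : pzRingType) (M : bimodType B A) (N : bimodType A B)
  (Q : rquad M N) : Type := (rqC Q * rqD Q)%type.

Section RightQuadModule.
Variables (A B : pzRingType) (M : bimodType B A) (N : bimodType A B).
Variable Q : rquad M N.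
Local Notation h := (rqh Q).
Local Notation k := (rqk Q).
Implicit Types (l : (morita00 M N)^c) (v : rquad_mod Q).

HB.instance Definition _ := GRing.Zmodule.on (rquad_mod Q).

Definition rquad_scale l v : rquad_mod Q :=
  let: (a, n, m, b) := (l : morita00 M N) in let: (c, d) := v in
  ((a : A^c) *: c + k (rtens d m), h (rtens c n) + (b : B^c) *: d).

Fact rquad_scaleA l l' v :
  rquad_scale l (rquad_scale l' v) = rquad_scale (l * l') v.
Proof.
move: l l' v => [[[a n] m] b] [[[a' n'] m'] b'] [c d] /=.
rewrite !scalerDr !scalerA !rtensDr !rtensDl !rtensM !linearD /= rqkh rqhk.
by rewrite add0r addr0 -!scale_rtens !linearZ /= !addrA.
Qed.

Fact rquad_scale1 : left_id 1 rquad_scale.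
Proof.
by case=> c d /=; rewrite !scale1r !rtens0r !linear0 add0r addr0.
Qed.

Fact rquad_scaleDr : right_distributive rquad_scale +%R.
Proof.
move=> [[[a n] m] b] [c d] [c' d'] /=; congr (_, _).
  by rewrite scalerDr rtensDl linearD addrACA.
by rewrite scalerDr rtensDl linearD addrACA.
Qed.

Fact rquad_scaleDl v : {morph rquad_scale^~ v : l l' / l + l'}.
Proof.
move: v => [c d] [[[a n] m] b] [[[a' n'] m'] b'] /=; congr (_, _).
  by rewrite (@scalerDl A^c) rtensDr linearD addrACA.
by rewrite (@scalerDl B^c) rtensDr linearD addrACA.
Qed.

HB.instance Definition _ := GRing.Zmodule_isLmodule.Build (morita00 M N)^c
  (rquad_mod Q) rquad_scaleA rquad_scale1 rquad_scaleDr rquad_scaleDl.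

End RightQuadModule.

Section ZeroQuads.
Variables (A B : pzRingType) (M : bimodType B A) (N : bimodType A B).

(* The quadruple (X, 0, 0, 0), the zero B-module being ['rV[B]_0]. *)
Definition lquad_l (X : lmodType A) : lquad M N :=
  @LQuad A B M N X 'rV[B]_0 \0 \0 (fun _ _ _ => erefl) (fun _ _ _ => erefl).

Definition rquad_l (C : lmodType A^c) : rquad M N :=
  @RQuad A B M N C 'rV[B^c]_0 \0 \0 (fun _ _ _ => erefl) (fun _ _ _ => erefl).

End ZeroQuads.

Record complex (R : pzRingType) := Complex {
  cobj :> int -> lmodType R;
  cdiff : forall i : int, {linear cobj i -> cobj (i + 1)};
  cdiffK : forall (i : int) (p : cobj i), cdiff (i + 1) (cdiff i p) = 0
}.

Section Complexes.
Variables (R : pzRingType) (P : complex R).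

(* Exactness at P^(i+1) for every integer i, hence at every term. *)
Definition exact_complex : Prop :=
  forall (i : int) (p : P (i + 1)),
    cdiff P (i + 1) p = 0 <-> exists q : P i, cdiff P i q = p.

(* Exactness of Hom_R(P, X), whose differentials are precomposition with those
   of P, at each Hom_R(P^(i+1), X). *)
Definition hom_exact (X : lmodType R) : Prop :=
  forall (i : int) (phi : {linear P (i + 1) -> X}),
    (forall q : P i, phi (cdiff P i q) = 0) <->
    exists psi : {linear P (i + 1 + 1) -> X},
      forall p, psi (cdiff P (i + 1) p) = phi p.

Definition tensor_exact (Y : lmodType R^c) : Prop :=
  forall (i : int) (t : tensor Y (P (i + 1))),
    tensor_map (cdiff P (i + 1)) t = 0 <->
    exists s : tensor Y (P i), tensor_map (cdiff P i) s = t.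

Definition totally_exact : Prop := exact_complex /\ hom_exact R^o.

Definition terms_in_proj : Prop :=
  forall i : int, finitely_generated (P i) /\ projective (P i).

End Complexes.

(* Modules being finitely generated by convention, the complete resolution has
   finitely generated projective terms. *)
Definition gorenstein_projective (R : pzRingType) (X : lmodType R) : Prop :=
  exists P : complex R,
    [/\ terms_in_proj P, totally_exact P & lmod_iso X (ker_mod (cdiff P 0))].

Definition left_semi_weakly_compatible (R : pzRingType) (X : lmodType R) :
  Prop :=
  forall P : complex R, terms_in_proj P -> totally_exact P -> hom_exact P X.

Definition right_semi_weakly_compatible (R : pzRingType) (Y : lmodType R^c) :
  Prop :=
  forall P : complex R, terms_in_proj P -> totally_exact P -> tensor_exact P Y.

Definition weakly_compatible (R S : pzRingType) (U : bimodType R S) : Prop :=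
  left_semi_weakly_compatible U /\
  right_semi_weakly_compatible (right_of U).

(* Main.v *)
Require Import Defs.
From HB Require Import structures.
From mathcomp Require Import all_boot ssralg ssrint matrix.
From mathcomp Require Import boolp.

Set Implicit Arguments.
Unset Strict Implicit.
Unset Printing Implicit Defensive.

Import GRing.Theory.
Local Open Scope ring_scope.

(** Write L for the Morita context ring with zero bimodule maps.  A left
    L-module is a quadruple (X, Y, f, g), and f induces a map
    M (x) Coker g -> Y, because f vanishes on M (x) Im g; likewise g induces
    N (x) Coker f -> X.  Call a quadruple mono when both induced maps are
    injective, and glued when moreover Coker f and Coker g are
    Gorenstein-projective.  Under finiteness, the existence of some isomorphism
    Im f ~ M (x) Coker g already forces the induced surjection
    M (x) Coker g -> Im f to be injective, since a surjective endomorphism of a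
    noetherian module is injective ([im_isoP]).  So condition (2) says that a
    finitely generated quadruple is Gorenstein-projective exactly when it is
    glued ([im_iso_glued]).

    Complexes are handled one step at a time.  A step is a short exact sequence
    0 -> K -> P -> G -> 0 with P finitely generated projective, along which
    every map K -> R extends to P.  Splicing steps gives totally exact
    complexes and cutting complexes into cocycles gives steps, so the
    Gorenstein-projective modules form the largest class which can be entered
    and left by a step from each of its members ([gorensteinP]).  Left
    semi-weak compatibility of V becomes the vanishing of Ext^1(G, V) for G
    Gorenstein-projective, and right semi-weak compatibility of Y becomes the
    injectivity of Y (x) K -> Y (x) P along steps.

    The link between L and the pair (A, B) is a pair of cokernel functors, sent
    through the snake lemma: for a short exact sequence Q1 -> Q2 -> Q3 of
    quadruples with Q2 projective (hence mono, [projective_mono]), Q3 mono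
    makes the sequence of cokernels short exact, and Q1 is mono exactly when
    tensoring the map of cokernels Q1 -> Q2 stays injective.

    From (1) to (2): a glued quadruple has steps up and down to glued
    quadruples, built by a horseshoe argument on the quadruples
    (P + N (x) R, M (x) P + R), so glued quadruples are Gorenstein-projective.
    Conversely let Q be Gorenstein-projective.  The row (M, 0) satisfies
    (M, 0) (x) Q = M (x) Coker g, so its compatibility gives half of the
    monicity; dimension shifting along (N, 0) -> (N, B) -> (0, B) turns the
    compatibility of (N, 0) into the extension property of the cokernels of f
    into B.  Hence Coker f is Gorenstein-projective; the compatibility of N and
    M then gives the other half in the same way.

    From (2) to (1): for G and H Gorenstein-projective the quadruple
    (G + N (x) H, M (x) G + H) is glued, hence Gorenstein-projective.  Embedding
    it in a projective with glued cokernel gives an embedding of G in a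
    projective which stays injective after tensoring with M; and the vanishing
    of its Ext^1 into the column (N, B) of L contains that of Ext^1(G, N). *)

(** * Exact sequences of modules *)

Section LinearMaps.
Variable R : pzRingType.
Implicit Types U V W X K G P Q F : lmodType R.

Definition linear_of U V (h : U -> V) (hP : linear h) : {linear U -> V} :=
  HB.pack h (GRing.isLinear.Build R U V *:%R h hP).

Definition surjective (S T : Type) (p : S -> T) := forall y, exists x, p x = y.

Definition right_exact K X G (i : {linear K -> X}) (p : {linear X -> G}) :=
  surjective p /\ forall x, p x = 0 <-> exists k, i k = x.

Definition short_exact K X G (i : {linear K -> X}) (p : {linear X -> G}) :=
  injective i /\ right_exact i p.

Lemma linear_inj U V (h : {linear U -> V}) :
  (forall u, h u = 0 -> u = 0) -> injective h.
Proof.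
move=> h0 u u' /eqP; rewrite -subr_eq0 -linearB => /eqP/h0/eqP.
by rewrite subr_eq0 => /eqP.
Qed.

Lemma linear_inj0 U V (h : {linear U -> V}) u :
  injective h -> h u = 0 -> u = 0.
Proof. by move=> hI hu; apply: hI; rewrite hu linear0. Qed.

(** The universal property of a quotient, for an arbitrary surjection: the
    factorization is read off on chosen preimages. *)
Lemma factor_surj U V W (s : {linear U -> V}) (h : {linear U -> W}) :
  surjective s -> (forall u, s u = 0 -> h u = 0) ->
  exists k : {linear V -> W}, forall u, k (s u) = h u.
Proof.
move=> sS sh; pose r v := projT1 (cid (sS v)).
have rK v : s (r v) = v := projT2 (cid (sS v)).
have hE u u' : s u = s u' -> h u = h u'.
  move=> e; apply/eqP; rewrite -subr_eq0 -linearB; apply/eqP/sh.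
  by rewrite linearB e subrr.
have kP : linear (fun v => h (r v)).
  by move=> a v w; rewrite -linearP; apply: hE; rewrite linearP !rK.
by exists (linear_of kP) => u; apply: hE; rewrite rK.
Qed.

Lemma factor_inj U V W (i : {linear V -> W}) (h : {linear U -> W}) :
  injective i -> (forall u, exists v, i v = h u) ->
  exists k : {linear U -> V}, forall u, i (k u) = h u.
Proof.
move=> iI ih; pose r u := projT1 (cid (ih u)).
have rK u : i (r u) = h u := projT2 (cid (ih u)).
have rP : linear r by move=> a v w; apply: iI; rewrite linearP !rK linearP.
by exists (linear_of rP).
Qed.

Lemma lmod_iso_inv U V : lmod_iso U V ->
  exists (a : {linear U -> V}) (b : {linear V -> U}),
    cancel a b /\ cancel b a.
Proof.
move=> [a [b ab ba]].
have bP : linear b by move=> c u v; apply: (can_inj ab); rewrite linearP !ba.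
by exists a, (linear_of bP).
Qed.

Lemma lmod_iso_of U V (a : {linear U -> V}) :
  injective a -> surjective a -> lmod_iso U V.
Proof.
move=> aI aS; exists a.
exists (fun v => projT1 (cid (aS v))) => [u|v].
  exact/aI/(projT2 (cid (aS (a u)))).
exact: (projT2 (cid (aS v))).
Qed.

Lemma lmod_iso_refl U : lmod_iso U U.
Proof. by exists idfun; exists id. Qed.

Lemma lmod_iso_sym U V : lmod_iso U V -> lmod_iso V U.
Proof. by move=> /lmod_iso_inv[a [b [ab ba]]]; exists b; exists a. Qed.

Lemma lmod_iso_trans U V W : lmod_iso U V -> lmod_iso V W -> lmod_iso U W.
Proof.
move=> [a ab] [b bb]; exists (b \o a : {linear U -> W}).
exact: bij_comp.
Qed.

Lemma coker_right_exact U V (f : {linear U -> V}) :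
  right_exact f (coker_pi f : {linear V -> coker_mod f}).
Proof.
split=> [y|x]; first by exists (repr y); rewrite /= coker_pi_repr.
rewrite -(linear0 (coker_pi f)); split=> [/coker_piP|[u fu]].
  by rewrite subr0.
by apply/coker_piP; exists u; rewrite subr0.
Qed.

Lemma ker_mod_lift U V (f : {linear U -> V}) u :
  f u = 0 -> exists k : ker_mod f, val k = u.
Proof.
move=> fu; have ku : ker_pred f u by apply/eqP.
by exists (exist (fun x => ker_pred f x) u ku).
Qed.

Lemma ker_modP U V (f : {linear U -> V}) (k : ker_mod f) : f (val k) = 0.
Proof. exact/eqP/(valP k). Qed.

Lemma ker_short_exact U V (f : {linear U -> V}) :
  surjective f -> short_exact (val : {linear ker_mod f -> U}) f.
Proof.
move=> fS; split; first exact: val_inj.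
by split=> // x; split=> [/ker_mod_lift|[k <-]]; last exact: ker_modP.
Qed.

Lemma right_exact_compare K X G G' (i : {linear K -> X}) (p : {linear X -> G})
    (p' : {linear X -> G'}) :
  right_exact i p -> right_exact i p' ->
  exists k : {linear G -> G'},
    [/\ injective k, surjective k & forall x, k (p x) = p' x].
Proof.
move=> [pS pK] [pS' pK'].
have [k kE] := factor_surj pS (fun u pu => (pK' u).2 ((pK u).1 pu)).
exists k; split=> // [|y]; last by have [x <-] := pS' y; exists (p x).
apply: linear_inj => y; have [x <-] := pS y.
by rewrite kE => /(pK' x).1/(pK x).2.
Qed.

Lemma right_exact_uniq K X G G' (i : {linear K -> X}) (p : {linear X -> G})
    (p' : {linear X -> G'}) :
  right_exact i p -> right_exact i p' -> lmod_iso G G'.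
Proof.
by move=> ex ex'; have [k [kI kS _]] := right_exact_compare ex ex';
  apply: lmod_iso_of kI kS.
Qed.

(** Cokernels may be computed after replacing the middle term by an isomorphic
    module; [k] need only be known on the image of [i']. *)
Lemma right_exact_middle K X X' G (i : {linear K -> X}) (i' : {linear K -> X'})
    (p : {linear X -> G}) (k : {linear X' -> X}) :
  injective k -> surjective k -> (forall u, k (i' u) = i u) ->
  right_exact i p -> right_exact i' (p \o k : {linear X' -> G}).
Proof.
move=> kI kS ki [pS pK]; split=> [y|x /=].
  by have [x <-] := pS y; have [x' <-] := kS x; exists x'.
rewrite pK; split=> -[u uE]; exists u; last by rewrite -uE ki.
by apply: kI; rewrite ki.
Qed.

Lemma short_exact_middle K X X' G (i' : {linear K -> X'})
    (p' : {linear X' -> G}) (p : {linear X -> G}) (k : {linear X' -> X}) :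
  injective k -> surjective k -> (forall u, p' u = p (k u)) ->
  short_exact i' p' -> short_exact (k \o i' : {linear K -> X}) p.
Proof.
move=> kI kS kp [iI [pS pK]]; split; first exact: inj_comp.
split=> [y|x]; first by have [x <-] := pS y; exists (k x); rewrite kp.
have [x' <-] := kS x; rewrite -kp pK.
split=> -[u uE]; exists u; first by rewrite /= uE.
exact: kI.
Qed.

Lemma short_exact_uniq K K' X G (i : {linear K -> X}) (i' : {linear K' -> X})
    (p : {linear X -> G}) :
  short_exact i p -> short_exact i' p -> lmod_iso K K'.
Proof.
move=> [iI [_ iK]] [iI' [_ iK']].
have ih u : exists v, i' v = i u by apply/iK'/iK; exists u.
have [k kE] := factor_inj iI' ih.
apply: (@lmod_iso_of _ _ k) => [u v kuv|y].
  by apply: iI; rewrite -!kE kuv.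
have /iK[u iu] : p (i' y) = 0 by apply/iK'; exists y.
by exists u; apply: iI'; rewrite kE.
Qed.

Lemma fg_surj U V (s : {linear U -> V}) :
  surjective s -> finitely_generated U -> finitely_generated V.
Proof.
move=> sS [n [v vP]]; exists n, (fun i => s (v i)) => y.
have [x <-] := sS y; have [c ->] := vP x; exists c.
by rewrite linear_sum; apply: eq_bigr => i _; rewrite linearZ.
Qed.

Lemma projective_iso U V : lmod_iso U V -> projective U -> projective V.
Proof.
move=> /lmod_iso_inv[a [b [ab ba]]] Upr X W g h gS.
have [k kE] := Upr _ _ g (h \o a : {linear _ -> _}) gS.
by exists (k \o b : {linear _ -> _}) => v; rewrite /= kE /= ba.
Qed.

(** A lifting of the identity through the free cover gives coordinate forms. *)
Lemma dual_basis P : finitely_generated P -> projective P ->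
  exists (n : nat) (v : 'I_n -> P) (c : 'I_n -> {linear P -> R^o}),
    forall x, x = \sum_(j < n) (c j x : R) *: v j.
Proof.
move=> [n [v vP]] Ppr.
pose s (r : 'rV[R]_n) := \sum_(j < n) r ord0 j *: v j.
have sP : linear s.
  move=> a u w; rewrite /s scaler_sumr -big_split; apply: eq_bigr => j _ /=.
  by rewrite !mxE scalerDl scalerA.
have sS : surjective (linear_of sP).
  move=> x; have [c ->] := vP x; exists (\row_j c j).
  by apply: eq_bigr => j _; rewrite mxE.
have [k kE] := Ppr _ _ (linear_of sP) idfun sS.
have cP j : linear (fun x => k x ord0 j : R^o).
  by move=> a x y; rewrite linearP !mxE.
exists n, v, (fun j => linear_of (cP j)) => x.
by rewrite -[LHS](kE x).
Qed.

End LinearMaps.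

(** * Extension of maps along an injection *)

Section Extensions.
Variable R : pzRingType.
Implicit Types U V W X K G P Q F : lmodType R.

Definition extends K X (i : {linear K -> X}) V :=
  forall h : {linear K -> V},
  exists k : {linear X -> V}, forall u, k (i u) = h u.

(** The vanishing of Ext^1(G, V), phrased without resolutions. *)
Definition ext1_zero G V :=
  forall K X (i : {linear K -> X}) (p : {linear X -> G}),
  short_exact i p -> extends i V.

(** The hypothesis says that [V] is a direct summand of the [n]-th power of [W],
    and the extension property passes to powers and to summands. *)
Lemma extends_summand K X (i : {linear K -> X}) W V n
    (a : 'I_n -> {linear V -> W}) (b : 'I_n -> {linear W -> V}) :
  (forall x, x = \sum_(j < n) b j (a j x)) -> extends i W -> extends i V.
Proof.
move=> abE iW h.
have kE j := cid (iW (a j \o h : {linear K -> W})).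
pose k x := \sum_(j < n) b j (projT1 (kE j) x).
have kP : linear k.
  move=> c x y; rewrite /k scaler_sumr -big_split; apply: eq_bigr => j _ /=.
  by rewrite !linearP.
exists (linear_of kP) => u; rewrite [RHS]abE; apply: eq_bigr => j _.
by rewrite (projT2 (kE j)).
Qed.

Lemma extends_fgproj K X (i : {linear K -> X}) P :
  finitely_generated P -> projective P -> extends i R^o -> extends i P.
Proof.
move=> Pfg Ppr; have [n [v [c vP]]] := dual_basis Pfg Ppr.
have bP j : linear (fun r : R^o => (r : R) *: v j).
  by move=> a x y; rewrite scalerDl -scalerA.
exact: (@extends_summand _ _ i R^o P n c (fun j => linear_of (bP j)) vP).
Qed.

Lemma extends_retract K X (i : {linear K -> X}) V W (a : {linear V -> W})
    (b : {linear W -> V}) :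
  cancel a b -> extends i W -> extends i V.
Proof.
move=> ab; apply: (@extends_summand _ _ i W V 1 (fun=> a) (fun=> b)) => x.
by rewrite big_ord1 ab.
Qed.

Lemma extends_rV0 K X (i : {linear K -> X}) : extends i 'rV[R]_0.
Proof. by move=> h; exists \0 => u; rewrite [RHS]thinmx0. Qed.

(** The extension property is inherited by extensions of the target, because
    the map extended to the quotient can be lifted from a projective and the
    error of the lift lands in the subobject. *)
Lemma extends_middle K F V' V V'' (i : {linear K -> F})
    (s : {linear V' -> V}) (q : {linear V -> V''}) :
  projective F -> short_exact s q -> extends i V' -> extends i V'' ->
  extends i V.
Proof.
move=> Fpr [sI [qS qK]] iV' iV'' h.
have [k kE] := iV'' (q \o h : {linear _ -> _}).
have [l lE] := Fpr _ _ q k qS.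
have dP u : exists v, s v = (h \- (l \o i) : {linear K -> V}) u.
  by apply/qK; rewrite /= linearB /= lE kE subrr.
have [d dE] := factor_inj sI dP.
have [e eE] := iV' d.
exists (l \+ (s \o e) : {linear F -> V}) => u.
by rewrite /= eE dE /= addrCA subrr addr0.
Qed.

(** Dimension shifting.  Given a projective presentation of [Q] with kernel [K],
    the obstruction to lifting a map from [Q] to [V''] through [V] is a map
    from [K] to [V'], which extends by hypothesis; once lifted, the map
    extends along [i] as a map to [V]. *)
Lemma extends_quotient K F Q F' V' V V'' (k : {linear K -> F})
    (p : {linear F -> Q}) (i : {linear Q -> F'})
    (s : {linear V' -> V}) (q : {linear V -> V''}) :
  projective F -> short_exact k p -> short_exact s q ->
  extends k V' -> extends i V -> extends i V''.
Proof.
move=> Fpr [kI [pS pK]] [sI [qS qK]] kV' iV h.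
have [l lE] := Fpr _ _ q (h \o p : {linear _ -> _}) qS.
have dP u : exists v, s v = (l \o k : {linear K -> V}) u.
  apply/qK; rewrite /= lE /=; have -> : p (k u) = 0 by apply/pK; exists u.
  exact: linear0.
have [d dE] := factor_inj sI dP.
have [e eE] := kV' d.
(* The corrected lift kills [K], hence descends to [Q]. *)
pose l' := l \- (s \o e) : {linear F -> V}.
have l'0 x : p x = 0 -> l' x = 0.
  by move=> /pK[u <-]; rewrite /= eE dE subrr.
have [t tE] := factor_surj pS l'0.
have [t' t'E] := iV t.
exists (q \o t' : {linear F' -> V''}) => y; have [x <-] := pS y.
rewrite /= t'E tE /= linearB /= lE /=.
suff -> : q (s (e x)) = 0 by rewrite subr0.
by apply/qK; exists (e x).
Qed.

End Extensions.

(** * Gorenstein-projective modules and steps *)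

Section Steps.
Variable R : pzRingType.
Implicit Types U V W X K G P Q F : lmodType R.

(** A piece of a totally exact complex between two consecutive cocycles. *)
Definition step K P G (i : {linear K -> P}) (p : {linear P -> G}) :=
  [/\ finitely_generated P, projective P, short_exact i p & extends i R^o].

Definition linked K G :=
  exists P (i : {linear K -> P}) (p : {linear P -> G}), step i p.

Definition step_closed (C : lmodType R -> Prop) :=
  forall G, C G ->
    (exists G', C G' /\ linked G G') /\ (exists K, C K /\ linked K G).

Lemma linked_iso K K' G G' :
  lmod_iso K K' -> lmod_iso G G' -> linked K G -> linked K' G'.
Proof.
move=> /lmod_iso_inv[a [a' [aK aK']]] /lmod_iso_inv[b [b' [bK bK']]].
move=> [P [i [p [Pfg Ppr [iI [pS pK]] iR]]]].
exists P, (i \o a' : {linear _ -> _}), (b \o p : {linear _ -> _}).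
split=> //; last first.
  move=> h; have [k kE] := iR (h \o a : {linear _ -> _}).
  by exists k => u; rewrite /= kE /= aK'.
split; first by move=> u v /= /iI /(can_inj aK').
split=> [y|x /=]; first by have [x xE] := pS (b' y); exists x; rewrite /= xE.
split=> [bp|[k <-]].
  have /pK[k <-] : p x = 0 by apply: (can_inj bK); rewrite bp linear0.
  by exists (a k); rewrite aK.
suff -> : p (i (a' k)) = 0 by rewrite linear0.
by apply/pK; exists (a' k).
Qed.

Section FromComplex.
Variable P : complex R.
Hypotheses (Pproj : terms_in_proj P) (Pex : totally_exact P).

(** The differential corestricts to a surjection onto the next cocycles, by
    exactness of the complex. *)
Lemma cocycle_exact (i : int) :
  exists p : {linear P i -> ker_mod (cdiff P (i + 1))},
    (forall x, val (p x) = cdiff P i x) /\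
    short_exact (val : {linear ker_mod (cdiff P i) -> P i}) p.
Proof.
have dh u : exists v : ker_mod (cdiff P (i + 1)), val v = cdiff P i u.
  exact/ker_mod_lift/cdiffK.
have [p pE] := factor_inj (i := val : {linear ker_mod (cdiff P (i + 1)) -> _})
  val_inj dh.
exists p; split=> //; split; first exact: val_inj.
split=> [y|x].
  have /Pex.1[x xE] : cdiff P (i + 1) (val y) = 0 by apply: ker_modP.
  by exists x; apply: val_inj; rewrite pE.
split=> [px|[k <-]]; first by apply: ker_mod_lift; rewrite -pE px.
by apply: val_inj; rewrite pE; apply: ker_modP.
Qed.

(** A map on cocycles composes with the surjection onto them to a map which
    kills the previous differential; exactness of Hom writes it as a
    restriction of a map on the next term. *)
Lemma hom_exact_extends V : hom_exact P V ->
  forall i, extends (val : {linear ker_mod (cdiff P i) -> P i}) V.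
Proof.
move=> PV j; have [k ->] : exists k : int, j = k + 1 + 1.
  by exists (j - 1 - 1); rewrite !subrK.
move=> h; have [p [pE [_ [pS pK]]]] := cocycle_exact (k + 1).
have hp0 q : (h \o p : {linear _ -> _}) (cdiff P k q) = 0.
  rewrite /=; suff -> : p (cdiff P k q) = 0 by rewrite linear0.
  by apply: val_inj; rewrite pE cdiffK.
have [l lE] := (PV k (h \o p : {linear _ -> _})).1 hp0.
exists l => u; have [x <-] := pS u.
by rewrite /= pE lE.
Qed.

Lemma cocycle_step (i : int) :
  exists p : {linear P i -> ker_mod (cdiff P (i + 1))},
    (forall x, val (p x) = cdiff P i x) /\
    step (val : {linear ker_mod (cdiff P i) -> P i}) p.
Proof.
have [p [pE pex]] := cocycle_exact i; have [Pfg Ppr] := Pproj i.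
by exists p; split=> //; split=> //; apply: hom_exact_extends Pex.2 i.
Qed.

Lemma cocycle_linked (i : int) :
  linked (ker_mod (cdiff P i)) (ker_mod (cdiff P (i + 1))).
Proof. by have [p [_ pst]] := cocycle_step i; do 3!eexists; exact: pst. Qed.

Lemma cocycle_closed :
  step_closed (fun V => exists i, lmod_iso V (ker_mod (cdiff P i))).
Proof.
move=> V [i Vi]; split.
  exists (ker_mod (cdiff P (i + 1))); split.
    by exists (i + 1); apply: lmod_iso_refl.
  exact: linked_iso (lmod_iso_sym Vi) (lmod_iso_refl _) (cocycle_linked i).
exists (ker_mod (cdiff P (i - 1))); split.
  by exists (i - 1); apply: lmod_iso_refl.
apply: linked_iso (cocycle_linked (i - 1)); first exact: lmod_iso_refl.
by rewrite subrK; apply: lmod_iso_sym.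
Qed.

End FromComplex.

Section FromChain.
Variables (X : int -> lmodType R) (P : int -> lmodType R).
Variables (ci : forall i, {linear X i -> P i}).
Variables (cp : forall i, {linear P i -> X (i + 1)}).
Hypothesis Xst : forall i, step (ci i) (cp i).

Lemma chain_diffK i p :
  (ci (i + 1 + 1) \o cp (i + 1)) ((ci (i + 1) \o cp i) p) = 0.
Proof.
have [_ _ [_ [_ K]] _] := Xst (i + 1).
rewrite /=; set y := cp _ _; suff -> : y = 0 by rewrite linear0.
by apply/K; exists (cp i p).
Qed.

(** Splicing a chain of steps indexed by the integers. *)
Definition chain_complex : complex R :=
  Complex (fun i p => chain_diffK p : (ci (i + 1 + 1) \o cp (i + 1) :
    {linear P (i + 1) -> P (i + 1 + 1)})
   ((ci (i + 1) \o cp i : {linear P i -> P (i + 1)}) p) = 0).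

Lemma chain_proj : terms_in_proj chain_complex.
Proof. by move=> i; have [] := Xst i. Qed.

Lemma chain_hom_exact V : (forall i, extends (ci i) V) ->
  hom_exact chain_complex V.
Proof.
move=> cV i h; split=> [h0|[k kE] q]; last by rewrite -kE cdiffK linear0.
have [_ _ [_ [pS pK]] _] := Xst i.
have [_ _ [_ [pS' pK']] _] := Xst (i + 1).
have ph x : cp (i + 1) x = 0 -> h x = 0.
  by move=> /pK'[y <-]; have [z <-] := pS y; apply: h0.
have [l lE] := factor_surj pS' ph.
have [k kE] := cV (i + 1 + 1) l.
by exists k => x; rewrite /= kE lE.
Qed.

Lemma chain_exact : totally_exact chain_complex.
Proof.
split; last by apply: chain_hom_exact => i; have [] := Xst i.
move=> i x; split=> [dx|[q <-]]; last exact: chain_diffK.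
have [_ _ [_ [pS pK]] _] := Xst i.
have [_ _ [_ [pS' pK']] _] := Xst (i + 1).
have [_ _ [iI _] _] := Xst (i + 1 + 1).
have /pK'[y <-] := linear_inj0 iI dx.
by have [z <-] := pS y; exists z.
Qed.

Lemma chain_cocycle i : lmod_iso (X i) (ker_mod (cdiff chain_complex i)).
Proof.
have [_ _ [iI [pS pK]] _] := Xst i.
have [_ _ [iI' _] _] := Xst (i + 1).
have ih u : exists v : ker_mod (cdiff chain_complex i), val v = ci i u.
  apply: ker_mod_lift; rewrite /=; set y := cp _ _.
  suff -> : y = 0 by rewrite linear0.
  by apply/pK; exists u.
have [k kE] := factor_inj
  (i := val : {linear ker_mod (cdiff chain_complex i) -> _}) val_inj ih.
apply: (@lmod_iso_of _ _ _ k) => [u v kuv|y].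
  by apply: iI; rewrite -!kE kuv.
have /(linear_inj0 iI')/pK[u uE] : cdiff chain_complex i (val y) = 0.
  exact: ker_modP.
by exists u; apply: val_inj; rewrite kE.
Qed.

End FromChain.

(** Dependent choice, run in both directions from [G]. *)
Lemma closed_chain (C : lmodType R -> Prop) G : step_closed C -> C G ->
  exists X : int -> lmodType R,
    [/\ X 0 = G, forall i, C (X i) & forall i, linked (X i) (X (i + 1))].
Proof.
move=> Ccl CG; pose T := {V : lmodType R | C V}.
have upP (t : T) : exists t' : T, linked (sval t) (sval t').
  have [[G' [CG' l]] _] := Ccl _ (svalP t).
  by exists (exist _ G' CG').
have downP (t : T) : exists t' : T, linked (sval t') (sval t).
  have [_ [G' [CG' l]]] := Ccl _ (svalP t).
  by exists (exist _ G' CG').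
pose up t := projT1 (cid (upP t)); pose down t := projT1 (cid (downP t)).
pose t0 : T := exist _ G CG.
pose X (i : int) : T :=
  match i with Posz n => iter n up t0 | Negz n => iter n.+1 down t0 end.
exists (fun i => sval (X i)); split=> // [i|]; first exact: svalP.
case=> n.
  have -> : n%:Z + 1 = n.+1%:Z by rewrite intS addrC.
  exact: (projT2 (cid (upP _))).
have -> : Negz n + 1 = - n%:Z by rewrite NegzE intS opprD addrAC addNr add0r.
case: n => [|n]; first exact: (projT2 (cid (downP _))).
rewrite -NegzE; exact: (projT2 (cid (downP _))).
Qed.

(** Gorenstein-projective modules form the largest class closed under steps
    in both directions: the cocycles of a complete resolution are such a class,
    and a chain of steps through [G] splices into a complete resolution. *)
Lemma gorensteinP G : gorenstein_projective G <->
  exists C, step_closed C /\ C G.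
Proof.
split=> [[P [Ppr Pex PG]]|[C [Ccl CG]]].
  exists (fun V => exists i, lmod_iso V (ker_mod (cdiff P i))).
  by split; [apply: cocycle_closed | exists 0].
have [X [X0 _ Xl]] := closed_chain Ccl CG.
pose D i := cid (Xl i); pose I i := cid (projT2 (D i)).
pose J i := cid (projT2 (I i)); have Xst i := projT2 (J i).
exists (chain_complex Xst); split; first exact: chain_proj.
  exact: chain_exact.
by rewrite -{1}X0; apply: chain_cocycle.
Qed.

End Steps.

(** * Right exactness of the tensor product *)

Section TensorMaps.
Variables (R : pzRingType) (C : lmodType R^c).
Implicit Types U V W X Y Z K G : lmodType R.

Lemma tens0l X (x : X) : tens (0 : C) x = 0.
Proof. by apply: (addrI (tens 0 x)); rewrite -tensDl !addr0. Qed.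

Lemma tens0r X (c : C) : tens c (0 : X) = 0.
Proof. by apply: (addrI (tens c 0)); rewrite -tensDr !addr0. Qed.

Fact tensor_map_zmod X X' (f : {linear X -> X'}) :
  zmod_morphism (@tensor_map R C X X' f).
Proof. exact/tensor_lift_zmod/tensor_map_balanced. Qed.
HB.instance Definition _ X X' (f : {linear X -> X'}) :=
  GRing.isZmodMorphism.Build _ _ (@tensor_map R C X X' f) (tensor_map_zmod f).

Lemma tensor_map_inj X X' (f : {linear X -> X'}) :
  (forall t : tensor C X, tensor_map f t = 0 -> t = 0) ->
  injective (@tensor_map R C X X' f).
Proof.
move=> f0 s t /eqP; rewrite -subr_eq0 -raddfB => /eqP/f0/eqP.
by rewrite subr_eq0 => /eqP.
Qed.

Lemma tensor_map_comp X Y Z (f : {linear X -> Y}) (g : {linear Y -> Z})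
    (h : {linear X -> Z}) :
  (forall x, g (f x) = h x) ->
  forall t : tensor C X, tensor_map g (tensor_map f t) = tensor_map h t.
Proof.
move=> gf; apply: tensor_eq => [s t|s t|c x]; rewrite ?raddfB //=.
by rewrite !tensor_map_tens gf.
Qed.

Lemma tensor_map_id X (f : {linear X -> X}) :
  (forall x, f x = x) -> forall t : tensor C X, tensor_map f t = t.
Proof.
move=> f1; apply: tensor_eq => [s t|s t|c x]; rewrite ?raddfB //=.
by rewrite tensor_map_tens f1.
Qed.

Lemma tensor_map0 X Y (f : {linear X -> Y}) :
  (forall x, f x = 0) -> forall t : tensor C X, tensor_map f t = 0.
Proof.
move=> f0; apply: (tensor_eq (G := fun=> 0)) => [s t|s t|c x].
- exact: raddfB.
- by rewrite subrr.
- by rewrite tensor_map_tens f0 tens0r.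
Qed.

Lemma tensor_map_surj X G (p : {linear X -> G}) :
  surjective p -> surjective (@tensor_map R C X G p).
Proof.
move=> pS; elim/tensor_ind => [|s t [s' <-] [t' <-]|c y].
- by exists 0; rewrite raddf0.
- by exists (s' - t'); rewrite raddfB.
- by have [x <-] := pS y; exists (tens c x); rewrite tensor_map_tens.
Qed.

(** Modulo the image of [C (x) K], a tensor [c (x) x] only depends on [c] and
    [p x]; this gives a map back from [C (x) G] to the quotient. *)
Lemma tensor_right_exact K X G (i : {linear K -> X}) (p : {linear X -> G}) :
  right_exact i p -> forall t : tensor C X,
  tensor_map p t = 0 <-> exists s : tensor C K, tensor_map i s = t.
Proof.
move=> [pS pK] t; split=> [|[s <-]]; last first.
  rewrite (tensor_map_comp (h := \0)); first exact: tensor_map0.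
  by move=> x; apply/pK; exists x.
(* The quotient is taken over the integers, where additive maps are linear. *)
pose Ti : zmodule (tensor C K) -> zmodule (tensor C X) := tensor_map i.
have TiP : linear Ti.
  by move=> a u v; rewrite /Ti raddfD raddfMz.
pose Q := coker_mod (linear_of TiP).
pose pi : zmodule (tensor C X) -> Q := coker_pi (linear_of TiP).
have piB : zmod_morphism pi by exact: raddfB.
have piE x x' c : p x = p x' -> pi (tens c x) = pi (tens c x').
  move=> pxx; apply/coker_piP.
  have /pK[k kE] : p (x - x') = 0 by rewrite linearB pxx subrr.
  exists (tens c k); rewrite /= /Ti tensor_map_tens kE.
  by apply/eqP; rewrite -[X in X == _](addrK (tens c x')) -tensDr subrK.
pose r y := projT1 (cid (pS y)).
have rK y : p (r y) = y := projT2 (cid (pS y)).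
pose phi c y := pi (tens c (r y)).
have phiB : balanced phi.
  split=> [c c' y|c y y'|a c y].
  - by rewrite /phi tensDl; apply: (raddfD (coker_pi _)).
  - rewrite /phi (piE _ (r y + r y')) ?linearD ?rK // tensDr.
    exact: (raddfD (coker_pi _)).
  - by rewrite /phi tensM; apply: piE; rewrite linearZ !rK.
have liftE u : tensor_lift phi (tensor_map p u) = pi u.
  apply: (tensor_eq (F := fun u => tensor_lift phi (tensor_map p u))).
  - by move=> a b; rewrite raddfB; apply: tensor_lift_zmod.
  - exact: piB.
  - move=> c x; rewrite tensor_map_tens (tensor_lift_tens phiB).
    by apply: piE; rewrite rK.
move=> pt0; move: (liftE t); rewrite pt0.
have := tensor_lift_zmod phiB 0 0; rewrite !subrr => ->.
move=> /esym; rewrite -[0 in RHS](raddf0 (coker_pi (linear_of TiP))).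
by move=> /coker_piP[w]; rewrite subr0; exists w.
Qed.

End TensorMaps.

(** * Compatible modules *)

Section GorensteinModules.
Variable R : pzRingType.
Implicit Types U V W X K G P Q F : lmodType R.

Lemma gorenstein_closed : step_closed (@gorenstein_projective R).
Proof.
move=> G /gorensteinP[C [Ccl CG]].
have [[G' [CG' l]] [K [CK l']]] := Ccl _ CG.
by split; [exists G' | exists K]; split=> //; apply/gorensteinP; exists C.
Qed.

Lemma gorenstein_iso G G' :
  lmod_iso G G' -> gorenstein_projective G -> gorenstein_projective G'.
Proof.
move=> GG' [P [Ppr Pex PG]]; exists P; split=> //.
exact: lmod_iso_trans (lmod_iso_sym GG') PG.
Qed.

Lemma gorenstein_fg G : gorenstein_projective G -> finitely_generated G.
Proof.
move=> /gorenstein_closed[_ [K [_ [P [i [p [Pfg _ [_ [pS _]] _]]]]]]].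
exact: fg_surj pS Pfg.
Qed.

Lemma gorenstein_rV0 : gorenstein_projective ('rV[R]_0 : lmodType R).
Proof.
have l : linked ('rV[R]_0 : lmodType R) ('rV[R]_0 : lmodType R).
  exists 'rV[R]_0, idfun, idfun; split.
  - exists 0%N, (fun=> 0) => x; exists (fun=> 0).
    by rewrite [LHS]thinmx0 big_ord0.
  - by move=> U W g h _; exists \0 => v /=; rewrite (thinmx0 v) !linear0.
  - split=> //; split=> [y|x]; first by exists y.
    by split=> _; [exists x | rewrite [LHS]thinmx0].
  - by move=> h; exists h.
apply/gorensteinP; exists (fun V => V = 'rV[R]_0 :> lmodType R).
by split=> // V ->; split; exists 'rV[R]_0.
Qed.

Lemma cocycle_gorenstein (P : complex R) i :
  terms_in_proj P -> totally_exact P ->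
  gorenstein_projective (ker_mod (cdiff P i)).
Proof.
move=> Ppr Pex; apply/gorensteinP.
exists (fun V => exists i, lmod_iso V (ker_mod (cdiff P i))).
by split; [apply: cocycle_closed | exists i; apply: lmod_iso_refl].
Qed.

(** One projective presentation [0 -> K -> P -> G] computes Ext^1(G, -): any
    other extension [X] of [G] is the pushout of [P] along a map from [K]. *)
Lemma ext1_of_extends K P G (i : {linear K -> P}) (p : {linear P -> G}) V :
  projective P -> short_exact i p -> extends i V -> ext1_zero G V.
Proof.
move=> Ppr [iI [pS pK]] iV K' X j q [jI [qS qK]] h.
have [a aE] := Ppr _ _ q p qS.
have ai u : exists v, j v = (a \o i : {linear _ -> _}) u.
  by apply/qK; rewrite /= aE; apply/pK; exists u.
have [b bE] := factor_inj jI ai.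
have [e eE] := iV (h \o b : {linear _ -> _}).
(* [X] as a quotient of [P * K'], with kernel the antidiagonal copy of [K]. *)
pose s (x : P * K') := a x.1 + j x.2.
have sP : linear s by move=> c x y; rewrite /s !linearP /= addrACA scalerDr.
pose t (x : P * K') := e x.1 + h x.2.
have tP : linear t by move=> c x y; rewrite /t !linearP /= addrACA scalerDr.
have sS : surjective (linear_of sP).
  move=> x; have [u uE] := pS (q x).
  have /qK[v vE] : q (x - a u) = 0 by rewrite linearB aE uE subrr.
  by exists (u, v); rewrite /= /s /= vE addrC subrK.
have st x : linear_of sP x = 0 -> linear_of tP x = 0.
  case: x => x y; rewrite /= /s /t /= => sxy.
  have qj : q (j y) = 0 by apply/qK; exists y.
  have /pK[u uE] : p x = 0.
    by rewrite -aE -[LHS]addr0 -[in LHS]qj -linearD sxy linear0.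
  have -> : y = - b u.
    apply: jI; apply/eqP; rewrite linearN bE /= uE -addr_eq0 addrC.
    exact/eqP.
  by rewrite -uE eE /= linearN subrr.
have [k kE] := factor_surj sS st.
exists k => v; move: (kE (0, v)).
by rewrite /= /s /t /= !linear0 !add0r.
Qed.

Section Compatible.
Variable P : complex R.
Hypotheses (Ppr : terms_in_proj P) (Pex : totally_exact P).

Lemma extends_hom_exact V :
  (forall i, extends (val : {linear ker_mod (cdiff P i) -> P i}) V) ->
  hom_exact P V.
Proof.
move=> iV i h; split=> [h0|[k kE] q]; last by rewrite -kE cdiffK linear0.
have [p [pE [_ _ [_ [pS pK]] _]]] := cocycle_step Ppr Pex (i + 1).
have ph x : p x = 0 -> h x = 0.
  move=> px; have /Pex.1[y <-] : cdiff P (i + 1) x = 0 by rewrite -pE px.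
  exact: h0.
have [l lE] := factor_surj pS ph.
have [k kE] := iV _ l.
by exists k => x; rewrite -pE kE lE.
Qed.

Variable Y : lmodType R^c.

Lemma tensor_exact_inj : tensor_exact P Y -> forall i,
  injective (tensor_map (val : {linear ker_mod (cdiff P i) -> P i}) :
             tensor Y _ -> _).
Proof.
move=> PY j; have [k ->] : exists k : int, j = k + 1 + 1.
  by exists (j - 1 - 1); rewrite !subrK.
have [p [pE [_ _ [_ [pS pK]] _]]] := cocycle_step Ppr Pex (k + 1).
apply: tensor_map_inj => t; have [s <-] := tensor_map_surj pS t.
rewrite (tensor_map_comp (h := cdiff P (k + 1))) // => /PY[r <-].
by rewrite (tensor_map_comp (h := \0)) ?tensor_map0 // => x;
  apply: val_inj; rewrite pE cdiffK.
Qed.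

Lemma inj_tensor_exact :
  (forall i, injective (tensor_map (val : {linear ker_mod (cdiff P i) -> P i}) :
             tensor Y _ -> _)) -> tensor_exact P Y.
Proof.
move=> iY i t.
have [p [pE [_ _ [_ pex] _]]] := cocycle_step Ppr Pex (i + 1).
have [q [qE [_ _ [_ [qS _]] _]]] := cocycle_step Ppr Pex i.
split=> [dt|[s <-]]; last first.
  rewrite (tensor_map_comp (h := \0)) ?tensor_map0 // => x.
  exact: cdiffK.
have /(tensor_right_exact pex)[s <-] : tensor_map p t = 0.
  apply: (iY (i + 1 + 1)); rewrite raddf0.
  by rewrite (tensor_map_comp (h := cdiff P (i + 1))).
have [r <-] := tensor_map_surj qS s; exists r.
by rewrite (tensor_map_comp (h := cdiff P i)).
Qed.

End Compatible.

(** [G] is the module of 0-cocycles of some complete resolution, and the piece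
    of it ending at [G] is a projective presentation. *)
Lemma compatible_ext1 G V : left_semi_weakly_compatible V ->
  gorenstein_projective G -> ext1_zero G V.
Proof.
move=> Vc [P [Ppr Pex PG]].
have PV : extends (val : {linear ker_mod (cdiff P (-1)) -> P (-1)}) V.
  exact: (hom_exact_extends Pex (Vc P Ppr Pex)).
have [p [pE [_ Qpr [vI [pS pK]] _]]] := cocycle_step Ppr Pex (-1).
have [a [b [ab ba]]] := lmod_iso_inv PG.
apply: (ext1_of_extends (p := b \o p : {linear _ -> _}) Qpr _ PV).
split=> //; split=> [y|x].
  by have [x xE] := pS (a y); exists x; rewrite /= xE.
rewrite -pK; split=> [bp|/= ->]; last exact: linear0.
by apply: (can_inj ba); rewrite [LHS]bp linear0.
Qed.

Lemma compatible_of_ext1 V :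
  (forall G, gorenstein_projective G -> ext1_zero G V) ->
  left_semi_weakly_compatible V.
Proof.
move=> H P Ppr Pex; apply: extends_hom_exact => // i.
have [p [_ [_ _ pex _]]] := cocycle_step Ppr Pex i.
exact: H (cocycle_gorenstein _ Ppr Pex) _ _ _ _ pex.
Qed.

Lemma ext1_zero_iso G G' V : lmod_iso G G' -> ext1_zero G V -> ext1_zero G' V.
Proof.
move=> /lmod_iso_inv[a [b [ab ba]]] GV K X i p [iI [pS pK]].
apply: (GV K X i (b \o p : {linear _ -> _})); split=> //.
split=> [y|x]; first by have [x xE] := pS (a y); exists x; rewrite /= xE ab.
rewrite -pK /=; split=> [e|->]; last exact: linear0.
by apply: (can_inj ba); rewrite e linear0.
Qed.

Lemma regular_compatible : left_semi_weakly_compatible (R^o : lmodType R).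
Proof. by move=> P _ []. Qed.

(** Injectivity after tensoring need only be tested on one embedding of [K]
    through which [i] can be compared. *)
Lemma tensor_inj_compare (Y : lmodType R^c) K K' P P' (i : {linear K -> P})
    (i' : {linear K' -> P'}) :
  lmod_iso K K' -> extends i P' -> injective (@tensor_map R Y K' P' i') ->
  injective (@tensor_map R Y K P i).
Proof.
move=> /lmod_iso_inv[a [b [ab ba]]] ext i'I.
have [e eE] := ext (i' \o a : {linear K -> P'}).
apply: tensor_map_inj => t it.
have <- : tensor_map b (tensor_map a t) = t.
  by rewrite (tensor_map_comp (h := b \o a : {linear K -> K})) // tensor_map_id.
suff -> : tensor_map a t = 0 by rewrite raddf0.
apply: i'I; rewrite raddf0.
rewrite (tensor_map_comp (h := e \o i : {linear K -> P'})).
  have <- : tensor_map e (tensor_map i t) =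
      tensor_map (e \o i : {linear _ -> _}) t.
    exact: tensor_map_comp.
  by rewrite it raddf0.
by move=> x; rewrite /= eE.
Qed.

Lemma right_compatible_step (Y : lmodType R^c) K P G (i : {linear K -> P})
    (p : {linear P -> G}) :
  right_semi_weakly_compatible Y -> gorenstein_projective K -> step i p ->
  injective (@tensor_map R Y K P i).
Proof.
move=> Yc [Q [Qpr Qex QK]] [_ _ _ iR]; have [Qfg0 Qpr0] := Qpr 0.
apply: (tensor_inj_compare QK) (extends_fgproj Qfg0 Qpr0 iR) _.
exact: (tensor_exact_inj Qpr Qex (Yc Q Qpr Qex)).
Qed.

(** It is enough to find one embedding of each Gorenstein-projective module into
    a finitely generated projective that stays injective after tensoring: it
    factors through the embedding of cocycles in any totally exact complex. *)
Lemma right_compatible_of_embeddings (Y : lmodType R^c) :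
  (forall K, gorenstein_projective K ->
    exists K' P' (i' : {linear K' -> P'}),
      [/\ lmod_iso K K', finitely_generated P', projective P' &
          injective (@tensor_map R Y K' P' i')]) ->
  right_semi_weakly_compatible Y.
Proof.
move=> H P Ppr Pex; apply: inj_tensor_exact => // i.
have [p [_ [_ _ _ iR]]] := cocycle_step Ppr Pex i.
have [K' [P' [i' [KK' P'fg P'pr i'I]]]] := H _ (cocycle_gorenstein i Ppr Pex).
exact: tensor_inj_compare KK' (extends_fgproj P'fg P'pr iR) i'I.
Qed.

End GorensteinModules.

(** * Tensoring with a bimodule *)

Section BimoduleTensor.
Variables (S R : pzRingType) (U : bimodType S R).
Implicit Types X Y Z G H P : lmodType R.
Implicit Types V W K : lmodType S.

Definition ltensor_map X X' (f : {linear X -> X'}) :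
  ltensor U X -> ltensor U X' := tensor_map f.

Lemma ltensor_ind X (Q : ltensor U X -> Prop) :
  Q 0 -> (forall s t, Q s -> Q t -> Q (s - t)) ->
  (forall u x, Q (ltens u x)) -> forall t, Q t.
Proof. exact: (@tensor_ind R (right_of U) X Q). Qed.

Lemma ltensr0 X (u : U) : ltens u (0 : X) = 0.
Proof. exact: tens0r. Qed.

Lemma ltensBr X (u : U) (x y : X) : ltens u (x - y) = ltens u x - ltens u y.
Proof. by apply/eqP; rewrite eq_sym subr_eq -ltensDr subrK. Qed.

Lemma ltensor_map_tens X X' (f : {linear X -> X'}) u x :
  ltensor_map f (ltens u x) = ltens u (f x).
Proof. exact: tensor_map_tens. Qed.

Fact ltensor_map_zmod X X' (f : {linear X -> X'}) :
  zmod_morphism (ltensor_map f).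
Proof. exact: tensor_map_zmod. Qed.
HB.instance Definition _ X X' (f : {linear X -> X'}) :=
  GRing.isZmodMorphism.Build _ _ (ltensor_map f) (ltensor_map_zmod f).

Fact ltensor_map_scalable X X' (f : {linear X -> X'}) :
  scalable (ltensor_map f).
Proof.
move=> s; apply: tensor_eq => [t t'|t t'|u x].
- by rewrite scalerBr raddfB.
- by rewrite raddfB scalerBr.
- rewrite -[tens u x]/(ltens (u : U) x) ltensor_map_tens !scale_ltens.
  exact: ltensor_map_tens.
Qed.
HB.instance Definition _ X X' (f : {linear X -> X'}) :=
  GRing.isScalable.Build _ _ _ _ (ltensor_map f) (ltensor_map_scalable f).

Lemma ltensor_eq X V (h k : {linear ltensor U X -> V}) :
  (forall u x, h (ltens u x) = k (ltens u x)) -> forall t, h t = k t.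
Proof.
by move=> hk; apply: tensor_eq => //; [exact: (raddfB h)|exact: (raddfB k)].
Qed.

Lemma ltensor_lift X V (phi : U -> X -> V) :
  (forall u x x', phi u (x + x') = phi u x + phi u x') ->
  (forall u u' x, phi (u + u') x = phi u x + phi u' x) ->
  (forall s u x, phi (s *: u) x = s *: phi u x) ->
  (forall u r x, phi (rscale u r) x = phi u (r *: x)) ->
  exists h : {linear ltensor U X -> V}, forall u x, h (ltens u x) = phi u x.
Proof.
move=> phiDr phiDl phiZ phiM.
have phiB : balanced (phi : right_of U -> X -> V).
  by split=> // r u x; apply: phiM.
pose h : ltensor U X -> V :=
  tensor_lift (phi : right_of U -> X -> V).
have hE u x : h (ltens u x) = phi u x by apply: tensor_lift_tens.
have hB : zmod_morphism h by apply: tensor_lift_zmod.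
have hZ s t : h (s *: t) = s *: h t.
  move: t; apply: tensor_eq => [t t'|t t'|u x].
  - by rewrite scalerBr hB.
  - by rewrite hB scalerBr.
  - rewrite -[tens u x]/(ltens (u : U) x) scale_ltens !hE.
    exact: phiZ.
have hP : linear h.
  by move=> s t t'; rewrite (zmod_morphismD hB) hZ.
by exists (linear_of hP).
Qed.

Lemma ltensor_map_surj X X' (p : {linear X -> X'}) :
  surjective p -> surjective (ltensor_map p).
Proof. exact: tensor_map_surj. Qed.

Lemma ltensor_right_exact X Y G (i : {linear X -> Y}) (p : {linear Y -> G}) :
  right_exact i p ->
  right_exact (ltensor_map i : {linear _ -> _})
              (ltensor_map p : {linear ltensor U _ -> _}).
Proof.
move=> ex; split; first exact/ltensor_map_surj/ex.1.
exact: tensor_right_exact.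
Qed.

Lemma ltensor_map_comp X Y Z (f : {linear X -> Y}) (g : {linear Y -> Z})
    (h : {linear X -> Z}) :
  (forall x, g (f x) = h x) ->
  forall t, ltensor_map g (ltensor_map f t) = ltensor_map h t.
Proof. exact: tensor_map_comp. Qed.

Lemma ltensor_square X X' Y Y' (f : {linear X -> X'}) (g : {linear Y -> Y'})
    (a : {linear X -> Y}) (b : {linear X' -> Y'}) :
  (forall x, g (a x) = b (f x)) ->
  forall t, ltensor_map g (ltensor_map a t) = ltensor_map b (ltensor_map f t).
Proof.
move=> gab t.
rewrite (ltensor_map_comp (h := b \o f : {linear X -> Y'})) //.
exact/esym/(ltensor_map_comp (h := b \o f : {linear _ -> _})).
Qed.

Lemma ltensor_spanP X n (v : 'I_n -> X) :
  (forall x, exists c : 'I_n -> R, x = \sum_(i < n) c i *: v i) ->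
  forall t : ltensor U X,
  exists w : 'I_n -> U, t = \sum_(i < n) ltens (w i) (v i).
Proof.
move=> vP; elim/ltensor_ind => [|s t [w ->] [w' ->]|u x].
- by exists (fun=> 0); rewrite big1 // => i _; apply: ltens0l.
- exists (fun i => w i - w' i); rewrite -sumrB; apply: eq_bigr => i _.
  by apply/eqP; rewrite subr_eq -ltensDl subrK.
- have [c ->] := vP x; exists (fun i => rscale u (c i)).
  elim/big_rec2: _ => [|i y t _ <-].
    exact: ltensr0.
  by rewrite ltensM -ltensDr.
Qed.

(** [U (x) P] is a direct summand of a power of [U]. *)
Lemma extends_ltensor K W (i : {linear K -> W}) P :
  finitely_generated P -> projective P -> extends i U ->
  extends i (ltensor U P).
Proof.
move=> Pfg Ppr; have [n [v [c vP]]] := dual_basis Pfg Ppr.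
have aP (j : 'I_n) : exists h : {linear ltensor U P -> U},
    forall u x, h (ltens u x) = rscale u (c j x : R).
  apply: ltensor_lift => [u x x'|u u' x|s u x|u r x].
  - by rewrite linearD rscaleDr.
  - exact: rscaleDl.
  - by rewrite scale_rscale.
  - by rewrite linearZ rscaleA.
have bP j : linear (fun u : U => ltens u (v j)).
  by move=> s u u'; rewrite ltensDl scale_ltens.
have [a aE] := choice aP.
apply: (extends_summand (a := a) (b := fun j => linear_of (bP j))) => t.
have sP : linear (fun t => \sum_(j < n) linear_of (bP j) (a j t)).
  move=> s x y; rewrite scaler_sumr -big_split; apply: eq_bigr => j _ /=.
  by rewrite linearP ltensDl scale_ltens.
apply: (ltensor_eq (h := idfun) (k := linear_of sP)) => u x /=.
rewrite [in LHS](vP x); elim/big_rec2: _ => [|j y t' _ <-].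
  exact: ltensr0.
by rewrite aE /= ltensM -ltensDr.
Qed.

End BimoduleTensor.

(** * Surjective endomorphisms of noetherian modules *)

Section NoetherianModules.
Variable R : pzRingType.
Implicit Types V : lmodType R.

Fixpoint span V (s : seq V) (x : V) : Prop :=
  if s is v :: s' then exists (r : R) (y : V), span s' y /\ x = r *: v + y
  else x = 0.

Lemma span_linear V (s : seq V) a x y :
  span s x -> span s y -> span s (a *: x + y).
Proof.
elim: s x y => [|v s IHs] x y /=; first by move=> -> ->; rewrite scaler0 addr0.
move=> [r [z [sz ->]]] [r' [z' [sz' ->]]].
exists (a * r + r'), (a *: z + z'); split; first exact: IHs.
by rewrite scalerDr scalerA scalerDl addrACA.
Qed.

Lemma span_sum V n (v : 'I_n -> V) (c : 'I_n -> R) :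
  span (map v (enum 'I_n)) (\sum_(i < n) c i *: v i).
Proof.
rewrite -big_enum /=; elim: (enum _) => [|i s IHs] /=; first by rewrite big_nil.
by rewrite big_cons; exists (c i); eexists; split; first exact: IHs.
Qed.

Definition submodule V (D : V -> Prop) :=
  D 0 /\ forall a x y, D x -> D y -> D (a *: x + y).

(** The ascending chain condition for a module spanned by a finite sequence, by
    induction on the sequence: the coefficients of the first generator in the
    members of the chain form an ascending chain of left ideals, and the rest
    lies in the span of the other generators. *)
Lemma noetherian_span_acc V (s : seq V) (D : nat -> V -> Prop) :
  left_noetherian R -> (forall n, submodule (D n)) ->
  (forall n x, D n x -> D n.+1 x) ->
  exists n0, forall n x, (n0 <= n)%N -> span s x -> D n x -> D n0 x.
Proof.
move=> Rn Dsub Dinc.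
have Dle m n x : (m <= n)%N -> D m x -> D n x.
  by move=> /subnK <-; elim: (n - m)%N => //= k IHk /IHk; apply: Dinc.
elim: s => [|v s [n0 IHs]].
  by exists 0%N => n x _ -> _; apply: (Dsub 0%N).1.
(* Leading coefficients along [v] of the elements of [D n]. *)
pose I n r := exists y, span s y /\ D n (r *: v + y).
have Iid n : left_ideal (I n).
  have [D0 DL] := Dsub n; have s0 : span s 0.
    by elim: (s) => //= w s' s0; exists 0, 0; rewrite scale0r addr0.
  split=> [|r r' [y [sy Dy]] [y' [sy' Dy']]|a r [y [sy Dy]]].
  - by exists 0; rewrite scale0r addr0.
  - exists (1 *: y + y'); split; first exact: span_linear.
    rewrite scale1r scalerDl addrACA -[_ *: v + y]scale1r; exact: DL.
  - exists (a *: y + 0); split; first exact: span_linear.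
    by rewrite addr0 -scalerA -scalerDr -[X in D n X]addr0; apply: DL.
have [n1 n1P] := Rn I Iid (fun n r '(ex_intro y (conj sy Dy)) =>
  ex_intro _ y (conj sy (Dinc _ _ Dy))).
exists (maxn n0 n1) => n x.
rewrite geq_max => /andP[n0n n1n] [r [y [sy ->]]] Dx.
have [|y' [sy' Dy']] := n1P n n1n r; first by exists y.
have [_ DL] := Dsub n; have [_ DL'] := Dsub (maxn n0 n1).
have Dd : D n0 (-1 *: y' + y).
  apply: (IHs n) => //; first exact: span_linear.
  have -> : -1 *: y' + y = -1 *: (r *: v + y') + (r *: v + y).
    by rewrite !scaleN1r opprD addrACA addNr add0r.
  by apply: DL => //; apply: Dle Dy'.
have -> : r *: v + y = 1 *: (r *: v + y') + (-1 *: y' + y).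
  by rewrite scale1r scaleN1r addrA addrK.
by apply: DL'; [apply: Dle Dy' | apply: Dle Dd]; rewrite ?leq_maxr ?leq_maxl.
Qed.

(** The kernels of the iterates of [h] stabilize at some [h^k]; an element of
    the kernel of [h] is [h^k y] with [y] in the kernel of [h^(k+1)], hence
    zero. *)
Lemma noetherian_surj_inj V (h : {linear V -> V}) :
  left_noetherian R -> finitely_generated V -> surjective h -> injective h.
Proof.
move=> Rn [n [v vP]] hS.
have itP k : linear (iter k h).
  by elim: k => // k IHk a x y /=; rewrite IHk linearP.
pose D k x := iter k h x = 0.
have Dsub k : submodule (D k).
  pose L := linear_of (itP k); split; first exact: (linear0 L).
  move=> a x y xk yk; rewrite /D -[LHS]/(L (a *: x + y)) linearP /=.
  by rewrite xk yk scaler0 addr0.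
have Dinc k x : D k x -> D k.+1 x by rewrite /D /= => ->; rewrite linear0.
have [k kP] := noetherian_span_acc (map v (enum 'I_n)) Rn Dsub Dinc.
have itS j : surjective (iter j h).
  elim: j => [|j IHj] y; first by exists y.
  by have [x <-] := hS y; have [z <-] := IHj x; exists z.
apply: linear_inj => x hx; have [y yx] := itS k x; rewrite -yx.
apply: (kP k.+1) => //; last by rewrite /D /= yx.
by have [c ->] := vP y; apply: span_sum.
Qed.

End NoetherianModules.

(** * The map induced on a tensored cokernel *)

Section InducedMap.
Variables (S R : pzRingType) (U : bimodType S R).
Implicit Types Y H : lmodType R.
Implicit Types X V G : lmodType S.

(** The map from [U (x) H] to [X] induced by [g] exists and is injective, for a
    surjection [p]. *)
Definition induces_mono X Y H (g : {linear ltensor U Y -> X})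
    (p : {linear Y -> H}) :=
  forall t, g t = 0 <-> ltensor_map p t = 0.

(** The induced map from [U (x) H] onto the image of [g] becomes, through any
    isomorphism back, a surjective endomorphism of a noetherian module. *)
Lemma im_isoP X Y H (g : {linear ltensor U Y -> X}) (p : {linear Y -> H}) :
  left_noetherian S -> finitely_generated (ltensor U H) -> surjective p ->
  (forall t, ltensor_map p t = 0 -> g t = 0) ->
  lmod_iso (im_mod g) (ltensor U H) <-> induces_mono g p.
Proof.
move=> Sn UHfg pS pg.
have UpS : surjective (ltensor_map p : {linear ltensor U Y -> _}).
  exact: ltensor_map_surj.
have [gb gbE] := factor_surj UpS pg.
have gbI t : exists v : im_mod g, val v = gb t.
  have [s <-] := ltensor_map_surj pS t.
  have gs : im_pred g (gb (ltensor_map p s)).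
    by apply/im_predP; exists s; rewrite gbE.
  by exists (exist (fun v => im_pred g v) _ gs).
have [k kE] := factor_inj (i := val : {linear im_mod g -> X}) val_inj gbI.
have kS : surjective k.
  move=> v; have /im_predP[t gt] := valP v.
  by exists (ltensor_map p t); apply: val_inj; rewrite kE gbE.
split=> [/lmod_iso_inv[a [b [ab ba]]] t|gp].
  split=> [gt|]; last exact: pg.
  have akS : surjective (a \o k : {linear ltensor U H -> ltensor U H}).
    by move=> y; have [x xE] := kS (b y); exists x; rewrite /= xE ba.
  have akI := noetherian_surj_inj Sn UHfg akS.
  apply: (linear_inj0 akI) => /=.
  suff -> : k (ltensor_map p t) = 0 by rewrite linear0.
  by apply: val_inj; rewrite kE gbE gt.
apply/lmod_iso_sym/(lmod_iso_of (a := k)) => //; apply: linear_inj => t.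
have [s <-] := ltensor_map_surj pS t => ks.
by apply/gp; rewrite -gbE -kE ks.
Qed.

(** [X] is an extension of [G] by [U (x) H] through the induced map, so that
    maps on [U (x) H] extend to [X] when Ext^1(G, V) vanishes. *)
Lemma extend_from_image X Y H G V (g : {linear ltensor U Y -> X})
    (p : {linear Y -> H}) (q : {linear X -> G})
    (h : {linear ltensor U H -> V}) :
  surjective p -> induces_mono g p -> right_exact g q -> ext1_zero G V ->
  exists e : {linear X -> V}, forall t, e (g t) = h (ltensor_map p t).
Proof.
move=> pS gp [qS qK] GV.
have UpS : surjective (ltensor_map p : {linear ltensor U Y -> _}).
  exact: ltensor_map_surj.
have [gb gbE] := factor_surj UpS (fun t => (gp t).2).
have gbex : short_exact gb q.
  split.
    apply: linear_inj => s; have [t <-] := UpS s.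
    by rewrite gbE => /gp.
  split=> // x; rewrite qK; split=> [[t <-]|[s <-]].
    by exists (ltensor_map p t); rewrite -gbE.
  by have [t <-] := UpS s; exists t; rewrite gbE.
have [e eE] := GV _ _ gb q gbex h.
by exists e => t; rewrite -eE -gbE.
Qed.

Lemma ltensor_fg Y : finitely_generated U -> finitely_generated Y ->
  finitely_generated (ltensor U Y).
Proof.
move=> [m [a aP]] [n [v vP]].
pose I := ('I_n * 'I_m)%type.
pose w (k : 'I_#|{: I}|) := ltens (a (enum_val k).2) (v (enum_val k).1).
exists #|{: I}|, w => t; have [b ->] := ltensor_spanP vP t.
have [c cE] := choice (fun j => aP (b j)).
exists (fun k => c (enum_val k).1 (enum_val k).2).
pose F (z : I) := c z.1 z.2 *: ltens (a z.2) (v z.1).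
rewrite -[RHS](big_enum_val (A := {: I}) F).
rewrite -(pair_bigA _ (fun j i => F (j, i))) /=.
apply: eq_bigr => j _; rewrite {1}cE /F /=.
elim/big_rec2: _ => [|i y t' _ <-]; first exact: ltens0l.
by rewrite ltensDl scale_ltens.
Qed.

End InducedMap.

(** * A snake lemma *)

Section Snake.
Variables (S R : pzRingType) (U : bimodType S R).
Variables (X1 X2 X3 G1 G2 G3 : lmodType S) (Y1 Y2 Y3 H1 H2 H3 : lmodType R).
Variables (a : {linear X1 -> X2}) (a' : {linear X2 -> X3}).
Variables (b : {linear Y1 -> Y2}) (b' : {linear Y2 -> Y3}).
Variables (g1 : {linear ltensor U Y1 -> X1}) (g2 : {linear ltensor U Y2 -> X2})
  (g3 : {linear ltensor U Y3 -> X3}).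
Variables (p1 : {linear X1 -> G1}) (p2 : {linear X2 -> G2})
  (p3 : {linear X3 -> G3}).
Variables (q1 : {linear Y1 -> H1}) (q2 : {linear Y2 -> H2})
  (q3 : {linear Y3 -> H3}).
Variables (i : {linear G1 -> G2}) (i' : {linear G2 -> G3}).
Variables (j : {linear H1 -> H2}) (j' : {linear H2 -> H3}).
Hypotheses (aex : short_exact a a') (bS : surjective b')
  (jex : right_exact j j').
Hypotheses (p1ex : right_exact g1 p1) (p2ex : right_exact g2 p2)
  (p3ex : right_exact g3 p3).
Hypotheses (q1S : surjective q1).
Hypotheses (ag : forall t, a (g1 t) = g2 (ltensor_map b t))
  (a'g : forall t, a' (g2 t) = g3 (ltensor_map b' t)).
Hypotheses (ip : forall x, i (p1 x) = p2 (a x))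
  (i'p : forall x, i' (p2 x) = p3 (a' x)).
Hypotheses (jq : forall y, j (q1 y) = q2 (b y))
  (j'q : forall y, j' (q2 y) = q3 (b' y)).

(** An element of [X2] whose class dies in [G3] is corrected by an element of
    the image of [g2], found by lifting along [b']. *)
Lemma snake_right_exact : right_exact i i'.
Proof.
have [aI [aS aK]] := aex; have [p1S p1K] := p1ex.
have [p2S p2K] := p2ex; have [p3S p3K] := p3ex.
split=> [y|y].
  by have [x <-] := p3S y; have [x' <-] := aS x; exists (p2 x').
have [x <-] := p2S y; rewrite i'p; split=> [/p3K[t tE]|[z]].
  have [s sE] := ltensor_map_surj bS t.
  have /aK[x1 x1E] : a' (x - g2 s) = 0 by rewrite linearB a'g sE tE subrr.
  exists (p1 x1); rewrite ip x1E linearB.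
  suff -> : p2 (g2 s) = 0 by rewrite subr0.
  by apply/p2K; exists s.
have [x1 <-] := p1S z; rewrite ip => /eqP; rewrite -subr_eq0 -linearB.
move=> /eqP/p2K[t tE]; have ax1 : a' (a x1) = 0 by apply/aK; exists x1.
have -> : x = a x1 - g2 t by rewrite tE opprB addrC subrK.
rewrite linearB ax1 sub0r linearN a'g (_ : p3 _ = 0) ?oppr0 //.
by apply/p3K; exists (ltensor_map b' t).
Qed.

Hypothesis mono2 : induces_mono g2 q2.

(** An element of [U (x) Y2] dying in [U (x) H3] agrees, modulo the kernel of
    the map to [U (x) H2], with one coming from [U (x) Y1]; that kernel is
    killed by [g2]. *)
Lemma snake_lift t : ltensor_map j' (ltensor_map q2 t) = 0 ->
  exists s, g2 t = a (g1 s).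
Proof.
move=> /(ltensor_right_exact U jex).2[s].
have [s' <-] := ltensor_map_surj q1S s.
rewrite /= (ltensor_square jq) => e; exists s'; rewrite ag.
apply/eqP; rewrite -subr_eq0 -linearB; apply/eqP/mono2.
by rewrite raddfB /= e subrr.
Qed.

(** In the diagram with columns [U (x) Hk -> Xk -> Gk], injectivity of the third
    column closes the gap between the kernel of [i] and the image of [g1]. *)
Lemma snake_coker_inj : induces_mono g3 q3 -> injective i.
Proof.
move=> mono3; have [aI [aS aK]] := aex; apply: linear_inj => y.
have [x <-] := p1ex.1 y; rewrite ip => /p2ex.2[t tE].
have [|s sE] := @snake_lift t; last first.
  by apply/p1ex.2; exists s; apply: aI; rewrite -sE.
rewrite (ltensor_square j'q); apply/mono3.
by rewrite -a'g tE; apply/aK; exists x.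
Qed.

Lemma snake_tensor_inj :
  induces_mono g1 q1 -> injective (ltensor_map j : ltensor U H1 -> _).
Proof.
move=> mono1; apply: tensor_map_inj => t.
have [s <-] := ltensor_map_surj q1S t.
rewrite -/(ltensor_map j _) (ltensor_square jq) => /mono2; rewrite -ag => ags.
by apply/mono1; case: aex => aI _; apply: (linear_inj0 aI).
Qed.

Lemma snake_mono1 :
  injective (ltensor_map j : ltensor U H1 -> _) -> induces_mono g1 q1.
Proof.
move=> jI t; have [aI _] := aex; split=> [gt|qt].
  apply: jI; rewrite raddf0 (ltensor_square jq).
  by apply/mono2; rewrite -ag gt linear0.
apply: aI; rewrite linear0 ag; apply/mono2.
by rewrite -(ltensor_square jq) qt linear0.
Qed.

Lemma snake_mono3 : injective i -> induces_mono g3 q3.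
Proof.
move=> iI t; have [s <-] := ltensor_map_surj bS t.
have [aI [aS aK]] := aex; rewrite -a'g -(ltensor_square j'q); split.
  move=> /aK[x xE]; have /p1ex.2[s' s'E] : p1 x = 0.
    by apply: iI; rewrite linear0 ip xE; apply/p2ex.2; exists s.
  have e : ltensor_map q2 s = ltensor_map q2 (ltensor_map b s').
    apply/eqP; rewrite -subr_eq0 -linearB; apply/eqP/mono2.
    by rewrite raddfB /= -ag s'E xE subrr.
  apply/(ltensor_right_exact U jex).2; exists (ltensor_map q1 s').
  by rewrite /= (ltensor_square jq) e.
move=> /snake_lift[s' ->]; apply/aK; by exists (g1 s').
Qed.

End Snake.

(** * Maps of quadruples and of their cokernels *)

Section QuadMaps.
Variables (A B : pzRingType) (M : bimodType B A) (N : bimodType A B).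
Local Notation L := (morita00 M N).

Section Components.
Variables (Q Q' : lquad M N) (phi : {linear lquad_mod Q -> lquad_mod Q'}).

Lemma lquad_scaleE (Q0 : lquad M N) a n m b (x : lqX Q0) (y : lqY Q0) :
  ((a, n, m, b) : L) *: ((x, y) : lquad_mod Q0) =
  (a *: x + lqg Q0 (ltens n y), lqf Q0 (ltens m x) + b *: y).
Proof. by []. Qed.

Definition fst_map (x : lqX Q) : lqX Q' := (phi (x, 0)).1.
Definition snd_map (y : lqY Q) : lqY Q' := (phi (0, y)).2.

(** The diagonal idempotents of the ring force a linear map to be diagonal. *)
Lemma quad_mapE x y : phi (x, y) = (fst_map x, snd_map y).
Proof.
have e1 : (x, 0) = ((1, 0, 0, 0) : L) *: ((x, y) : lquad_mod Q).
  by rewrite lquad_scaleE scale1r scale0r !ltens0l !linear0 !addr0.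
have e2 : (0, y) = ((0, 0, 0, 1) : L) *: ((x, y) : lquad_mod Q).
  by rewrite lquad_scaleE scale1r scale0r !ltens0l !linear0 !add0r.
rewrite /fst_map /snd_map e1 e2 !linearZ /=; case: (phi _) => x' y'.
rewrite !lquad_scaleE /=.
by rewrite !scale1r !ltens0l !linear0 addr0 add0r.
Qed.

Fact fst_map_linear : linear fst_map.
Proof.
move=> a x x'; rewrite /fst_map.
have -> : (a *: x + x', 0) =
    ((a, 0, 0, 0) : L) *: ((x, 0) : lquad_mod Q) + (x', 0).
  rewrite lquad_scaleE !ltens0l scaler0 !linear0 !addr0.
  by congr pair; rewrite /= ?addr0.
rewrite linearP /= !quad_mapE lquad_scaleE !ltens0l !linear0 /=.
by rewrite addr0.
Qed.
HB.instance Definition _ := GRing.isLinear.Build A (lqX Q) (lqX Q') *:%R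
  fst_map fst_map_linear.

Fact snd_map_linear : linear snd_map.
Proof.
move=> b y y'; rewrite /snd_map.
have -> : (0, b *: y + y') =
    ((0, 0, 0, b) : L) *: ((0, y) : lquad_mod Q) + (0, y').
  rewrite lquad_scaleE !ltens0l scaler0 !linear0 !add0r.
  by congr pair; rewrite /= ?addr0.
rewrite linearP /= !quad_mapE lquad_scaleE !ltens0l !linear0 /=.
by rewrite add0r.
Qed.
HB.instance Definition _ := GRing.isLinear.Build B (lqY Q) (lqY Q') *:%R
  snd_map snd_map_linear.

Lemma fst_map_g t : fst_map (lqg Q t) = lqg Q' (ltensor_map snd_map t).
Proof.
apply: (ltensor_eq (h := fst_map \o lqg Q : {linear _ -> _})
  (k := lqg Q' \o ltensor_map snd_map : {linear _ -> _})) => n y /=.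
rewrite ltensor_map_tens /fst_map.
have -> : (lqg Q (ltens n y), 0) = ((0, n, 0, 0) : L) *: ((0, y) : lquad_mod Q).
  by rewrite lquad_scaleE !ltens0l scaler0 scale0r !linear0 !add0r.
by rewrite linearZ /= quad_mapE lquad_scaleE linear0 scaler0 add0r.
Qed.

Lemma snd_map_f t : snd_map (lqf Q t) = lqf Q' (ltensor_map fst_map t).
Proof.
apply: (ltensor_eq (h := snd_map \o lqf Q : {linear _ -> _})
  (k := lqf Q' \o ltensor_map fst_map : {linear _ -> _})) => m x /=.
rewrite ltensor_map_tens /snd_map.
have -> : (0, lqf Q (ltens m x)) = ((0, 0, m, 0) : L) *: ((x, 0) : lquad_mod Q).
  by rewrite lquad_scaleE !ltens0l scaler0 scale0r !linear0 !addr0.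
by rewrite linearZ /= quad_mapE lquad_scaleE linear0 scaler0 addr0.
Qed.

End Components.

Section Compositions.
Variables (Q1 Q2 Q3 : lquad M N) (phi : {linear lquad_mod Q1 -> lquad_mod Q2}).
Variables (psi : {linear lquad_mod Q2 -> lquad_mod Q3}).
Variables (chi : {linear lquad_mod Q1 -> lquad_mod Q3}).
Hypothesis e : forall v, psi (phi v) = chi v.

Lemma fst_map_comp x : fst_map chi x = fst_map psi (fst_map phi x).
Proof. by rewrite {1}/fst_map -e quad_mapE quad_mapE. Qed.

Lemma snd_map_comp y : snd_map chi y = snd_map psi (snd_map phi y).
Proof. by rewrite {1}/snd_map -e quad_mapE quad_mapE. Qed.

End Compositions.

Lemma quad_map_ex (Q Q' : lquad M N) (a : {linear lqX Q -> lqX Q'})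
    (b : {linear lqY Q -> lqY Q'}) :
  (forall n y, a (lqg Q (ltens n y)) = lqg Q' (ltens n (b y))) ->
  (forall m x, b (lqf Q (ltens m x)) = lqf Q' (ltens m (a x))) ->
  exists phi : {linear lquad_mod Q -> lquad_mod Q'},
    forall x y, phi (x, y) = (a x, b y).
Proof.
move=> ag bf; pose phi (v : lquad_mod Q) : lquad_mod Q' := (a v.1, b v.2).
have phiP : linear phi.
  move=> [[[r n] m] s] [x y] [x' y']; rewrite /phi !lquad_scaleE.
  by congr pair; rewrite /= !linearD ?ag ?bf !linearZ.
by exists (linear_of phiP).
Qed.

Section ExactComponents.
Variables (Q1 Q2 Q3 : lquad M N).
Variables (phi : {linear lquad_mod Q1 -> lquad_mod Q2})
  (psi : {linear lquad_mod Q2 -> lquad_mod Q3}).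

Lemma fst_map_short_exact : short_exact phi psi ->
  short_exact (fst_map phi : {linear _ -> _}) (fst_map psi : {linear _ -> _}).
Proof.
move=> [phiI [psiS psiK]]; split=> [x x' /= xx|].
  have : phi (x, 0) = phi (x', 0) by rewrite !quad_mapE xx.
  by move=> /phiI[].
split=> [y|x /=].
  by have [[x z]] := psiS (y, 0); rewrite quad_mapE => -[]; exists x.
split=> [px|[u ux]].
  have /psiK[[u v]] : psi (x, 0) = 0 by rewrite quad_mapE px linear0.
  by rewrite quad_mapE => -[]; exists u.
have /psiK : exists v, phi v = (x, 0).
  by exists (u, 0); rewrite quad_mapE ux linear0.
by rewrite quad_mapE => -[].
Qed.

Lemma snd_map_short_exact : short_exact phi psi ->
  short_exact (snd_map phi : {linear _ -> _}) (snd_map psi : {linear _ -> _}).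
Proof.
move=> [phiI [psiS psiK]]; split=> [x x' /= xx|].
  have : phi (0, x) = phi (0, x') by rewrite !quad_mapE xx.
  by move=> /phiI[].
split=> [y|x /=].
  by have [[z x]] := psiS (0, y); rewrite quad_mapE => -[]; exists x.
split=> [px|[u ux]].
  have /psiK[[v u]] : psi (0, x) = 0 by rewrite quad_mapE px linear0.
  by rewrite quad_mapE => -[]; exists u.
have /psiK : exists v, phi v = (0, x).
  by exists (0, u); rewrite quad_mapE ux linear0.
by rewrite quad_mapE => -[].
Qed.

End ExactComponents.

Section CokernelMaps.
Variable Q : lquad M N.

Lemma lqf_ltens_g m t : lqf Q (ltens m (lqg Q t)) = 0.
Proof.
elim/ltensor_ind: t => [|s t sP tP|n y]; last exact: lqfg.
  by rewrite linear0 ltensr0 linear0.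
by rewrite linearB ltensBr linearB /= sP tP subrr.
Qed.

Lemma lqg_ltens_f n t : lqg Q (ltens n (lqf Q t)) = 0.
Proof.
elim/ltensor_ind: t => [|s t sP tP|m x]; last exact: lqgf.
  by rewrite linear0 ltensr0 linear0.
by rewrite linearB ltensBr linearB /= sP tP subrr.
Qed.

Lemma lqf_coker t :
  ltensor_map (coker_pi (lqg Q) : {linear _ -> _}) t = 0 -> lqf Q t = 0.
Proof.
move=> /(ltensor_right_exact M (coker_right_exact (lqg Q))).2[s <-].
apply: (ltensor_eq (h := lqf Q \o ltensor_map (lqg Q) : {linear _ -> _})
  (k := \0)) => m x /=.
by rewrite ltensor_map_tens lqf_ltens_g.
Qed.

Lemma lqg_coker t :
  ltensor_map (coker_pi (lqf Q) : {linear _ -> _}) t = 0 -> lqg Q t = 0.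
Proof.
move=> /(ltensor_right_exact N (coker_right_exact (lqf Q))).2[s <-].
apply: (ltensor_eq (h := lqg Q \o ltensor_map (lqf Q) : {linear _ -> _})
  (k := \0)) => m x /=.
by rewrite ltensor_map_tens lqg_ltens_f.
Qed.

(** Injectivity of the canonical map [M (x) Coker g -> Y]. *)
Definition f_mono := induces_mono (lqf Q) (coker_pi (lqg Q) : {linear _ -> _}).
(** Injectivity of the canonical map [N (x) Coker f -> X]. *)
Definition g_mono := induces_mono (lqg Q) (coker_pi (lqf Q) : {linear _ -> _}).

End CokernelMaps.

Section InducedCokernelMaps.
Variables (Q Q' : lquad M N) (phi : {linear lquad_mod Q -> lquad_mod Q'}).

Fact cokg_map_ex :
  exists i : {linear coker_mod (lqg Q) -> coker_mod (lqg Q')},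
    forall x, i (coker_pi (lqg Q) x) = coker_pi (lqg Q') (fst_map phi x).
Proof.
have [pS pK] := coker_right_exact (lqg Q).
have [_ pK'] := coker_right_exact (lqg Q').
apply: (factor_surj
  (h := coker_pi (lqg Q') \o fst_map phi : {linear _ -> _})) => //.
move=> u /pK[t <-]; apply/pK'; exists (ltensor_map (snd_map phi) t).
by rewrite /= fst_map_g.
Qed.
Definition cokg_map := projT1 (cid cokg_map_ex).

Lemma cokg_mapE x :
  cokg_map (coker_pi (lqg Q) x) = coker_pi (lqg Q') (fst_map phi x).
Proof. exact: (projT2 (cid cokg_map_ex)). Qed.

Fact cokf_map_ex :
  exists i : {linear coker_mod (lqf Q) -> coker_mod (lqf Q')},
    forall x, i (coker_pi (lqf Q) x) = coker_pi (lqf Q') (snd_map phi x).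
Proof.
have [pS pK] := coker_right_exact (lqf Q).
have [_ pK'] := coker_right_exact (lqf Q').
apply: (factor_surj
  (h := coker_pi (lqf Q') \o snd_map phi : {linear _ -> _})) => //.
move=> u /pK[t <-]; apply/pK'; exists (ltensor_map (fst_map phi) t).
by rewrite /= snd_map_f.
Qed.
Definition cokf_map := projT1 (cid cokf_map_ex).

Lemma cokf_mapE x :
  cokf_map (coker_pi (lqf Q) x) = coker_pi (lqf Q') (snd_map phi x).
Proof. exact: (projT2 (cid cokf_map_ex)). Qed.

End InducedCokernelMaps.

Section QuadSnake.
Variables (Q1 Q2 Q3 : lquad M N).
Variables (phi : {linear lquad_mod Q1 -> lquad_mod Q2})
  (psi : {linear lquad_mod Q2 -> lquad_mod Q3}).
Hypothesis ex : short_exact phi psi.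

Let fstex := fst_map_short_exact ex.
Let sndex := snd_map_short_exact ex.

Lemma cokg_right_exact : right_exact (cokg_map phi) (cokg_map psi).
Proof.
apply: (snake_right_exact fstex sndex.2.1 (coker_right_exact _)
 (coker_right_exact _) (coker_right_exact _)); first exact: fst_map_g.
- exact: cokg_mapE.
- exact: cokg_mapE.
Qed.

Lemma cokf_right_exact : right_exact (cokf_map phi) (cokf_map psi).
Proof.
apply: (snake_right_exact sndex fstex.2.1 (coker_right_exact _)
 (coker_right_exact _) (coker_right_exact _)); first exact: snd_map_f.
- exact: cokf_mapE.
- exact: cokf_mapE.
Qed.

Lemma cokg_map_inj : g_mono Q2 -> g_mono Q3 -> injective (cokg_map phi).
Proof.
exact: (snake_coker_inj fstex cokf_right_exact (coker_right_exact _)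
  (coker_right_exact _) (coker_right_exact _).1 (fst_map_g phi) (fst_map_g psi)
  (cokg_mapE phi) (cokf_mapE phi) (cokf_mapE psi)).
Qed.

Lemma cokf_map_inj : f_mono Q2 -> f_mono Q3 -> injective (cokf_map phi).
Proof.
exact: (snake_coker_inj sndex cokg_right_exact (coker_right_exact _)
  (coker_right_exact _) (coker_right_exact _).1 (snd_map_f phi) (snd_map_f psi)
  (cokf_mapE phi) (cokg_mapE phi) (cokg_mapE psi)).
Qed.

Lemma tensor_cokf_inj : g_mono Q2 -> g_mono Q1 ->
  injective (ltensor_map (cokf_map phi) : ltensor N _ -> _).
Proof.
exact: (snake_tensor_inj fstex (coker_right_exact _).1 (fst_map_g phi)
  (cokf_mapE phi)).
Qed.

Lemma tensor_cokg_inj : f_mono Q2 -> f_mono Q1 ->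
  injective (ltensor_map (cokg_map phi) : ltensor M _ -> _).
Proof.
exact: (snake_tensor_inj sndex (coker_right_exact _).1 (snd_map_f phi)
  (cokg_mapE phi)).
Qed.

Lemma g_mono_sub : g_mono Q2 ->
  injective (ltensor_map (cokf_map phi) : ltensor N _ -> _) -> g_mono Q1.
Proof. exact: (snake_mono1 fstex (fst_map_g phi) (cokf_mapE phi)). Qed.

Lemma f_mono_sub : f_mono Q2 ->
  injective (ltensor_map (cokg_map phi) : ltensor M _ -> _) -> f_mono Q1.
Proof. exact: (snake_mono1 sndex (snd_map_f phi) (cokg_mapE phi)). Qed.

Lemma g_mono_quo : g_mono Q2 -> injective (cokg_map phi) -> g_mono Q3.
Proof.
exact: (snake_mono3 fstex sndex.2.1 cokf_right_exact (coker_right_exact _)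
  (coker_right_exact _) (coker_right_exact _).1 (fst_map_g phi) (fst_map_g psi)
  (cokg_mapE phi) (cokf_mapE phi) (cokf_mapE psi)).
Qed.

Lemma f_mono_quo : f_mono Q2 -> injective (cokf_map phi) -> f_mono Q3.
Proof.
exact: (snake_mono3 sndex fstex.2.1 cokg_right_exact (coker_right_exact _)
  (coker_right_exact _) (coker_right_exact _).1 (snd_map_f phi) (snd_map_f psi)
  (cokf_mapE phi) (cokg_mapE phi) (cokg_mapE psi)).
Qed.

End QuadSnake.

End QuadMaps.

(** * Every module is a quadruple *)

Section Corner.
Variables (R S : pzRingType) (rho : R -> S).
Hypotheses (rhoD : {morph rho : x y / x + y})
  (rhoM : {morph rho : x y / x * y}).
Variable V : lmodType S.

Definition corner_pred : pred V := fun v => rho 1 *: v == v.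

Fact corner_zmod : zmod_closed corner_pred.
Proof.
split=> [|u v]; rewrite !unfold_in /corner_pred ?scaler0 //.
by move=> /eqP uE /eqP vE; rewrite scalerBr uE vE.
Qed.
HB.instance Definition _ := GRing.isZmodClosed.Build V corner_pred corner_zmod.

(** The Peirce component of [V] at the idempotent [rho 1]; the proofs that
    [rho] is a ring morphism up to the unit are parameters because the scalar
    action on the component depends on them. *)
Definition corner_of (_ : {morph rho : x y / x + y})
  (_ : {morph rho : x y / x * y}) := {v : V | corner_pred v}.
Local Notation corner := (corner_of rhoD rhoM).
HB.instance Definition _ := SubChoice.on corner.
HB.instance Definition _ :=
  GRing.SubChoice_isSubZmodule.Build V corner_pred corner corner_zmod.

Fact corner_scale_proof r (v : corner) : corner_pred (rho r *: val v).
Proof. by rewrite /corner_pred scalerA -rhoM mul1r. Qed.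

Definition corner_scale r v : corner :=
  Sub (rho r *: val v) (corner_scale_proof r v).

Fact corner_scaleA a b v :
  corner_scale a (corner_scale b v) = corner_scale (a * b) v.
Proof. by apply: val_inj; rewrite /= scalerA -rhoM. Qed.

Fact corner_scale1 : left_id 1 corner_scale.
Proof. by move=> v; apply/val_inj/eqP/(valP v). Qed.

Fact corner_scaleDr : right_distributive corner_scale +%R.
Proof. by move=> a u v; apply: val_inj; rewrite /= scalerDr. Qed.

Fact corner_scaleDl v : {morph corner_scale^~ v : a b / a + b}.
Proof. by move=> a b; apply: val_inj; rewrite /= rhoD scalerDl. Qed.

HB.instance Definition _ := GRing.Zmodule_isLmodule.Build R corner
  corner_scaleA corner_scale1 corner_scaleDr corner_scaleDl.

Definition corner_elt (v : V) (vP : rho 1 *: v = v) : corner :=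
  exist (fun v => corner_pred v) v (introT eqP vP).

Lemma corner1 (v : corner) : rho 1 *: val v = val v.
Proof. exact/eqP/(valP v). Qed.

End Corner.

Section ModulesAreQuads.
Variables (A B : pzRingType) (M : bimodType B A) (N : bimodType A B).
Local Notation L := (morita00 M N).

Definition diagA (a : A) : L := (a, 0, 0, 0).
Definition diagB (b : B) : L := (0, 0, 0, b).
Definition offN (n : N) : L := (0, n, 0, 0).
Definition offM (m : M) : L := (0, 0, m, 0).

Lemma morita_mulE a n m b a' n' m' b' :
  ((a, n, m, b) : L) * (a', n', m', b') =
  (a * a', a *: n' + rscale n b', rscale m a' + b *: m', b * b').
Proof. by []. Qed.

Lemma morita_addE a n m b a' n' m' b' :
  ((a, n, m, b) : L) + (a', n', m', b') = (a + a', n + n', m + m', b + b').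
Proof. by []. Qed.

Let simpE := (scaler0, scale0r, rscale0, rscale0l, mulr0, mul0r, addr0, add0r,
  rscale1 (s := M), rscale1 (s := N), scale1r, mul1r, mulr1).

Fact diagAD : {morph diagA : a b / a + b}.
Proof. by move=> a b; rewrite [RHS]morita_addE !addr0. Qed.
Fact diagAM : {morph diagA : a b / a * b}.
Proof. by move=> a b; rewrite [RHS]morita_mulE !simpE. Qed.
Fact diagBD : {morph diagB : a b / a + b}.
Proof. by move=> a b; rewrite [RHS]morita_addE !addr0. Qed.
Fact diagBM : {morph diagB : a b / a * b}.
Proof. by move=> a b; rewrite [RHS]morita_mulE !simpE. Qed.

Lemma offND n n' : offN (n + n') = offN n + offN n'.
Proof. by rewrite [RHS]morita_addE !addr0. Qed.
Lemma offMD n n' : offM (n + n') = offM n + offM n'.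
Proof. by rewrite [RHS]morita_addE !addr0. Qed.
Lemma diagA_offN a n : diagA a * offN n = offN (a *: n).
Proof. by rewrite [LHS]morita_mulE !simpE. Qed.
Lemma diagB_offM b m : diagB b * offM m = offM (b *: m).
Proof. by rewrite [LHS]morita_mulE !simpE. Qed.
Lemma offN_diagB n b : offN n * diagB b = offN (rscale n b).
Proof. by rewrite [LHS]morita_mulE !simpE. Qed.
Lemma offM_diagA m a : offM m * diagA a = offM (rscale m a).
Proof. by rewrite [LHS]morita_mulE !simpE. Qed.
Lemma offNM n m : offN n * offM m = 0.
Proof. by rewrite [LHS]morita_mulE !simpE. Qed.
Lemma offMN m n : offM m * offN n = 0.
Proof. by rewrite [LHS]morita_mulE !simpE. Qed.
Lemma offN_diagA n a : offN n * diagA a = 0.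
Proof. by rewrite [LHS]morita_mulE !simpE. Qed.
Lemma offM_diagB m b : offM m * diagB b = 0.
Proof. by rewrite [LHS]morita_mulE !simpE. Qed.
Lemma morita_split a n m b :
  ((a, n, m, b) : L) = diagA a + offN n + (offM m + diagB b).
Proof. by rewrite !morita_addE !simpE. Qed.
Lemma diag11 : diagA 1 + diagB 1 = 1.
Proof. by rewrite [LHS]morita_addE !simpE. Qed.
Lemma diagAB a b : diagA a * diagB b = 0.
Proof. by rewrite [LHS]morita_mulE !simpE. Qed.
Lemma diagBA a b : diagB b * diagA a = 0.
Proof. by rewrite [LHS]morita_mulE !simpE. Qed.

(** The quadruple consists of the two Peirce components, with the off-diagonal
    matrices acting between them. *)
Lemma module_is_quad (V : lmodType L) :
  exists Q : lquad M N, lmod_iso (lquad_mod Q) V.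
Proof.
pose X : lmodType A := corner_of V diagAD diagAM.
pose Y : lmodType B := corner_of V diagBD diagBM.
have xP (v : V) : diagA 1 *: (diagA 1 *: v) = diagA 1 *: v.
  by rewrite scalerA -diagAM mulr1.
have yP (v : V) : diagB 1 *: (diagB 1 *: v) = diagB 1 *: v.
  by rewrite scalerA -diagBM mulr1.
have fP (m : M) (v : V) : diagB 1 *: (offM m *: v) = offM m *: v.
  by rewrite scalerA diagB_offM scale1r.
have gP (n : N) (v : V) : diagA 1 *: (offN n *: v) = offN n *: v.
  by rewrite scalerA diagA_offN scale1r.
have [f fE] : exists f : {linear ltensor M X -> Y},
    forall m x, f (ltens m x) = corner_elt diagBD diagBM (fP m (val x)).
  apply: ltensor_lift => [m x x'|m m' x|b m x|m a x]; apply: val_inj => /=.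
  - by rewrite scalerDr.
  - by rewrite offMD scalerDl.
  - by rewrite scalerA diagB_offM.
  - by rewrite scalerA offM_diagA.
have [g gE] : exists g : {linear ltensor N Y -> X},
    forall n y, g (ltens n y) = corner_elt diagAD diagAM (gP n (val y)).
  apply: ltensor_lift => [m x x'|m m' x|b m x|m a x]; apply: val_inj => /=.
  - by rewrite scalerDr.
  - by rewrite offND scalerDl.
  - by rewrite scalerA diagA_offN.
  - by rewrite scalerA offN_diagB.
have gf n m x : g (ltens n (f (ltens m x))) = 0.
  by rewrite gE fE; apply: val_inj; rewrite /= scalerA offNM scale0r.
have fg m n y : f (ltens m (g (ltens n y))) = 0.
  by rewrite gE fE; apply: val_inj; rewrite /= scalerA offMN scale0r.
pose Q := LQuad gf fg; exists Q.
pose h (v : lquad_mod Q) : V := val v.1 + val v.2.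
have XB (x : X) l : l * diagA 1 = 0 -> l *: val x = 0.
  by move=> l0; rewrite -(corner1 x) scalerA l0 scale0r.
have YB (y : Y) l : l * diagB 1 = 0 -> l *: val y = 0.
  by move=> l0; rewrite -(corner1 y) scalerA l0 scale0r.
have hP : linear h.
  move=> [[[a n] m] b] [x y] [x' y'].
  have -> : ((a, n, m, b) : L) *: ((x, y) : lquad_mod Q) + (x', y') =
    (a *: x + g (ltens n y) + x', f (ltens m x) + b *: y + y') by [].
  rewrite /h /= gE fE /= morita_split !scalerDr !scalerDl.
  rewrite [offN n *: val x]XB ?offN_diagA // [diagB b *: val x]XB ?diagBA //.
  rewrite [diagA a *: val y]YB ?diagAB // [offM m *: val y]YB ?offM_diagB //.
  rewrite !addr0 !add0r addrACA; congr (_ + _).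
  by rewrite addrACA.
apply: (@lmod_iso_of _ _ _ (linear_of hP)) => [|v].
  apply: (linear_inj (h := linear_of hP)) => -[x y]; rewrite /= /h /= => xy.
  have x0 : val x = 0.
    have := congr1 (fun v => diagA 1 *: v) xy.
    by rewrite scaler0 scalerDr (corner1 x) YB ?diagAB // addr0.
  move: xy; rewrite x0 add0r => y0.
  by congr pair; apply: val_inj.
exists (corner_elt diagAD diagAM (xP v), corner_elt diagBD diagBM (yP v)).
by rewrite /= /h /= -scalerDl diag11 scale1r.
Qed.

End ModulesAreQuads.

(** * Quadruples induced from a pair of modules *)

Section FreeQuad.
Variables (A B : pzRingType) (M : bimodType B A) (N : bimodType A B).
Local Notation L := (morita00 M N).

Section Def.
Variables (P : lmodType A) (R : lmodType B).

Definition free_f (t : ltensor M (P * ltensor N R)%type) : ltensor M P * R :=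
  (ltensor_map (fst : {linear (P * ltensor N R)%type -> P}) t, 0).
Definition free_g (t : ltensor N (ltensor M P * R)%type) : P * ltensor N R :=
  (0, ltensor_map (snd : {linear (ltensor M P * R)%type -> R}) t).

Fact free_f_linear : linear free_f.
Proof.
move=> a s t; rewrite /free_f linearP.
by congr pair; rewrite /= ?scaler0 ?addr0.
Qed.
HB.instance Definition _ := GRing.isLinear.Build _ _ _ _ free_f free_f_linear.
Fact free_g_linear : linear free_g.
Proof.
move=> a s t; rewrite /free_g linearP.
by congr pair; rewrite /= ?scaler0 ?addr0.
Qed.
HB.instance Definition _ := GRing.isLinear.Build _ _ _ _ free_g free_g_linear.

Fact free_gf n m x : free_g (ltens n (free_f (ltens m x))) = 0.
Proof. by rewrite /free_g ltensor_map_tens /= ltensr0. Qed.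
Fact free_fg m n y : free_f (ltens m (free_g (ltens n y))) = 0.
Proof. by rewrite /free_f ltensor_map_tens /= ltensr0. Qed.

(** The L-module induced from the [A * B]-module [(P, R)], that is,
    [(P + N (x) R, M (x) P + R)]. *)
Definition free_quad : lquad M N := LQuad free_gf free_fg.

Lemma free_coker_g :
  right_exact (lqg free_quad) (fst : {linear lqX free_quad -> P}).
Proof.
split=> [x|[x t]]; first by exists (x, 0).
split=> [/= ->|[s <-]] //.
have sndS : surjective (snd : {linear (ltensor M P * R)%type -> R}).
  by move=> y; exists (0, y).
by have [s <-] := ltensor_map_surj sndS t; exists s.
Qed.

Lemma free_coker_f :
  right_exact (lqf free_quad) (snd : {linear lqY free_quad -> R}).
Proof.
split=> [x|[t x]]; first by exists (0, x).
split=> [/= ->|[s <-]] //.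
have fstS : surjective (fst : {linear (P * ltensor N R)%type -> P}).
  by move=> y; exists (y, 0).
by have [s <-] := ltensor_map_surj fstS t; exists s.
Qed.

Lemma free_g_mono : g_mono free_quad.
Proof.
move=> t; split; last exact: lqg_coker.
move=> [gt].
have [k [_ _ kE]] :=
  right_exact_compare free_coker_f (coker_right_exact (lqf free_quad)).
have <- := ltensor_map_comp (fun u => kE u) t.
by rewrite /= gt raddf0.
Qed.

Lemma free_f_mono : f_mono free_quad.
Proof.
move=> t; split; last exact: lqf_coker.
move=> [gt].
have [k [_ _ kE]] :=
  right_exact_compare free_coker_g (coker_right_exact (lqg free_quad)).
have <- := ltensor_map_comp (fun u => kE u) t.
by rewrite /= gt raddf0.
Qed.

(** Extension of scalars is left adjoint to restriction: a pair of maps out of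
    [P] and [R] determines a map of quadruples. *)
Lemma free_quad_map (Q : lquad M N) (a : {linear P -> lqX Q})
    (b : {linear R -> lqY Q}) :
  exists phi : {linear lquad_mod free_quad -> lquad_mod Q},
    forall p t s r, phi ((p, t), (s, r)) =
      (a p + lqg Q (ltensor_map b t), lqf Q (ltensor_map a s) + b r).
Proof.
pose al (x : P * ltensor N R) := a x.1 + lqg Q (ltensor_map b x.2).
have alP : linear al.
  by move=> c x y; rewrite /al !linearP /= addrACA scalerDr.
pose be (y : ltensor M P * R) := lqf Q (ltensor_map a y.1) + b y.2.
have beP : linear be.
  by move=> c x y; rewrite /be !linearP /= addrACA scalerDr.
have [n y|m x|phi phiE] :=
  @quad_map_ex _ _ _ _ free_quad Q (linear_of alP) (linear_of beP).
- rewrite /= /al /= /free_g ltensor_map_tens /= linear0 add0r ltensor_map_tens.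
  by rewrite /be ltensDr linearD /= lqg_ltens_f add0r.
- rewrite /= /be /= /free_f ltensor_map_tens /= linear0 addr0 ltensor_map_tens.
  by rewrite /al ltensDr linearD /= lqf_ltens_g addr0.
- by exists phi => p t s r; rewrite phiE.
Qed.

(** Uniqueness in the adjunction: [P] and [R] generate. *)
Lemma free_map_eq (Q : lquad M N)
    (h k : {linear lquad_mod free_quad -> lquad_mod Q}) :
  (forall p, fst_map h (p, 0) = fst_map k (p, 0)) ->
  (forall r, snd_map h (0, r) = snd_map k (0, r)) -> forall v, h v = k v.
Proof.
move=> hkp hkr [[p t] [s r]]; rewrite !quad_mapE; congr pair.
  have -> : (p, t) = (p, 0) + (0, t) :> lqX free_quad.
    by congr pair; rewrite /= ?addr0 ?add0r.
  rewrite !linearD /= hkp; congr (_ + _).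
  elim/ltensor_ind: t => [|t t' tE t'E|n y].
  - by rewrite -[(0, 0)]/(0 : lqX free_quad) !linear0.
  - have -> : (0, t - t') = (0, t) - (0, t') :> lqX free_quad.
      by congr pair; rewrite /= subr0.
    by rewrite !linearB /= tE t'E.
  - have -> : (0, ltens n y) = lqg free_quad (ltens n (0, y)).
      by rewrite /= /free_g ltensor_map_tens.
    by rewrite !fst_map_g !ltensor_map_tens /= hkr.
have -> : (s, r) = (s, 0) + (0, r) :> lqY free_quad.
  by congr pair; rewrite /= ?addr0 ?add0r.
rewrite !linearD /= hkr; congr (_ + _).
elim/ltensor_ind: s => [|s s' sE s'E|m x].
- by rewrite -[(0, 0)]/(0 : lqY free_quad) !linear0.
- have -> : (s - s', 0) = (s, 0) - (s', 0) :> lqY free_quad.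
    by congr pair; rewrite /= subr0.
  by rewrite !linearB /= sE s'E.
- have -> : (ltens m x, 0) = lqf free_quad (ltens m (x, 0)).
    by rewrite /= /free_f ltensor_map_tens.
  by rewrite !snd_map_f !ltensor_map_tens /= hkp.
Qed.

Lemma free_quad_projective :
  projective P -> projective R -> projective (lquad_mod free_quad).
Proof.
move=> Ppr Rpr U W g h gS.
have [QU /lmod_iso_inv[u [u' [uK uK']]]] := module_is_quad U.
have [QW /lmod_iso_inv[w [w' [wK wK']]]] := module_is_quad W.
pose g' : {linear lquad_mod QU -> lquad_mod QW} := w' \o g \o u.
pose h' : {linear lquad_mod free_quad -> lquad_mod QW} := w' \o h.
have gS1 : surjective (fst_map g' : {linear _ -> _}).
  move=> x; have [v vE] := gS (w (x, 0)).
  have : g' (u' v) = (x, 0) by rewrite /g' /= uK' vE wK.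
  by case: (u' v) => x1 y1; rewrite quad_mapE => -[]; exists x1.
have gS2 : surjective (snd_map g' : {linear _ -> _}).
  move=> x; have [v vE] := gS (w (0, x)).
  have : g' (u' v) = (0, x) by rewrite /g' /= uK' vE wK.
  by case: (u' v) => x1 y1; rewrite quad_mapE => -[]; exists y1.
have h1P : linear (fun p : P => fst_map h' (p, 0)).
  move=> a x y; rewrite -linearP; congr (fst_map h' _).
  by congr pair; rewrite /= ?scaler0 addr0.
have h2P : linear (fun r : R => snd_map h' (0, r)).
  move=> a x y; rewrite -linearP; congr (snd_map h' _).
  by congr pair; rewrite /= ?scaler0 addr0.
have [k1 k1E] := Ppr _ _ (fst_map g' : {linear _ -> _}) (linear_of h1P) gS1.
have [k2 k2E] := Rpr _ _ (snd_map g' : {linear _ -> _}) (linear_of h2P) gS2.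
have [k kE] := free_quad_map k1 k2.
have k1' p : fst_map k (p, 0) = k1 p.
  by rewrite /fst_map (kE p 0 0 0) /= !linear0 addr0.
have k2' r : snd_map k (0, r) = k2 r.
  by rewrite /snd_map (kE 0 0 0 r) /= !linear0 add0r.
have gk v : (g' \o k : {linear _ -> _}) v = h' v.
  apply: free_map_eq => [p|r].
    by rewrite -[RHS](k1E p) /= -k1'; apply: fst_map_comp.
  by rewrite -[RHS](k2E r) /= -k2'; apply: snd_map_comp.
exists (u \o k : {linear _ -> _}) => v; apply: (can_inj wK').
exact: gk.
Qed.

Lemma free_quad_fg : finitely_generated P -> finitely_generated R ->
  finitely_generated (lquad_mod free_quad).
Proof.
move=> [K [p pP]] [J [r rP]].
pose v (i : 'I_(K + J)) : lquad_mod free_quad :=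
  match split i with
  | inl k => ((p k, 0), (0, 0)) | inr j => ((0, 0), (0, r j)) end.
exists (K + J)%N, v => -[[x t] [s y]].
have [c ->] := pP x; have [d ->] := rP y.
have [m ->] := ltensor_spanP pP s; have [n ->] := ltensor_spanP rP t.
pose e (i : 'I_(K + J)) : L :=
  match split i with
  | inl k => (c k, 0, m k, 0) | inr j => (0, n j, 0, d j) end.
exists e; rewrite big_split_ord /=.
have -> : \sum_(i < K) e (lshift J i) *: v (lshift J i) =
  ((\sum_(i < K) c i *: p i, 0), (\sum_(i < K) ltens (m i) (p i), 0)).
  apply: (big_rec3 (fun a b w => w = ((b, 0), (a, 0)) :> lquad_mod free_quad)).
    by [].
  move=> i a b w _ ->; rewrite /e /v (unsplitK (inl i)).
  rewrite lquad_scaleE ltens0l linear0 /= /free_f ltensor_map_tens /=.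
  by congr (_, _, (_, _)); rewrite /= ?scaler0 ?scale0r ?addr0.
have -> : \sum_(i < J) e (rshift K i) *: v (rshift K i) =
  ((0, \sum_(i < J) ltens (n i) (r i)), (0, \sum_(i < J) d i *: r i)).
  apply: (big_rec3 (fun a b w => w = ((0, b), (0, a)) :> lquad_mod free_quad)).
    by [].
  move=> i a b w _ ->; rewrite /e /v (unsplitK (inr i)).
  rewrite lquad_scaleE ltens0l linear0 /= /free_g ltensor_map_tens /=.
  by congr (_, _, (_, _)); rewrite /= ?scaler0 ?scale0r ?addr0 ?add0r.
by congr (_, _, (_, _)); rewrite /= ?addr0 ?add0r.
Qed.

End Def.
End FreeQuad.

(** * Maps into quadruples with zero structure, and projective quadruples *)

Section ZeroQuads.
Variables (A B : pzRingType) (M : bimodType B A) (N : bimodType A B).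
Implicit Types (U : lmodType A) (W : lmodType B).

Definition zero_quad (U : lmodType A) (W : lmodType B) : lquad M N :=
  @LQuad A B M N U W \0 \0 (fun _ _ _ => erefl) (fun _ _ _ => erefl).

Lemma zero_quad_map (Q : lquad M N) U W (a : {linear coker_mod (lqg Q) -> U})
    (b : {linear coker_mod (lqf Q) -> W}) :
  exists phi : {linear lquad_mod Q -> lquad_mod (zero_quad U W)},
    forall x y, phi (x, y) = (a (coker_pi (lqg Q) x), b (coker_pi (lqf Q) y)).
Proof.
apply: (@quad_map_ex _ _ _ _ Q (zero_quad U W)
  (a \o coker_pi (lqg Q) : {linear _ -> _})
  (b \o coker_pi (lqf Q) : {linear _ -> _})) => [n y|m x] /=.
  suff -> : coker_pi (lqg Q) (lqg Q (ltens n y)) = 0 by rewrite linear0.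
  by apply/(coker_right_exact (lqg Q)).2; exists (ltens n y).
suff -> : coker_pi (lqf Q) (lqf Q (ltens m x)) = 0 by rewrite linear0.
by apply/(coker_right_exact (lqf Q)).2; exists (ltens m x).
Qed.

(** Maps to a quadruple with zero structure maps factor through cokernels. *)
Lemma zero_quad_mapP (Q : lquad M N) U W
    (phi : {linear lquad_mod Q -> lquad_mod (zero_quad U W)}) :
  exists (a : {linear coker_mod (lqg Q) -> U})
    (b : {linear coker_mod (lqf Q) -> W}),
    (forall x, fst_map phi x = a (coker_pi (lqg Q) x)) /\
    (forall y, snd_map phi y = b (coker_pi (lqf Q) y)).
Proof.
have [pS pK] := coker_right_exact (lqg Q).
have [qS qK] := coker_right_exact (lqf Q).
have ap x : coker_pi (lqg Q) x = 0 -> fst_map phi x = 0.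
  by move=> /pK[t <-]; rewrite fst_map_g.
have bq y : coker_pi (lqf Q) y = 0 -> snd_map phi y = 0.
  by move=> /qK[t <-]; rewrite snd_map_f.
have [a aE] := factor_surj pS ap; have [b bE] := factor_surj qS bq.
by exists a, b; split=> z; rewrite (aE, bE).
Qed.

(** The cokernel functors are left adjoint to the inclusion of quadruples with
    zero structure maps. *)
Lemma extends_zero_quad (Q Q' : lquad M N)
    (phi : {linear lquad_mod Q -> lquad_mod Q'}) U W :
  extends phi (lquad_mod (zero_quad U W)) <->
  extends (cokg_map phi) U /\ extends (cokf_map phi) W.
Proof.
have [pS _] := coker_right_exact (lqg Q).
have [qS _] := coker_right_exact (lqf Q).
split=> [ext|[extU extW] h].
  split=> [a|b].
    have [h hE] := zero_quad_map a (\0 : {linear coker_mod (lqf Q) -> W}).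
    have [k kE] := ext h; have [a' [_ [a'E _]]] := zero_quad_mapP k.
    exists a' => u; have [x <-] := pS u; rewrite cokg_mapE -a'E.
    by rewrite -(fst_map_comp kE) /fst_map hE.
  have [h hE] := zero_quad_map (\0 : {linear coker_mod (lqg Q) -> U}) b.
  have [k kE] := ext h; have [_ [b' [_ b'E]]] := zero_quad_mapP k.
  exists b' => u; have [x <-] := qS u; rewrite cokf_mapE -b'E.
  by rewrite -(snd_map_comp kE) /snd_map hE.
have [a [b [aE bE]]] := zero_quad_mapP h.
have [a' a'E] := extU a; have [b' b'E] := extW b.
have [k kE] := zero_quad_map a' b'; exists k => -[x y].
rewrite [phi _]quad_mapE kE [RHS]quad_mapE -cokg_mapE -cokf_mapE.
by rewrite a'E b'E aE bE.
Qed.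

(** The inclusion of quadruples with zero structure maps preserves surjections,
    so its left adjoint preserves projectives. *)
Lemma coker_projective (Q : lquad M N) : projective (lquad_mod Q) ->
  projective (coker_mod (lqg Q)) /\ projective (coker_mod (lqf Q)).
Proof.
move=> Qpr.
have lift U W U' W' (a : {linear U -> U'}) (b : {linear W -> W'})
    (h : {linear coker_mod (lqg Q) -> U'})
    (k : {linear coker_mod (lqf Q) -> W'}) :
    surjective a -> surjective b ->
    (exists h' : {linear coker_mod (lqg Q) -> U}, forall x, a (h' x) = h x) /\
    (exists k' : {linear coker_mod (lqf Q) -> W}, forall x, b (k' x) = k x).
  move=> aS bS.
  have [phi phiE] : exists phi : {linear lquad_mod (zero_quad U W) ->
      lquad_mod (zero_quad U' W')}, forall x y, phi (x, y) = (a x, b y).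
    apply: (@quad_map_ex _ _ _ _ (zero_quad U W) (zero_quad U' W') a b) => *;
      exact: linear0.
  have [psi psiE] := zero_quad_map h k.
  have phiS : surjective phi.
    move=> [x y]; have [x' <-] := aS x; have [y' <-] := bS y.
    by exists (x', y'); rewrite phiE.
  have [chi chiE] := Qpr _ _ phi psi phiS.
  have [h' [k' [h'E k'E]]] := zero_quad_mapP chi.
  split.
    exists h' => u; have [x <-] := (coker_right_exact (lqg Q)).1 u.
    have := chiE (x, 0); rewrite quad_mapE phiE psiE => -[<- _].
    by rewrite -h'E.
  exists k' => u; have [x <-] := (coker_right_exact (lqf Q)).1 u.
  have := chiE (0, x); rewrite quad_mapE phiE psiE => -[_ <-].
  by rewrite -k'E.
split=> [U U' a h aS|W W' b k bS].
  apply: (lift U 'rV[B]_0 U' 'rV[B]_0 a idfun h \0 aS _).1.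
  by move=> x; exists x.
apply: (lift 'rV[A]_0 W 'rV[A]_0 W' idfun b \0 k _ bS).2.
by move=> x; exists x.
Qed.

Lemma coker_fg (Q : lquad M N) : finitely_generated (lquad_mod Q) ->
  finitely_generated (coker_mod (lqg Q)) /\
  finitely_generated (coker_mod (lqf Q)).
Proof.
have [phi phiE] := @zero_quad_map Q _ _ idfun idfun.
move=> /(fg_surj (s := phi)) [[x y]|n [v vP]].
  have [x' <-] := (coker_right_exact (lqg Q)).1 x.
  have [y' <-] := (coker_right_exact (lqf Q)).1 y.
  by exists (x', y'); rewrite phiE.
split.
  exists n, (fun i => (v i).1) => x; have [c cE] := vP (x, 0).
  exists (fun i => (c i).1.1.1); rewrite -[LHS]/(x, 0 : coker_mod (lqf Q)).1 cE.
  apply: (big_rec2 (fun (a : lquad_mod (zero_quad _ _)) b => a.1 = b)) => //.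
  move=> i a b _ <-; case: (v i) (c i) => s t [[[r m] m'] r'].
  by rewrite lquad_scaleE /= addr0.
exists n, (fun i => (v i).2) => x; have [c cE] := vP (0, x).
exists (fun i => (c i).2); rewrite -[LHS]/(0 : coker_mod (lqg Q), x).2 cE.
apply: (big_rec2 (fun (a : lquad_mod (zero_quad _ _)) b => a.2 = b)) => //.
move=> i a b _ <-; case: (v i) (c i) => s t [[[r m] m'] r'].
by rewrite lquad_scaleE /= add0r.
Qed.

Section Retract.
Variables (Q T : lquad M N) (s : {linear lquad_mod Q -> lquad_mod T})
  (r : {linear lquad_mod T -> lquad_mod Q}).
Hypothesis sK : cancel s r.

Lemma g_mono_retract : g_mono T -> g_mono Q.
Proof.
move=> Tm t; split; last exact: lqg_coker.
move=> gt; have : lqg T (ltensor_map (snd_map s) t) = 0.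
  by rewrite -fst_map_g gt linear0.
move=> /Tm; rewrite -(ltensor_square (cokf_mapE s)) => e.
have e1 u : cokf_map r (cokf_map s u) = u.
  have [x <-] := (coker_right_exact (lqf Q)).1 u.
  by rewrite !cokf_mapE -(snd_map_comp (chi := idfun)).
rewrite -[LHS](tensor_map_id (f := idfun)) //.
rewrite -(tensor_map_comp (f := cokf_map s) (g := cokf_map r)) //.
by rewrite [tensor_map (cokf_map s) _]e raddf0.
Qed.

Lemma f_mono_retract : f_mono T -> f_mono Q.
Proof.
move=> Tm t; split; last exact: lqf_coker.
move=> ft; have : lqf T (ltensor_map (fst_map s) t) = 0.
  by rewrite -snd_map_f ft linear0.
move=> /Tm; rewrite -(ltensor_square (cokg_mapE s)) => e.
have e1 u : cokg_map r (cokg_map s u) = u.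
  have [x <-] := (coker_right_exact (lqg Q)).1 u.
  by rewrite !cokg_mapE -(fst_map_comp (chi := idfun)).
rewrite -[LHS](tensor_map_id (f := idfun)) //.
rewrite -(tensor_map_comp (f := cokg_map s) (g := cokg_map r)) //.
by rewrite [tensor_map (cokg_map s) _]e raddf0.
Qed.

End Retract.

(** A projective quadruple is a retract of the one induced from its two
    components, which is mono by construction. *)
Lemma projective_mono (Q : lquad M N) : projective (lquad_mod Q) ->
  f_mono Q /\ g_mono Q.
Proof.
move=> Qpr; have [r rE] := free_quad_map (Q := Q) idfun idfun.
have rS : surjective r.
  by move=> [x y]; exists ((x, 0), (0, y)); rewrite rE /= !linear0 addr0 add0r.
have [s sK] := Qpr _ _ r idfun rS.
have sK' : cancel s r by move=> v; exact: sK.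
split; [apply: (f_mono_retract sK') | apply: (g_mono_retract sK')].
  exact: free_f_mono.
exact: free_g_mono.
Qed.

End ZeroQuads.

(** * The columns of the Morita ring *)

Section Columns.
Variables (A B : pzRingType) (M : bimodType B A) (N : bimodType A B).
Local Notation L := (morita00 M N).

Fact colA_f_ex : exists f : {linear ltensor M A^o -> M},
  forall m a, f (ltens m a) = rscale m (a : A).
Proof.
apply: ltensor_lift => [m a a'|m m' a|b m a|m r a].
- exact: rscaleDr.
- exact: rscaleDl.
- by rewrite scale_rscale.
- exact: rscaleA.
Qed.
Definition colA_f := projT1 (cid colA_f_ex).
Lemma colA_fE m a : colA_f (ltens m a) = rscale m (a : A).
Proof. exact: (projT2 (cid colA_f_ex)). Qed.

Fact colB_g_ex : exists g : {linear ltensor N B^o -> N},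
  forall n b, g (ltens n b) = rscale n (b : B).
Proof.
apply: ltensor_lift => [m a a'|m m' a|b m a|m r a].
- exact: rscaleDr.
- exact: rscaleDl.
- by rewrite scale_rscale.
- exact: rscaleA.
Qed.
Definition colB_g := projT1 (cid colB_g_ex).
Lemma colB_gE n b : colB_g (ltens n b) = rscale n (b : B).
Proof. exact: (projT2 (cid colB_g_ex)). Qed.

Fact colA_fg (m : M) (n : N) (y : M) :
  colA_f (ltens m ((\0 : {linear ltensor N M -> A^o}) (ltens n y))) = 0.
Proof. by rewrite /= ltensr0 linear0. Qed.
Fact colB_gf (n : N) (m : M) (x : N) :
  colB_g (ltens n ((\0 : {linear ltensor M N -> B^o}) (ltens m x))) = 0.
Proof. by rewrite /= ltensr0 linear0. Qed.

(** The first column of L, the quadruple [(A, M)]. *)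
Definition colA : lquad M N :=
  @LQuad A B M N A^o M colA_f \0 (fun _ _ _ => erefl) colA_fg.
(** The second column of L, the quadruple [(N, B)]. *)
Definition colB : lquad M N :=
  @LQuad A B M N N B^o \0 colB_g colB_gf (fun _ _ _ => erefl).

Lemma colA_exact :
  exists (s : {linear lquad_mod (zero_quad M N 'rV[A]_0 M) -> lquad_mod colA})
    (q : {linear lquad_mod colA -> lquad_mod (zero_quad M N A^o 'rV[B]_0)}),
    short_exact s q.
Proof.
have [|m x|s sE] :=
  @quad_map_ex _ _ _ _ (zero_quad M N 'rV[A]_0 M) colA \0 idfun.
- by [].
- by rewrite /= ltensr0 linear0.
have [|m x|q qE] :=
  @quad_map_ex _ _ _ _ colA (zero_quad M N A^o 'rV[B]_0) idfun \0.
- by [].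
- by [].
exists s, q; split=> [[x y] [x' y']|].
  by rewrite !sE => -[->]; rewrite (thinmx0 x) (thinmx0 x').
split=> [[x y]|[x y]]; first by exists (x, 0); rewrite qE (thinmx0 y).
split=> [|[[u v]]]; first by rewrite qE => -[->]; exists (0, y); rewrite sE.
by rewrite sE qE => -[<- _].
Qed.

Lemma colB_exact :
  exists (s : {linear lquad_mod (zero_quad M N N 'rV[B]_0) -> lquad_mod colB})
    (q : {linear lquad_mod colB -> lquad_mod (zero_quad M N 'rV[A]_0 B^o)}),
    short_exact s q.
Proof.
have [m x||s sE] :=
  @quad_map_ex _ _ _ _ (zero_quad M N N 'rV[B]_0) colB idfun \0.
- by rewrite /= ltensr0 linear0.
- by [].
have [||q qE] :=
  @quad_map_ex _ _ _ _ colB (zero_quad M N 'rV[A]_0 B^o) \0 idfun.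
- by [].
- by [].
exists s, q; split=> [[x y] [x' y']|].
  by rewrite !sE => -[->]; rewrite (thinmx0 y) (thinmx0 y').
split=> [[x y]|[x y]]; first by exists (0, y); rewrite qE (thinmx0 x).
split=> [|[[u v]]]; first by rewrite qE => -[->]; exists (x, 0); rewrite sE.
by rewrite sE qE => -[_ <-].
Qed.

(** L is the direct sum of its columns. *)
Lemma extends_regular (K X : lmodType L) (i : {linear K -> X}) :
  extends i L^o <-> extends i (lquad_mod colA) /\ extends i (lquad_mod colB).
Proof.
pose inA (v : lquad_mod colA) : L^o := (v.1, 0, v.2, 0).
pose inB (v : lquad_mod colB) : L^o := (0, v.1, 0, v.2).
pose prA (l : L^o) : lquad_mod colA := (l.1.1.1, l.1.2).
pose prB (l : L^o) : lquad_mod colB := (l.1.1.2, l.2).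
have inAP : linear inA.
  move=> [[[a n] m] b] [x y] [x' y']; rewrite /inA !lquad_scaleE /= colA_fE.
  rewrite -[X in _ = X + _]/(((a, n, m, b) : L) * ((x, 0, y, 0) : L)).
  rewrite morita_mulE.
  rewrite morita_addE; congr (_, _, _, _);
    by rewrite ?scaler0 ?rscale0 ?mulr0 ?addr0.
have inBP : linear inB.
  move=> [[[a n] m] b] [x y] [x' y']; rewrite /inB !lquad_scaleE /= colB_gE.
  rewrite -[X in _ = X + _]/(((a, n, m, b) : L) * ((0, x, 0, y) : L)).
  rewrite morita_mulE.
  rewrite morita_addE; congr (_, _, _, _);
    by rewrite ?scaler0 ?rscale0 ?mulr0 ?addr0 ?add0r.
have prAP : linear prA.
  move=> [[[a n] m] b] [[[x t] y] u] [[[x' t'] y'] u'].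
  rewrite /prA !lquad_scaleE /= colA_fE.
  by congr pair; rewrite ?addr0.
have prBP : linear prB.
  move=> [[[a n] m] b] [[[x t] y] u] [[[x' t'] y'] u'].
  rewrite /prB !lquad_scaleE /= colB_gE.
  by congr pair; rewrite ?add0r.
split=> [ext|[extA extB] h].
  split.
    by apply: (extends_retract (b := linear_of prAP)
      (a := linear_of inAP)) ext => -[].
  by apply: (extends_retract (b := linear_of prBP)
    (a := linear_of inBP)) ext => -[].
have [k kE] := extA (linear_of prAP \o h : {linear _ -> _}).
have [l lE] := extB (linear_of prBP \o h : {linear _ -> _}).
exists ((linear_of inAP \o k) \+ (linear_of inBP \o l) :
  {linear X -> L^o}) => u.
rewrite /= kE lE /=; case: (h u) => [[[a n] m] b].
by rewrite /inA /inB /= [LHS]morita_addE !addr0 !add0r.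
Qed.

End Columns.

(** * Steps between quadruples *)

Section QuadSteps.
Variables (A B : pzRingType) (M : bimodType B A) (N : bimodType A B).
Implicit Types Q F : lquad M N.

Lemma linked_quad Q Q' : linked (lquad_mod Q) (lquad_mod Q') ->
  exists F (phi : {linear lquad_mod Q -> lquad_mod F})
    (psi : {linear lquad_mod F -> lquad_mod Q'}), step phi psi.
Proof.
move=> [P [i [p [Pfg Ppr [iI [pS pK]] iR]]]].
have [F /[dup] FP /lmod_iso_inv[a [b [ab ba]]]] := module_is_quad P.
exists F, (b \o i : {linear _ -> _}), (p \o a : {linear _ -> _}).
split; first 1 last.
- exact: projective_iso (lmod_iso_sym FP) Ppr.
- split; first by move=> u v /= /(can_inj ba)/iI.
  split=> [y|x]; first by have [x <-] := pS y; exists (b x); rewrite /= ba.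
  rewrite /= pK; split=> -[k kE]; exists k; first by rewrite kE ab.
  by rewrite -kE ba.
- move=> h; have [k kE] := iR h; exists (k \o a : {linear _ -> _}) => u.
  by rewrite /= ba kE.
- by apply: (fg_surj (s := b)) Pfg => x; exists (a x); rewrite ab.
Qed.

Lemma quad_step_up Q : gorenstein_projective (lquad_mod Q) ->
  exists F Q' (phi : {linear lquad_mod Q -> lquad_mod F})
    (psi : {linear lquad_mod F -> lquad_mod Q'}),
    gorenstein_projective (lquad_mod Q') /\ step phi psi.
Proof.
move=> /gorenstein_closed[[V [VG QV]] _].
have [Q' /lmod_iso_sym VQ'] := module_is_quad V.
have [F [phi [psi st]]] := linked_quad (linked_iso (lmod_iso_refl _) VQ' QV).
by exists F, Q', phi, psi; split=> //; apply: gorenstein_iso VQ' VG.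
Qed.

Lemma quad_step_down Q : gorenstein_projective (lquad_mod Q) ->
  exists F K (phi : {linear lquad_mod K -> lquad_mod F})
    (psi : {linear lquad_mod F -> lquad_mod Q}),
    gorenstein_projective (lquad_mod K) /\ step phi psi.
Proof.
move=> /gorenstein_closed[_ [V [VG QV]]].
have [K /lmod_iso_sym VK] := module_is_quad V.
have [F [phi [psi st]]] := linked_quad (linked_iso VK (lmod_iso_refl _) QV).
by exists F, K, phi, psi; split=> //; apply: gorenstein_iso VK VG.
Qed.

Lemma quad_gorenstein (D : lquad M N -> Prop) Q :
  (forall Q, D Q ->
    (exists Q', D Q' /\ linked (lquad_mod Q) (lquad_mod Q')) /\
    (exists K, D K /\ linked (lquad_mod K) (lquad_mod Q))) ->
  D Q -> gorenstein_projective (lquad_mod Q).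
Proof.
move=> Dcl DQ; apply/gorensteinP.
exists (fun V => exists Q, D Q /\ lmod_iso (lquad_mod Q) V).
split; last by exists Q; split=> //; apply: lmod_iso_refl.
move=> V [Q1 [DQ1 Q1V]]; have [[Q' [DQ' l]] [K [DK l']]] := Dcl _ DQ1.
split.
  exists (lquad_mod Q'); split; last exact: linked_iso Q1V (lmod_iso_refl _) l.
  by exists Q'; split=> //; apply: lmod_iso_refl.
exists (lquad_mod K); split; last exact: linked_iso (lmod_iso_refl _) Q1V l'.
by exists K; split=> //; apply: lmod_iso_refl.
Qed.

Lemma quad_quotient Q F (phi : {linear lquad_mod Q -> lquad_mod F}) :
  injective phi -> exists Q' (psi : {linear lquad_mod F -> lquad_mod Q'}),
    short_exact phi psi.
Proof.
move=> phiI.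
have [Q' /lmod_iso_inv[a [b [ab ba]]]] := module_is_quad (coker_mod phi).
exists Q', (b \o coker_pi phi : {linear _ -> _}); split=> //.
have [pS pK] := coker_right_exact phi.
split=> [y|x]; first by have [x xE] := pS (a y); exists x; rewrite /= xE ab.
rewrite -pK /=; split=> [e|->]; last exact: linear0.
by apply: (can_inj ba); rewrite e linear0.
Qed.

Lemma quad_kernel F Q (psi : {linear lquad_mod F -> lquad_mod Q}) :
  surjective psi -> exists K (phi : {linear lquad_mod K -> lquad_mod F}),
    short_exact phi psi.
Proof.
move=> psiS.
have [K /lmod_iso_inv[a [b [ab ba]]]] := module_is_quad (ker_mod psi).
have [vI [_ vK]] := ker_short_exact psiS.
exists K, ((val : {linear ker_mod psi -> _}) \o a : {linear _ -> _}).
split; first by move=> u v /= /val_inj/(can_inj ab).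
split=> // x; rewrite vK; split=> -[k kE]; last by exists (a k).
by exists (b k); rewrite /= ba.
Qed.

End QuadSteps.

(** * Tensoring with the row (M, 0) *)

Section ColumnTensor.
Variables (A B : pzRingType) (M : bimodType B A) (N : bimodType A B).
Local Notation L := (morita00 M N).
Local Notation Z := (rquad_mod (rquad_l M N (right_of M))).
Implicit Types Q : lquad M N.

Lemma rquad_l_scaleE a n m b (c : right_of M) (d : 'rV[B^c]_0) :
  ((a, n, m, b) : L^c) *: ((c, d) : Z) = ((a : A^c) *: c, 0).
Proof.
have -> : ((a, n, m, b) : L^c) *: ((c, d) : Z) =
  ((a : A^c) *: c + 0, 0 + (b : B^c) *: d) by [].
by rewrite addr0 (thinmx0 (0 + _)).
Qed.

(** The action of L on the row [(M, 0)] factors through [A], so the second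
    components and the image of [g] are killed in the tensor product: it is
    [M (x) Coker g]. *)
Lemma coker_tensorP Q :
  exists T : tensor Z (lquad_mod Q) -> ltensor M (coker_mod (lqg Q)),
  [/\ zmod_morphism T, bijective T &
    forall m d x y, T (tens ((m, d) : Z) ((x, y) : lquad_mod Q)) =
      ltens (m : M) (coker_pi (lqg Q) x)].
Proof.
pose pi := coker_pi (lqg Q); have [piS piK] := coker_right_exact (lqg Q).
pose phi (z : Z) (v : lquad_mod Q) := ltens (z.1 : M) (pi v.1).
have phiB : balanced phi.
  split=> [[c d] [c' d'] v|z v v'|].
  - exact: ltensDl.
  - by rewrite /phi /= /pi raddfD ltensDr.
  - move=> [[[a n] m] b] [c d] [x y].
    rewrite rquad_l_scaleE lquad_scaleE /phi /= /pi linearD linearZ /=.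
    have -> : coker_pi (lqg Q) (lqg Q (ltens n y)) = 0.
      by apply/piK; exists (ltens n y).
    by rewrite addr0 -ltensM.
pose T : tensor Z (lquad_mod Q) -> ltensor M (coker_mod (lqg Q)) :=
  tensor_lift phi.
have TE z v : T (tens z v) = phi z v by apply: tensor_lift_tens.
have TB : zmod_morphism T by apply: tensor_lift_zmod.
(* The image of [g] is reached by matrices with entry in [N], which act by zero
   on the row. *)
have e0 (m : right_of M) t : tens ((m, 0) : Z) ((lqg Q t, 0) : lquad_mod Q) = 0.
  elim/ltensor_ind: t => [|s t sP tP|n y].
  - by rewrite linear0; apply: tens0r.
  - have -> : (lqg Q (s - t), 0) = (lqg Q s, 0) - (lqg Q t, 0) :> lquad_mod Q.
      by rewrite linearB; congr pair; rewrite /= subr0.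
    rewrite -[LHS]addr0 -[in LHS]tP -tensDr subrK; exact: sP.
  - have -> : (lqg Q (ltens n y), 0) =
        ((0, n, 0, 0) : L) *: ((0, y) : lquad_mod Q).
      by rewrite lquad_scaleE !ltens0l scaler0 scale0r !linear0 !add0r.
    rewrite -tensM rquad_l_scaleE scale0r -[(0, 0)]/(0 : Z).
    exact: tens0l.
pose r u := projT1 (cid (piS u)).
have rK u : coker_pi (lqg Q) (r u) = u := projT2 (cid (piS u)).
pose psi (m : right_of M) u : tensor Z (lquad_mod Q) :=
  tens ((m, 0) : Z) ((r u, 0) : lquad_mod Q).
(* Independence of the chosen representative. *)
have psiE m u x : coker_pi (lqg Q) x = u ->
    psi m u = tens ((m, 0) : Z) ((x, 0) : lquad_mod Q).
  move=> xu; have /piK[t tE] : coker_pi (lqg Q) (r u - x) = 0.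
    by rewrite linearB /= rK xu subrr.
  rewrite /psi -[RHS]addr0 -(e0 m t) -tensDr tE; congr tens.
  by congr pair; rewrite /= ?addr0 // addrC subrK.
have psiB : balanced psi.
  split=> [m m' u|m u u'|a m u].
  - rewrite /psi -tensDl; congr tens; congr pair; by rewrite addr0.
  - rewrite (psiE m _ (r u + r u')) ?raddfD /= ?rK // -tensDr; congr tens.
    by congr pair; rewrite /= addr0.
  - rewrite (psiE m _ (a *: r u)) ?linearZ /= ?rK // /psi.
    have -> : (((a : A^c) *: m, 0) : Z) = ((a, 0, 0, 0) : L^c) *: ((m, 0) : Z).
      by rewrite rquad_l_scaleE.
    rewrite tensM lquad_scaleE; congr tens; congr pair.
      by rewrite !ltens0l linear0 addr0.
    by rewrite !ltens0l linear0 add0r scaler0.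
pose T' : ltensor M (coker_mod (lqg Q)) -> tensor Z (lquad_mod Q) :=
  tensor_lift psi.
have TE' m u : T' (ltens m u) = psi m u by apply: tensor_lift_tens.
have TB' : zmod_morphism T' by apply: tensor_lift_zmod.
exists T; split=> //; last by move=> m d x y; rewrite TE.
exists T'.
  apply: (tensor_eq (F := T' \o T) (G := id)) => // [u v|[m d] [x y]] /=.
    by rewrite TB; exact: (TB' (T u) (T v)).
  rewrite TE TE' (psiE m _ x) //.
  have -> : ((m, d) : Z) = ((1, 0, 0, 0) : L^c) *: ((m, d) : Z).
    by rewrite rquad_l_scaleE scale1r (thinmx0 d).
  rewrite tensM lquad_scaleE (thinmx0 d) !scale1r !ltens0l !linear0.
  by rewrite scale0r !addr0.
apply: (tensor_eq (F := T \o T') (G := id)) => // [u v|m u] /=.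
  by rewrite TB'; exact: (TB (T' u) (T' v)).
by rewrite TE' TE /phi /= /pi rK.
Qed.

Lemma tensor_cokg_injP Q Q' (phi : {linear lquad_mod Q -> lquad_mod Q'}) :
  injective (tensor_map phi : tensor Z _ -> _) <->
  injective (ltensor_map (cokg_map phi) : ltensor M _ -> _).
Proof.
have [T [TB Tbij TE]] := coker_tensorP Q.
have [T' [TB' Tbij' TE']] := coker_tensorP Q'.
have nat t : T' (tensor_map phi t) = ltensor_map (cokg_map phi) (T t).
  move: t; apply: (tensor_eq (F := T' \o tensor_map phi)
    (G := ltensor_map (cokg_map phi) \o T)) => [u v|u v|[m d] [x y]] /=.
  - by rewrite raddfB TB'.
  - by rewrite TB raddfB.
  - by rewrite tensor_map_tens quad_mapE TE TE' ltensor_map_tens cokg_mapE.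
have [S TK SK] := Tbij.
split=> inj s t.
  rewrite -(SK s) -(SK t) -!nat => /(bij_inj Tbij')/inj.
  by move=> ->.
move=> /(congr1 T'); rewrite !nat => /inj.
exact: bij_inj.
Qed.

End ColumnTensor.

(** * Glued quadruples *)

Section GorensteinQuads.
Variables (A B : pzRingType) (M : bimodType B A) (N : bimodType A B).
Local Notation L := (morita00 M N).
Implicit Types (Q F K : lquad M N) (G P : lmodType A) (H R : lmodType B).

(** [X] is an extension of [Coker g] by [N (x) Coker f], [Y] is an extension of
    [Coker f] by [M (x) Coker g], and both cokernels are
    Gorenstein-projective. *)
Definition glued Q := [/\ f_mono Q, g_mono Q,
  gorenstein_projective (coker_mod (lqf Q)) &
  gorenstein_projective (coker_mod (lqg Q))].

(** Each column of L is an extension of quadruples with zero structure maps: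
    [(A, 0)] by [(0, M)], and [(0, B)] by [(N, 0)]. *)
Lemma extends_regular_of_cokers Q F
    (phi : {linear lquad_mod Q -> lquad_mod F}) :
  projective (lquad_mod F) ->
  extends (cokg_map phi) A^o -> extends (cokg_map phi) N ->
  extends (cokf_map phi) B^o -> extends (cokf_map phi) M -> extends phi L^o.
Proof.
move=> Fpr gA gN fB fM; apply/extends_regular; split.
  have [s [q ex]] := colA_exact M N.
  by apply: (extends_middle Fpr ex); apply/extends_zero_quad; split=> //;
    apply: extends_rV0.
have [s [q ex]] := colB_exact M N.
by apply: (extends_middle Fpr ex); apply/extends_zero_quad; split=> //;
  apply: extends_rV0.
Qed.

(** A construction that turns steps between Gorenstein-projective quadruples
    into steps has Gorenstein-projective values, since these values form a class
    closed under steps. *)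
Lemma gorenstein_image (S : pzRingType) (c : lquad M N -> lmodType S) Q :
  (forall Q F Q' (phi : {linear lquad_mod Q -> lquad_mod F})
     (psi : {linear lquad_mod F -> lquad_mod Q'}),
     gorenstein_projective (lquad_mod Q) ->
     gorenstein_projective (lquad_mod Q') -> step phi psi ->
     linked (c Q) (c Q')) ->
  gorenstein_projective (lquad_mod Q) -> gorenstein_projective (c Q).
Proof.
move=> cl QG; apply/gorensteinP.
exists (fun V => exists Q, gorenstein_projective (lquad_mod Q) /\ V = c Q).
split; last by exists Q.
move=> V [{QG}Q [QG ->]].
have [F [Q' [phi [psi [Q'G st]]]]] := quad_step_up QG.
have [F0 [K [phi0 [psi0 [KG st0]]]]] := quad_step_down QG.
split.
  by exists (c Q'); split; [exists Q' | apply: cl st].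
by exists (c K); split; [exists K | apply: cl st0].
Qed.

(** * From compatibility to gluing *)

Section Sufficiency.
Hypotheses (Mc : weakly_compatible M) (Nc : weakly_compatible N).

Lemma quad_step_of_cokers Q F Q' (phi : {linear lquad_mod Q -> lquad_mod F})
    (psi : {linear lquad_mod F -> lquad_mod Q'}) :
  finitely_generated (lquad_mod F) -> projective (lquad_mod F) ->
  short_exact phi psi -> injective (cokg_map phi) -> injective (cokf_map phi) ->
  gorenstein_projective (coker_mod (lqg Q')) ->
  gorenstein_projective (coker_mod (lqf Q')) -> step phi psi.
Proof.
move=> Ffg Fpr ex gI fI gG fG; split=> //.
have gex : short_exact (cokg_map phi) (cokg_map psi).
  by split=> //; apply: cokg_right_exact.
have fex : short_exact (cokf_map phi) (cokf_map psi).
  by split=> //; apply: cokf_right_exact.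
apply: extends_regular_of_cokers => //.
- exact: compatible_ext1 (@regular_compatible A) gG _ _ _ _ gex.
- exact: compatible_ext1 Nc.1 gG _ _ _ _ gex.
- exact: compatible_ext1 (@regular_compatible B) fG _ _ _ _ fex.
- exact: compatible_ext1 Mc.1 fG _ _ _ _ fex.
Qed.

(** Horseshoe argument.  Given steps out of the cokernels, into [P] and [R], the
    map [N (x) Coker f -> N (x) R] extends to [X] because
    Ext^1(Coker g, N (x) R) vanishes; with [X -> Coker g -> P] this gives
    the first component of an embedding in the quadruple induced from
    [(P, R)]. *)
Lemma glued_up Q : glued Q ->
  exists Q', glued Q' /\ linked (lquad_mod Q) (lquad_mod Q').
Proof.
move=> [Qf Qg fG gG].
have [[G1 [G1g [P [i [p [Pfg Ppr iex iA]]]]]] _] := gorenstein_closed gG.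
have [[H1 [H1g [R [j [q [Rfg Rpr jex jB]]]]]] _] := gorenstein_closed fG.
pose pg := coker_pi (lqg Q) : {linear lqX Q -> coker_mod (lqg Q)}.
pose pf := coker_pi (lqf Q) : {linear lqY Q -> coker_mod (lqf Q)}.
have pgex : right_exact (lqg Q) pg := coker_right_exact (lqg Q).
have pfex : right_exact (lqf Q) pf := coker_right_exact (lqf Q).
have NR : ext1_zero (coker_mod (lqg Q)) (ltensor N R).
  move=> K X a b ex; apply: extends_ltensor => //.
  exact: compatible_ext1 Nc.1 gG _ _ _ _ ex.
have MP : ext1_zero (coker_mod (lqf Q)) (ltensor M P).
  move=> K X a b ex; apply: extends_ltensor => //.
  exact: compatible_ext1 Mc.1 fG _ _ _ _ ex.
have [e eE] :=
  extend_from_image (ltensor_map j : {linear _ -> _}) pfex.1 Qg pgex NR.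
have [e' eE'] :=
  extend_from_image (ltensor_map i : {linear _ -> _}) pgex.1 Qf pfex MP.
pose F := free_quad M N P R.
have alP : linear (fun x : lqX Q => (i (pg x), e x) : lqX F).
  by move=> a x y; rewrite !linearP.
have beP : linear (fun y : lqY Q => (e' y, j (pf y)) : lqY F).
  by move=> a x y; rewrite !linearP.
have Ninj := right_compatible_step Nc.2 fG (And4 Rfg Rpr jex jB).
have Minj := right_compatible_step Mc.2 gG (And4 Pfg Ppr iex iA).
have [n y|m x|phi phiE] :=
  @quad_map_ex _ _ _ _ Q F (linear_of alP) (linear_of beP).
- rewrite /= /free_g ltensor_map_tens /= eE /= !ltensor_map_tens.
  have -> : pg (lqg Q (ltens n y)) = 0 by apply/pgex.2; exists (ltens n y).
  by rewrite linear0.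
- rewrite /= /free_f ltensor_map_tens /= eE' /= !ltensor_map_tens.
  have -> : pf (lqf Q (ltens m x)) = 0 by apply/pfex.2; exists (ltens m x).
  by rewrite linear0.
have phiI : injective phi.
  apply: linear_inj => -[x y]; rewrite phiE => -[ix ex ey jy].
  have /pgex.2[t tE] : pg x = 0 by apply: linear_inj0 ix; case: iex.
  have /pfex.2[s sE] : pf y = 0 by apply: linear_inj0 jy; case: jex.
  congr pair.
    rewrite -tE; apply/Qg; apply: Ninj; rewrite raddf0.
    by rewrite -[LHS]eE tE.
  rewrite -sE; apply/Qf; apply: Minj; rewrite raddf0.
  by rewrite -[LHS]eE' sE.
have [Q' [psi ex]] := quad_quotient phiI.
have [k [kI kS kE]] :=
  right_exact_compare (coker_right_exact (lqg F)) (free_coker_g M N P R).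
have [l [lI lS lE]] :=
  right_exact_compare (coker_right_exact (lqf F)) (free_coker_f M N P R).
have ki u : k (cokg_map phi u) = i u.
  by have [x <-] := pgex.1 u; rewrite cokg_mapE kE /fst_map phiE.
have lj u : l (cokf_map phi u) = j u.
  by have [x <-] := pfex.1 u; rewrite cokf_mapE lE /snd_map phiE.
have phigI : injective (cokg_map phi).
  by move=> u v uv; case: iex => iI _; apply: iI; rewrite -!ki uv.
have phifI : injective (cokf_map phi).
  by move=> u v uv; case: jex => jI _; apply: jI; rewrite -!lj uv.
have gG' : gorenstein_projective (coker_mod (lqg Q')).
  apply: gorenstein_iso G1g.
  apply: right_exact_uniq (cokg_right_exact ex).
  exact: right_exact_middle kI kS ki iex.2.
have fG' : gorenstein_projective (coker_mod (lqf Q')).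
  apply: gorenstein_iso H1g.
  apply: right_exact_uniq (cokf_right_exact ex).
  exact: right_exact_middle lI lS lj jex.2.
exists Q'; split.
  split=> //; first exact: f_mono_quo ex (@free_f_mono _ _ _ _ P R) phifI.
  exact: g_mono_quo ex (@free_g_mono _ _ _ _ P R) phigI.
exists (lquad_mod F), phi, psi; apply: quad_step_of_cokers => //.
  exact: free_quad_fg.
exact: free_quad_projective.
Qed.

(** Given steps [P -> Coker g] and [R -> Coker f], liftings to [X] and [Y]
    induce a surjection from the quadruple induced from [(P, R)]; its kernel is
    glued by the snake lemma. *)
Lemma glued_down Q : glued Q ->
  exists K, glued K /\ linked (lquad_mod K) (lquad_mod Q).
Proof.
move=> [Qf Qg fG gG].
have [_ [K0 [K0g [P [i [p [Pfg Ppr iex iA]]]]]]] := gorenstein_closed gG.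
have [_ [K1 [K1g [R [j [q [Rfg Rpr jex jB]]]]]]] := gorenstein_closed fG.
pose pg := coker_pi (lqg Q) : {linear lqX Q -> coker_mod (lqg Q)}.
pose pf := coker_pi (lqf Q) : {linear lqY Q -> coker_mod (lqf Q)}.
have pgex : right_exact (lqg Q) pg := coker_right_exact (lqg Q).
have pfex : right_exact (lqf Q) pf := coker_right_exact (lqf Q).
have [a aE] := Ppr _ _ pg p pgex.1; have [b bE] := Rpr _ _ pf q pfex.1.
pose F := free_quad M N P R.
have [psi psiE] := free_quad_map a b.
have psiS : surjective psi.
  move=> [x y]; have [u uE] := iex.2.1 (pg x); have [v vE] := jex.2.1 (pf y).
  have /pgex.2[t tE] : pg (x - a u) = 0 by rewrite linearB aE uE subrr.
  have /pfex.2[s sE] : pf (y - b v) = 0 by rewrite linearB bE vE subrr.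
  have [t0 t0E] := ltensor_map_surj jex.2.1 (ltensor_map pf t).
  have [s0 s0E] := ltensor_map_surj iex.2.1 (ltensor_map pg s).
  exists ((u, t0), (s0, v)); rewrite psiE.
  have -> : lqg Q (ltensor_map b t0) = x - a u.
    rewrite -tE; apply/eqP; rewrite -subr_eq0 -linearB; apply/eqP/Qg.
    by rewrite raddfB /= -t0E (ltensor_map_comp bE) subrr.
  have -> : lqf Q (ltensor_map a s0) = y - b v.
    rewrite -sE; apply/eqP; rewrite -subr_eq0 -linearB; apply/eqP/Qf.
    by rewrite raddfB /= -s0E (ltensor_map_comp aE) subrr.
  by rewrite addrC subrK subrK.
have [K [phi ex]] := quad_kernel psiS.
have [k [kI kS kE]] :=
  right_exact_compare (coker_right_exact (lqg F)) (free_coker_g M N P R).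
have [l [lI lS lE]] :=
  right_exact_compare (coker_right_exact (lqf F)) (free_coker_f M N P R).
have kp u : cokg_map psi u = p (k u).
  have [[x t] <-] := (coker_right_exact (lqg F)).1 u.
  rewrite cokg_mapE kE /fst_map psiE /= linearD /=.
  rewrite -[coker_pi _ (a x)]/(pg (a x)) aE.
  have -> : coker_pi (lqg Q) (lqg Q (ltensor_map b t)) = 0.
    by apply/pgex.2; exists (ltensor_map b t).
  by rewrite addr0.
have lq u : cokf_map psi u = q (l u).
  have [[s y] <-] := (coker_right_exact (lqf F)).1 u.
  rewrite cokf_mapE lE /snd_map psiE /= linearD /=.
  rewrite -[coker_pi _ (b y)]/(pf (b y)) bE.
  have -> : coker_pi (lqf Q) (lqf Q (ltensor_map a s)) = 0.
    by apply/pfex.2; exists (ltensor_map a s).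
  by rewrite add0r.
have Fpr : projective (lquad_mod F) by apply: free_quad_projective.
have Ffg : finitely_generated (lquad_mod F) by apply: free_quad_fg.
have Fgm : g_mono F by apply: free_g_mono.
have Ffm : f_mono F by apply: free_f_mono.
have gI := cokg_map_inj ex Fgm Qg; have fI := cokf_map_inj ex Ffm Qf.
have gex : short_exact (cokg_map phi) (cokg_map psi).
  by split=> //; apply: cokg_right_exact.
have fex : short_exact (cokf_map phi) (cokf_map psi).
  by split=> //; apply: cokf_right_exact.
have [Fgpr Ffpr] := coker_projective Fpr; have [Fgfg Fffg] := coker_fg Ffg.
have gKG : gorenstein_projective (coker_mod (lqg K)).
  apply: gorenstein_iso K0g.
  exact: short_exact_uniq iex (short_exact_middle kI kS kp gex).
have fKG : gorenstein_projective (coker_mod (lqf K)).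
  apply: gorenstein_iso K1g.
  exact: short_exact_uniq jex (short_exact_middle lI lS lq fex).
exists K; split.
  2: by exists (lquad_mod F), phi, psi; apply: quad_step_of_cokers.
split=> //.
  apply: (f_mono_sub ex Ffm).
  apply: (right_compatible_step Mc.2 gKG (p := cokg_map psi)).
  split=> //; exact: compatible_ext1 (@regular_compatible A) gG _ _ _ _ gex.
apply: (g_mono_sub ex Fgm).
apply: (right_compatible_step Nc.2 fKG (p := cokf_map psi)).
split=> //; exact: compatible_ext1 (@regular_compatible B) fG _ _ _ _ fex.
Qed.

Lemma glued_gorenstein Q : glued Q -> gorenstein_projective (lquad_mod Q).
Proof.
apply: quad_gorenstein => {}Q Qgl.
by split; [apply: glued_up | apply: glued_down].
Qed.

Section Necessity.
Hypotheses
  (Ncol : left_semi_weakly_compatible (lquad_mod (lquad_l M N N)))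
  (Mrow : right_semi_weakly_compatible (rquad_mod (rquad_l M N (right_of M)))).

(** Embed [Q] in a projective by a step: compatibility of the row [(M, 0)] says
    that the induced map of cokernels of [g] stays injective after tensoring
    with [M]. *)
Lemma gorenstein_f_mono Q : gorenstein_projective (lquad_mod Q) -> f_mono Q.
Proof.
move=> QG; have [F [Q' [phi [psi [Q'G st]]]]] := quad_step_up QG.
have [_ Fpr ex _] := st; apply: (f_mono_sub ex (projective_mono Fpr).1).
by apply/tensor_cokg_injP; apply: right_compatible_step Mrow QG st.
Qed.

(** The snake lemma gives exactness.  The extension property into [B] is
    obtained from the one into the column [(N, B)], by shifting to the previous
    step, where maps into [(N, 0)] extend. *)
Lemma gorenstein_step_f Q F Q' (phi : {linear lquad_mod Q -> lquad_mod F})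
    (psi : {linear lquad_mod F -> lquad_mod Q'}) :
  gorenstein_projective (lquad_mod Q) -> gorenstein_projective (lquad_mod Q') ->
  step phi psi -> step (cokf_map phi) (cokf_map psi).
Proof.
move=> QG Q'G [Ffg Fpr ex phiL].
split; [exact: (coker_fg Ffg).2 | exact: (coker_projective Fpr).2 | |].
  split; last exact: cokf_right_exact.
  exact: cokf_map_inj ex (projective_mono Fpr).1 (gorenstein_f_mono Q'G).
have [F0 [K [phi0 [psi0 [KG [_ F0pr ex0 _]]]]]] := quad_step_down QG.
have [s [q sq]] := colB_exact M N.
suff : extends phi (lquad_mod (zero_quad M N 'rV[A]_0 B^o)).
  by move=> /extends_zero_quad[].
apply: (extends_quotient F0pr ex0 sq).
  exact: compatible_ext1 Ncol QG _ _ _ _ ex0.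
exact: ((extends_regular phi).1 phiL).2.
Qed.

Lemma gorenstein_cokf Q :
  gorenstein_projective (lquad_mod Q) ->
  gorenstein_projective (coker_mod (lqf Q)).
Proof.
apply: (gorenstein_image (c := fun Q => coker_mod (lqf Q))) => {}Q F Q' phi psi.
by move=> QG Q'G st; do 3!eexists; apply: gorenstein_step_f QG Q'G st.
Qed.

(** The cokernels of [f] form a step, to which compatibility of [N] applies. *)
Lemma gorenstein_g_mono Q : gorenstein_projective (lquad_mod Q) -> g_mono Q.
Proof.
move=> QG; have [F [Q' [phi [psi [Q'G st]]]]] := quad_step_up QG.
have [_ Fpr ex _] := st; apply: (g_mono_sub ex (projective_mono Fpr).2).
apply: right_compatible_step Nc.2 (gorenstein_cokf QG) _.
exact: gorenstein_step_f QG Q'G st.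
Qed.

(** The same shift, now along [(0, M) -> (A, M) -> (A, 0)]; maps into [(0, M)]
    extend by compatibility of [M] with the step on the cokernels of [f]. *)
Lemma gorenstein_step_g Q F Q' (phi : {linear lquad_mod Q -> lquad_mod F})
    (psi : {linear lquad_mod F -> lquad_mod Q'}) :
  gorenstein_projective (lquad_mod Q) -> gorenstein_projective (lquad_mod Q') ->
  step phi psi -> step (cokg_map phi) (cokg_map psi).
Proof.
move=> QG Q'G [Ffg Fpr ex phiL].
split; [exact: (coker_fg Ffg).1 | exact: (coker_projective Fpr).1 | |].
  split; last exact: cokg_right_exact.
  exact: cokg_map_inj ex (projective_mono Fpr).2 (gorenstein_g_mono Q'G).
have [F0 [K [phi0 [psi0 [KG st0]]]]] := quad_step_down QG.
have [_ F0pr ex0 _] := st0.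
have [s [q sq]] := colA_exact M N.
suff : extends phi (lquad_mod (zero_quad M N A^o 'rV[B]_0)).
  by move=> /extends_zero_quad[].
apply: (extends_quotient F0pr ex0 sq).
  2: exact: ((extends_regular phi).1 phiL).1.
apply/extends_zero_quad; split; first exact: extends_rV0.
have [_ _ fex _] := gorenstein_step_f KG QG st0.
exact: compatible_ext1 Mc.1 (gorenstein_cokf QG) _ _ _ _ fex.
Qed.

Lemma gorenstein_cokg Q :
  gorenstein_projective (lquad_mod Q) ->
  gorenstein_projective (coker_mod (lqg Q)).
Proof.
apply: (gorenstein_image (c := fun Q => coker_mod (lqg Q))) => {}Q F Q' phi psi.
by move=> QG Q'G st; do 3!eexists; apply: gorenstein_step_g QG Q'G st.
Qed.

Lemma gorenstein_glued Q : gorenstein_projective (lquad_mod Q) -> glued Q.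
Proof.
move=> QG; split; first exact: gorenstein_f_mono.
- exact: gorenstein_g_mono.
- exact: gorenstein_cokf.
- exact: gorenstein_cokg.
Qed.

End Necessity.

End Sufficiency.

(** * From gluing to compatibility *)

Section Converse.
Hypothesis gluedP : forall Q, finitely_generated (lquad_mod Q) ->
  gorenstein_projective (lquad_mod Q) <-> glued Q.

Lemma glued_of_gorenstein Q : gorenstein_projective (lquad_mod Q) -> glued Q.
Proof. by move=> QG; apply/gluedP => //; apply: gorenstein_fg. Qed.

(** The induced quadruple is mono and has [G] and [H] as its cokernels. *)
Lemma free_quad_gorenstein G H :
  gorenstein_projective G -> gorenstein_projective H ->
  gorenstein_projective (lquad_mod (free_quad M N G H)).
Proof.
move=> GG HG; apply/gluedP.
  by apply: free_quad_fg; apply: gorenstein_fg.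
split; [exact: free_f_mono | exact: free_g_mono | |].
  apply: gorenstein_iso HG.
  exact: right_exact_uniq (free_coker_f M N G H) (coker_right_exact _).
apply: gorenstein_iso GG.
exact: right_exact_uniq (free_coker_g M N G H) (coker_right_exact _).
Qed.

(** Embed the quadruple induced from [(G, 0)] in a projective one by a step:
    both are mono, so the map of cokernels out of [G] stays injective after
    tensoring with [M]. *)
Lemma right_compatible_M : right_semi_weakly_compatible (right_of M).
Proof.
apply: right_compatible_of_embeddings => G GG.
pose Q := free_quad M N G 'rV[B]_0.
have QG : gorenstein_projective (lquad_mod Q).
  apply: free_quad_gorenstein => //; exact: gorenstein_rV0.
have [F [Q' [phi [psi [Q'G [Ffg Fpr ex _]]]]]] := quad_step_up QG.
exists (coker_mod (lqg Q)), (coker_mod (lqg F)), (cokg_map phi); split.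
- exact: right_exact_uniq (free_coker_g M N G _) (coker_right_exact _).
- exact: (coker_fg Ffg).1.
- exact: (coker_projective Fpr).1.
- apply: (tensor_cokg_inj ex (projective_mono Fpr).1).
  exact: free_f_mono.
Qed.

Lemma right_compatible_N : right_semi_weakly_compatible (right_of N).
Proof.
apply: right_compatible_of_embeddings => G GG.
pose Q := free_quad M N 'rV[A]_0 G.
have QG : gorenstein_projective (lquad_mod Q).
  apply: free_quad_gorenstein => //; exact: gorenstein_rV0.
have [F [Q' [phi [psi [Q'G [Ffg Fpr ex _]]]]]] := quad_step_up QG.
exists (coker_mod (lqf Q)), (coker_mod (lqf F)), (cokf_map phi); split.
- exact: right_exact_uniq (free_coker_f M N _ G) (coker_right_exact _).
- exact: (coker_fg Ffg).2.
- exact: (coker_projective Fpr).2.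
- apply: (tensor_cokf_inj ex (projective_mono Fpr).2).
  exact: free_g_mono.
Qed.

Lemma free_quad_cover G H P R (p : {linear P -> G}) (q : {linear R -> H}) :
  surjective p -> surjective q ->
  exists psi : {linear lquad_mod (free_quad M N P R) ->
                       lquad_mod (free_quad M N G H)},
    surjective psi /\
    forall u t s r, psi ((u, t), (s, r)) =
      ((p u, ltensor_map q t), (ltensor_map p s, q r)).
Proof.
move=> pS qS; pose Q := free_quad M N G H.
have aP : linear (fun u => (p u, 0) : lqX Q).
  by move=> a u v; rewrite linearP; congr pair; rewrite /= scaler0 addr0.
have bP : linear (fun r => (0, q r) : lqY Q).
  by move=> a u v; rewrite linearP; congr pair; rewrite /= scaler0 addr0.
have [psi psiE] := free_quad_map (Q := Q) (linear_of aP) (linear_of bP).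
have psiE' u t s r : psi ((u, t), (s, r)) =
    ((p u, ltensor_map q t), (ltensor_map p s, q r)).
  rewrite psiE /= /free_f /free_g.
  rewrite (ltensor_map_comp (h := q)) // (ltensor_map_comp (h := p)) //.
  by congr (_, _, (_, _)); rewrite /= ?addr0 ?add0r.
exists psi; split=> // -[[x t] [s y]].
have [u <-] := pS x; have [v <-] := qS y.
have [t' <-] := ltensor_map_surj qS t; have [s' <-] := ltensor_map_surj pS s.
by exists ((u, t'), (s', v)).
Qed.

(** Ext^1 of a Gorenstein-projective quadruple into the columns of L vanishes;
    it is read off here on a presentation of the induced quadruple by another
    induced quadruple. *)
Lemma free_quad_ext1 G H P R (p : {linear P -> G}) (q : {linear R -> H}) :
  gorenstein_projective G -> gorenstein_projective H ->
  surjective p -> surjective q ->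
  exists K (phi : {linear lquad_mod K -> lquad_mod (free_quad M N P R)}),
  exists psi : {linear _ -> lquad_mod (free_quad M N G H)},
    [/\ short_exact phi psi,
       forall u t s r, psi ((u, t), (s, r)) =
         ((p u, ltensor_map q t), (ltensor_map p s, q r)),
       extends phi (lquad_mod (colA M N)) &
       extends phi (lquad_mod (colB M N))].
Proof.
move=> GG HG pS qS; have [psi [psiS psiE]] := free_quad_cover pS qS.
have [K [phi ex]] := quad_kernel psiS; exists K, phi, psi.
have /extends_regular[] // : extends phi L^o.
have QG := free_quad_gorenstein GG HG.
exact: compatible_ext1 (@regular_compatible L) QG _ _ _ _ ex.
Qed.

(** A map [K0 -> N] from the kernel of [P -> G] gives a map from the kernel
    quadruple to [(N, B)], zero in the second component; an extension of it to
    the quadruple induced from [(P, 0)] restricts to [P]. *)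
Lemma left_compatible_N : left_semi_weakly_compatible N.
Proof.
apply: compatible_of_ext1 => G GG.
have [_ [K0 [K0g [P [i [p [Pfg Ppr iex _]]]]]]] := gorenstein_closed GG.
apply: (ext1_of_extends Ppr iex) => chi.
have [iI [pS pK]] := iex.
have idS : surjective (idfun : {linear 'rV[B]_0 -> 'rV[B]_0}).
  by move=> y; exists y.
have [K [phi [psi [[phiI [_ phiK]] psiE _ extB]]]] :=
  free_quad_ext1 GG (gorenstein_rV0 B) pS idS.
(* The first coordinate of the kernel quadruple projects to [K0]. *)
have thP x : exists u, i u = (fst_map phi x).1.
  apply/pK; have : psi (phi (x, 0)) = 0 by apply/phiK; exists (x, 0).
  rewrite quad_mapE; case: (fst_map phi x) => u t.
  by case: (snd_map phi 0) => s r; rewrite psiE => -[].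
have fP : linear (fun x => (fst_map phi x).1 : P).
  by move=> a x y; rewrite linearP.
have [th thE] := factor_inj (h := linear_of fP) iI thP.
have [n y|m x|h hE] :=
    @quad_map_ex _ _ _ _ K (colB M N) (chi \o th : {linear _ -> _}) \0.
- rewrite /= ltensr0 linear0.
  suff -> : th (lqg K (ltens n y)) = 0 by rewrite linear0.
  by apply: iI; rewrite thE /= fst_map_g linear0.
- by [].
have [k kE] := extB h.
have k0P : linear (fun u : P => fst_map k (u, 0) : lqX (colB M N)).
  move=> a u v; rewrite -linearP; congr (fst_map k _).
  by congr pair; rewrite /= scaler0 addr0.
exists (linear_of k0P) => u /=.
have /phiK[[x y] xyE] : psi ((i u, 0), (0, 0)) = 0.
  rewrite psiE !linear0; have -> : p (i u) = 0 by apply/pK; exists u.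
  by [].
have xE : fst_map phi x = (i u, 0) by move: xyE; rewrite quad_mapE => -[].
rewrite -xE -(fst_map_comp kE) /fst_map hE /=; congr (chi _).
by apply: iI; rewrite thE /= xE.
Qed.

Lemma left_compatible_M : left_semi_weakly_compatible M.
Proof.
apply: compatible_of_ext1 => G GG.
have [_ [K0 [K0g [P [i [p [Pfg Ppr iex _]]]]]]] := gorenstein_closed GG.
apply: (ext1_of_extends Ppr iex) => chi.
have [iI [pS pK]] := iex.
have idS : surjective (idfun : {linear 'rV[A]_0 -> 'rV[A]_0}).
  by move=> y; exists y.
have [K [phi [psi [[phiI [_ phiK]] psiE extA _]]]] :=
  free_quad_ext1 (gorenstein_rV0 A) GG idS pS.
(* The second coordinate of the kernel quadruple projects to [K0]. *)
have thP x : exists u, i u = (snd_map phi x).2.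
  apply/pK; have : psi (phi (0, x)) = 0 by apply/phiK; exists (0, x).
  rewrite quad_mapE; case: (fst_map phi 0) => u t.
  by case: (snd_map phi x) => s r; rewrite psiE => -[].
have fP : linear (fun x => (snd_map phi x).2 : P).
  by move=> a x y; rewrite linearP.
have [th thE] := factor_inj (h := linear_of fP) iI thP.
have [n y|m x|h hE] :=
    @quad_map_ex _ _ _ _ K (colA M N) \0 (chi \o th : {linear _ -> _}).
- by [].
- rewrite /= ltensr0 linear0.
  suff -> : th (lqf K (ltens m x)) = 0 by rewrite linear0.
  by apply: iI; rewrite thE /= snd_map_f linear0.
have [k kE] := extA h.
have k0P : linear (fun u : P => snd_map k (0, u) : lqY (colA M N)).
  move=> a u v; rewrite -linearP; congr (snd_map k _).
  by congr pair; rewrite /= scaler0 addr0.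
exists (linear_of k0P) => u /=.
have /phiK[[x y] xyE] : psi ((0, 0), (0, i u)) = 0.
  rewrite psiE !linear0; have -> : p (i u) = 0 by apply/pK; exists u.
  by [].
have xE : snd_map phi y = (0, i u) by move: xyE; rewrite quad_mapE => -[].
rewrite -xE -(snd_map_comp kE) /snd_map hE /=; congr (chi _).
by apply: iI; rewrite thE /= xE.
Qed.

(** Maps from a quadruple to [(N, 0)] are maps from its cokernel of [g] to [N],
    and the cokernels form a short exact sequence. *)
Lemma left_compatible_column :
  left_semi_weakly_compatible (lquad_mod (lquad_l M N N)).
Proof.
apply: compatible_of_ext1 => G GG; have [Q QG] := module_is_quad G.
apply: (ext1_zero_iso QG).
have {GG} Qg : gorenstein_projective (lquad_mod Q).
  exact: gorenstein_iso (lmod_iso_sym QG) GG.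
have [F [K [phi [psi [_ [_ Fpr ex _]]]]]] := quad_step_down Qg.
have [_ Qgm _ gG] := glued_of_gorenstein Qg.
apply: (ext1_of_extends Fpr ex); apply/extends_zero_quad.
split; last exact: extends_rV0.
apply: (compatible_ext1 left_compatible_N gG (p := cokg_map psi)).
split; last exact: cokg_right_exact.
exact: cokg_map_inj ex (projective_mono Fpr).2 Qgm.
Qed.

Lemma right_compatible_row :
  right_semi_weakly_compatible (rquad_mod (rquad_l M N (right_of M))).
Proof.
apply: right_compatible_of_embeddings => V VG.
have [Q QV] := module_is_quad V.
have Qg : gorenstein_projective (lquad_mod Q).
  exact: gorenstein_iso (lmod_iso_sym QV) VG.
have [F [Q' [phi [psi [_ [Ffg Fpr ex _]]]]]] := quad_step_up Qg.
have [Qfm _ _ _] := glued_of_gorenstein Qg.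
exists (lquad_mod Q), (lquad_mod F), phi; split=> //; first exact: lmod_iso_sym.
apply/tensor_cokg_injP.
exact: tensor_cokg_inj ex (projective_mono Fpr).1 Qfm.
Qed.

End Converse.

End GorensteinQuads.

(** * The equivalence *)

Lemma im_iso_glued (A B : pzRingType) (M : bimodType B A) (N : bimodType A B)
    (Q : lquad M N) :
  left_noetherian A -> left_noetherian B ->
  finitely_generated M -> finitely_generated N ->
  finitely_generated (lquad_mod Q) ->
  glued Q <->
  [/\ gorenstein_projective (coker_mod (lqf Q)),
      gorenstein_projective (coker_mod (lqg Q)),
      lmod_iso (im_mod (lqf Q)) (ltensor M (coker_mod (lqg Q)))
    & lmod_iso (im_mod (lqg Q)) (ltensor N (coker_mod (lqf Q)))].
Proof.
move=> An Bn Mfg Nfg Qfg; have [gfg ffg] := coker_fg Qfg.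
have fP := im_isoP Bn (ltensor_fg Mfg gfg) (coker_right_exact (lqg Q)).1
  (@lqf_coker _ _ _ _ Q).
have gP := im_isoP An (ltensor_fg Nfg ffg) (coker_right_exact (lqf Q)).1
  (@lqg_coker _ _ _ _ Q).
by split=> [[/fP ? /gP ? ? ?]|[? ? /fP ? /gP ?]].
Qed.

Theorem proposition3p14 (A B : pzRingType)
    (M : bimodType B A) (N : bimodType A B) :
  noetherian A -> noetherian B ->
  finitely_generated M -> finitely_generated (right_of M) ->
  finitely_generated N -> finitely_generated (right_of N) ->
  [/\ weakly_compatible N, weakly_compatible M,
      left_semi_weakly_compatible (lquad_mod (lquad_l M N N))
    & right_semi_weakly_compatible (rquad_mod (rquad_l M N (right_of M)))]
  <->
  (forall Q : lquad M N,
    finitely_generated (lquad_mod Q) ->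
    (gorenstein_projective (lquad_mod Q) <->
      [/\ gorenstein_projective (coker_mod (lqf Q)),
          gorenstein_projective (coker_mod (lqg Q)),
          lmod_iso (im_mod (lqf Q)) (ltensor M (coker_mod (lqg Q)))
        & lmod_iso (im_mod (lqg Q)) (ltensor N (coker_mod (lqf Q)))])).
Proof.
move=> [An _] [Bn _] Mfg _ Nfg _.
have isoP Q := @im_iso_glued A B M N Q An Bn Mfg Nfg.
split=> [[Nc Mc Ncol Mrow] Q Qfg|H].
  split=> [QG|/(isoP Q Qfg)]; last exact: glued_gorenstein.
  by apply/(isoP Q Qfg); apply: gorenstein_glued.
have gluedP (Q : lquad M N) : finitely_generated (lquad_mod Q) ->
    gorenstein_projective (lquad_mod Q) <-> glued Q.
  by move=> Qfg; split=> [/(H Q Qfg)/(isoP Q Qfg)|/(isoP Q Qfg)/(H Q Qfg)].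
split.
- split; first exact: (left_compatible_N gluedP).
  exact: (right_compatible_N gluedP).
- split; first exact: (left_compatible_M gluedP).
  exact: (right_compatible_M gluedP).
- exact: (left_compatible_column gluedP).
- exact: (right_compatible_row gluedP).
Qed.
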